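(* Let $f,g$ satisfy the standing assumption (a)–(f) of the context, let $\boldsymbol{x}_0\in\mathbb{R}^{d_x}$, $\epsilon>0$, let $m\ge1$ be an integer, $\Delta=\varphi(\boldsymbol{x}_0)-\varphi^*$ and $R=\max\{\|\boldsymbol{y}^*(\boldsymbol{x}_0)\|,\|\boldsymbol{y}_\lambda^*(\boldsymbol{x}_0)\|\}$. Run the LFSBA algorithm of the context with $M=\Omega(m\bar\rho)$, $T=\Theta(\Delta\sqrt M\,\epsilon^{-3/2})$, $\kappa_1=\kappa$, $\ell_1=\ell$, $\kappa_2=3\kappa$, $\ell_2=(1+\lambda)\ell$, $$\lambda=\max\Big\{\frac{\bar\ell\kappa^2}{\Delta},\frac{\bar\ell\kappa^3}{\epsilon},\frac{\bar\ell\kappa^5}{\sqrt{M\epsilon}}\Big\},\qquad \tilde\epsilon=\min\Big\{\frac{\bar C_g\epsilon}{4\lambda\ell},\frac{\bar C_H\sqrt{M\epsilon}}{2C_2}\Big\},\quad \bar C_g=\tfrac1{576},\ \bar C_H=\tfrac1{288},$$ and $$K_t^1=K_t^2=\begin{cases}\Big\lceil 2\sqrt{\kappa_2}\,\log\Big(\frac{\sqrt{\kappa_2+1}}{\tilde\epsilon}R\Big)\Big\rceil, & t=0,\\[2mm] \Big\lceil 2\sqrt{\kappa_2}\,\log\Big(\frac{\sqrt{\kappa_2+1}}{\tilde\epsilon}\big(\tilde\epsilon+4\kappa\|\boldsymbol{s}^*_{t-1}\|\big)\Big)\Big\rceil, & t\ge1.\end{cases}$$ Then the output $\hat{\boldsymbol{x}}$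 is an $\big(\mathcal{O}(\epsilon),\mathcal{O}(\kappa^{2.5}\bar\ell^{0.5}m^{0.5}\epsilon^{0.5})\big)$-second-order stationary point of $\varphi$. Furthermore, the first-order and second-order oracle complexities of the algorithm are bounded by $\tilde{\mathcal{O}}(\kappa^3\bar\ell^{0.5}m^{0.5}\epsilon^{-1.5})$ and $\mathcal{O}(1+\kappa^{2.5}\bar\ell^{0.5}m^{-0.5}\epsilon^{-1.5})$, respectively.
   Context: **Problem.** $f,g:\mathbb{R}^{d_x}\times\mathbb{R}^{d_y}\to\mathbb{R}$; $\boldsymbol{y}^*(\boldsymbol{x})=\arg\min_{\boldsymbol{y}}g(\boldsymbol{x},\boldsymbol{y})$, $\varphi(\boldsymbol{x})=f(\boldsymbol{x},\boldsymbol{y}^*(\boldsymbol{x}))$, to be minimized over $\boldsymbol{x}$. **Standing assumption.** (a) $g$ is three times differentiable and $\mu$-strongly convex in $\boldsymbol{y}$ for each fixed $\boldsymbol{x}$; (b) $f$ is twice differentiable and $C$-Lipschitz in $(\boldsymbol{x},\boldsymbol{y})$; (c) $\nabla f,\nabla g$ are $\ell$-Lipschitz; (d) $\nabla^2f,\nabla^2g$ are $\rho$-Lipschitz; (e) the third-order derivative of $g$ is $\nu$-Lipschitz; (f) $\varphi^*:=\min_{\boldsymbol{x}}\varphi(\boldsymbol{x})>-\infty$. Put $\bar\ell=\max\{C,\ell,\nu,\rho\}$ and $\kappa=\bar\ell/\mu$. Norms are Euclidean/spectral. **Penalty function.** $\mathcal{L}_\lambda(\boldsymbol{x},\boldsymbol{y})=f(\boldsymbol{x},\boldsymbol{y})+\lambda\big(g(\boldsymbol{x},\boldsymbol{y})-g(\boldsymbol{x},\boldsymbol{y}^*(\boldsymbol{x}))\big)$,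 $\boldsymbol{y}_\lambda^*(\boldsymbol{x})=\arg\min_{\boldsymbol{y}}\mathcal{L}_\lambda(\boldsymbol{x},\boldsymbol{y})$, $\mathcal{L}_\lambda^*(\boldsymbol{x})=\mathcal{L}_\lambda(\boldsymbol{x},\boldsymbol{y}_\lambda^*(\boldsymbol{x}))$. The blocks used below are $\nabla_{xy}^2\mathcal{L}_\lambda=\nabla_{xy}^2f+\lambda\nabla_{xy}^2g$, $\nabla_{yy}^2\mathcal{L}_\lambda=\nabla_{yy}^2f+\lambda\nabla_{yy}^2g$, $\nabla^2_{yx}\mathcal{L}_\lambda=(\nabla^2_{xy}\mathcal{L}_\lambda)^\top$. For $\lambda\ge2\ell/\mu$ it is known that $\mathcal{L}_\lambda(\boldsymbol{x},\cdot)$ is $(\lambda\mu/2)$-strongly convex and $(1+\lambda)\ell$-smooth and that $\nabla^2\mathcal{L}_\lambda^*$ is $\bar\rho$-Lipschitz with $\bar\rho=\mathcal{O}(\bar\ell\kappa^5)$; this is the $\bar\rho$ used in the claim and in the algorithm. **Estimators.** $\mathbf{g}(\boldsymbol{x};\boldsymbol{y},\boldsymbol{w})=\nabla_xf(\boldsymbol{x},\boldsymbol{y})+\lambda(\nabla_xg(\boldsymbol{x},\boldsymbol{y})-\nabla_xg(\boldsymbol{x},\boldsymbol{w}))$, $\mathbf{H}(\boldsymbol{x};\boldsymbol{y},\boldsymbol{w})=\nabla_{xx}^2f(\boldsymbol{x},\boldsymbol{y})+\lambda(\nabla_{xx}^2g(\boldsymbol{x},\boldsymbol{y})-\nabla_{xx}^2g(\boldsymbol{x},\boldsymbol{w}))-\nabla_{xy}^2\mathcal{L}_\lambda(\boldsymbol{x},\boldsymbol{y})[\nabla_{yy}^2\mathcal{L}_\lambda(\boldsymbol{x},\boldsymbol{y})]^{-1}\nabla_{yx}^2\mathcal{L}_\lambda(\boldsymbol{x},\boldsymbol{y})+\lambda\nabla_{xy}^2g(\boldsymbol{x},\boldsymbol{w})[\nabla_{yy}^2g(\boldsymbol{x},\boldsymbol{w})]^{-1}\nabla_{yx}^2g(\boldsymbol{x},\boldsymbol{w})$.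 $C_2=\mathcal{O}(\lambda\bar\ell\kappa^2)$ is the coefficient of $\|\boldsymbol{y}-\boldsymbol{y}_\lambda^*(\boldsymbol{x})\|$ in the bound for $\|\nabla^2\mathcal{L}_\lambda^*(\boldsymbol{x})-\mathbf{H}(\boldsymbol{x};\boldsymbol{y},\boldsymbol{w})\|$ in terms of $\|\boldsymbol{w}-\boldsymbol{y}^*(\boldsymbol{x})\|$ and $\|\boldsymbol{y}-\boldsymbol{y}_\lambda^*(\boldsymbol{x})\|$; explicitly $C_2=\rho+\lambda\rho+(\ell+\lambda\ell)\Big(\frac{4(\rho+\lambda\rho)}{\lambda\mu}+\frac{4(\rho+\lambda\rho)(\ell+\lambda\ell)}{\lambda^2\mu^2}\Big)$. **AGD**$(h,\boldsymbol{z}_0,K,\eta,\theta)$: set $\tilde{\boldsymbol{z}}_0=\boldsymbol{z}_0$; for $k=0,\dots,K-1$: $\boldsymbol{z}_{k+1}=\tilde{\boldsymbol{z}}_k-\eta\nabla h(\tilde{\boldsymbol{z}}_k)$, $\tilde{\boldsymbol{z}}_{k+1}=\boldsymbol{z}_{k+1}+\theta(\boldsymbol{z}_{k+1}-\boldsymbol{z}_k)$; return $\boldsymbol{z}_K$. **LFSBA.** Input $\boldsymbol{x}_0$, $\boldsymbol{y}_{-1}=\boldsymbol{w}_{-1}=\mathbf{0}$. For $t=0,\dots,T-1$: $\boldsymbol{w}_t=\mathrm{AGD}(g(\boldsymbol{x}_t,\cdot),\boldsymbol{w}_{t-1},K_t^1,\frac1{\ell_1},\frac{\sqrt{\kappa_1}-1}{\sqrt{\kappa_1}+1})$;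 $\boldsymbol{y}_t=\mathrm{AGD}(\mathcal{L}_\lambda(\boldsymbol{x}_t,\cdot),\boldsymbol{y}_{t-1},K_t^2,\frac1{\ell_2},\frac{\sqrt{\kappa_2}-1}{\sqrt{\kappa_2}+1})$; $\mathbf{g}_t=\mathbf{g}(\boldsymbol{x}_t;\boldsymbol{y}_t,\boldsymbol{w}_t)$; if $t$ is divisible by $m$, set $\tilde{\boldsymbol{x}}=\boldsymbol{x}_t$ and $\tilde{\mathbf{H}}=\mathbf{H}(\boldsymbol{x}_t;\boldsymbol{y}_t,\boldsymbol{w}_t)$ (otherwise keep the previous ones); $\boldsymbol{s}_t^*=\arg\min_{\boldsymbol{s}}\{\mathbf{g}_t^\top\boldsymbol{s}+\frac12\boldsymbol{s}^\top\tilde{\mathbf{H}}\boldsymbol{s}+\frac M6\|\boldsymbol{s}\|^3\}$; $\boldsymbol{x}_{t+1}=\boldsymbol{x}_t+\boldsymbol{s}_t^*$; stop if $\epsilon\ge\frac1M\big(\frac{288}{287}\big)^2\big(\frac{M+2\bar\rho}{\sqrt2}\|\boldsymbol{s}_t^*\|+\bar\rho\|\tilde{\boldsymbol{x}}-\boldsymbol{x}_t\|\big)^2$. Output $\hat{\boldsymbol{x}}=\boldsymbol{x}_{t+1}$ for the last $t$. **Terminology.** A point $\hat{\boldsymbol{x}}$ is an $(\epsilon,\tau)$-second-order stationary point of $\varphi$ if $\|\nabla\varphi(\hat{\boldsymbol{x}})\|\le\epsilon$ and $\lambda_{\min}(\nabla^2\varphi(\hat{\boldsymbol{x}}))\ge-\tau$.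 First-order (second-order) oracle complexity is the total number of evaluations of first partial gradients (second-derivative blocks) of $f$ and $g$. $\mathcal{O}$ hides absolute constants, $\Omega$ is a lower bound up to a constant factor, $\Theta$ both; $\tilde{\mathcal{O}}$ additionally hides polylogarithmic factors.
   Formalization: Both oracle complexity bounds carry an explicit factor Δ (false with absolute constants as Δ grows); M is also bounded above by a constant times m·ℓ̄·κ⁵, on which hidden constants depend; λ ≥ 2ℓ/μ, Δ > 0, ρ > 0 and M > 0 are assumed so that the objects are defined. *)

(* Defs.v *)
From HB Require Import structures.
From mathcomp Require Import all_boot all_order all_algebra.
From mathcomp Require Import all_classical all_reals all_analysis.

Set Implicit Arguments.
Unset Strict Implicit.
Unset Printing Implicit Defensive.

Import Order.TTheory GRing.Theory Num.Theory.
Import numFieldNormedType.Exports.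

Local Open Scope classical_set_scope.
Local Open Scope ring_scope.

Section Euclidean.
Variable R : realType.

(* The library norm on matrices is the sup norm, hence the explicit
   Euclidean and spectral norms.  Differentiability in finite dimension does
   not depend on the norm. *)
Definition enorm n (v : 'cV[R]_n) : R := Num.sqrt (\sum_i v i 0 ^+ 2).

Definition spnorm m n (A : 'M[R]_(m, n)) : R :=
  sup [set enorm (A *m v) | v in [set v : 'cV[R]_n | enorm v <= 1]].

(* Operator norm of the trilinear form (u, v, w) |-> w^T *m T u *m v. *)
Definition trinorm n (T : 'cV[R]_n -> 'M[R]_n) : R :=
  sup [set spnorm (T u) | u in [set u : 'cV[R]_n | enorm u <= 1]].

Definition grad n (h : 'cV[R]_n -> R) (z : 'cV[R]_n) : 'cV[R]_n :=
  \col_i 'D_(delta_mx i 0) h z.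

Definition hess n (h : 'cV[R]_n -> R) (z : 'cV[R]_n) : 'M[R]_n :=
  \matrix_(i, j) 'D_(delta_mx j 0) (fun z' => grad h z' i 0) z.

Definition twice_differentiable n (h : 'cV[R]_n -> R) : Prop :=
  forall z, differentiable h z /\ differentiable (grad h) z.

Definition thrice_differentiable n (h : 'cV[R]_n -> R) : Prop :=
  twice_differentiable h /\ forall z, differentiable (hess h) z.

Definition lipschitz_fun n (c : R) (h : 'cV[R]_n -> R) : Prop :=
  forall z z', `|h z - h z'| <= c * enorm (z - z').

Definition lipschitz_grad n (c : R) (h : 'cV[R]_n -> R) : Prop :=
  forall z z', enorm (grad h z - grad h z') <= c * enorm (z - z').

Definition lipschitz_hess n (c : R) (h : 'cV[R]_n -> R) : Prop :=
  forall z z', spnorm (hess h z - hess h z') <= c * enorm (z - z').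

Definition lipschitz_third n (c : R) (h : 'cV[R]_n -> R) : Prop :=
  forall z z', trinorm (fun u => 'D_u (hess h) z - 'D_u (hess h) z')
               <= c * enorm (z - z').

Definition strongly_convex n (mu : R) (h : 'cV[R]_n -> R) : Prop :=
  forall (z z' : 'cV[R]_n) (t : R), 0 <= t <= 1 ->
    h (t *: z + (1 - t) *: z')
    <= t * h z + (1 - t) * h z' - mu / 2 * t * (1 - t) * enorm (z - z') ^+ 2.

Definition is_argmin n (h : 'cV[R]_n -> R) (z : 'cV[R]_n) : Prop :=
  forall z', h z <= h z'.

(* Only applied to functions with a unique minimizer. *)
Definition argmin n (h : 'cV[R]_n -> R) : 'cV[R]_n := xget 0 (is_argmin h).

(* Only applied to symmetric matrices, for which the set is nonempty. *)
Definition lambda_min n (A : 'M[R]_n) : R := inf [set a | eigenvalue A a].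

Definition second_order_stationary n (h : 'cV[R]_n -> R) (eps tau : R)
    (x : 'cV[R]_n) : Prop :=
  enorm (grad h x) <= eps /\ - tau <= lambda_min (hess h x).

(* Accelerated gradient descent; the state after k steps is
   (z_k, tilde z_k). *)
Fixpoint agd_state n (h : 'cV[R]_n -> R) (z0 : 'cV[R]_n) (eta theta : R)
    (k : nat) : 'cV[R]_n * 'cV[R]_n :=
  if k is k'.+1 then
    let: (z, zt) := agd_state h z0 eta theta k' in
    let z1 := zt - eta *: grad h zt in
    (z1, z1 + theta *: (z1 - z))
  else (z0, z0).

Definition agd n (h : 'cV[R]_n -> R) (z0 : 'cV[R]_n) (k : nat)
    (eta theta : R) : 'cV[R]_n := (agd_state h z0 eta theta k).1.

(* The ceiling as a number of iterations: a negative ceiling means that no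
   iteration is performed. *)
Definition natceil (r : R) : nat := absz (Num.max 0%R (Num.ceil r)).

End Euclidean.

Section Bilevel.
Variables (R : realType) (dx dy : nat).

(* A function of (x, y) in R^dx * R^dy is a function on R^(dx + dy), evaluated
   at the stacked vector col_mx x y. *)
Implicit Types (f g : 'cV[R]_(dx + dy) -> R).
Implicit Types (x : 'cV[R]_dx) (y w : 'cV[R]_dy).

Definition gradx f x y : 'cV[R]_dx := usubmx (grad f (col_mx x y)).
Definition hessxx f x y : 'M[R]_dx := ulsubmx (hess f (col_mx x y)).
Definition hessxy f x y : 'M[R]_(dx, dy) := ursubmx (hess f (col_mx x y)).
Definition hessyy f x y : 'M[R]_dy := drsubmx (hess f (col_mx x y)).

Definition ystar g x : 'cV[R]_dy := argmin (fun y => g (col_mx x y)).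

Definition hyperobj f g x : R := f (col_mx x (ystar g x)).

Definition hyperobj_inf f g : R := inf (range (hyperobj f g)).

(* If rho = 0 the tolerance tilde epsilon divides by C_2 = 0, so rho is taken
   positive; C, ell and nu are automatically nonnegative. *)
Record standing_assumption f g (mu C ell rho nu : R) : Prop := {
  sa_mu : 0 < mu ;
  sa_rho : 0 < rho ;
  sa_g_diff : thrice_differentiable g ;
  sa_g_sc : forall x, strongly_convex mu (fun y => g (col_mx x y)) ;
  sa_f_diff : twice_differentiable f ;
  sa_f_lip : lipschitz_fun C f ;
  sa_f_grad : lipschitz_grad ell f ;
  sa_g_grad : lipschitz_grad ell g ;
  sa_f_hess : lipschitz_hess rho f ;
  sa_g_hess : lipschitz_hess rho g ;
  sa_g_third : lipschitz_third nu g ;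
  sa_bounded : has_lbound (range (hyperobj f g))
}.

Definition ellbar (C ell rho nu : R) : R :=
  Num.max C (Num.max ell (Num.max nu rho)).

Definition penalty f g (lam : R) x y : R :=
  f (col_mx x y) + lam * (g (col_mx x y) - g (col_mx x (ystar g x))).

Definition ylam f g lam x : 'cV[R]_dy := argmin (penalty f g lam x).

Definition penalty_opt f g lam x : R := penalty f g lam x (ylam f g lam x).

Definition Lxy f g (lam : R) x y : 'M[R]_(dx, dy) :=
  hessxy f x y + lam *: hessxy g x y.

Definition Lyy f g (lam : R) x y : 'M[R]_dy :=
  hessyy f x y + lam *: hessyy g x y.

Definition gest f g (lam : R) x y w : 'cV[R]_dx :=
  gradx f x y + lam *: (gradx g x y - gradx g x w).

Definition Hest f g (lam : R) x y w : 'M[R]_dx :=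
  hessxx f x y + lam *: (hessxx g x y - hessxx g x w)
  - Lxy f g lam x y *m invmx (Lyy f g lam x y) *m (Lxy f g lam x y)^T
  + lam *: (hessxy g x w *m invmx (hessyy g x w) *m (hessxy g x w)^T).

Definition cubic_model (M : R) (gv : 'cV[R]_dx) (H : 'M[R]_dx)
    (s : 'cV[R]_dx) : R :=
  (gv^T *m s) 0 0 + 2^-1 * (s^T *m H *m s) 0 0 + M / 6 * enorm s ^+ 3.

(* Index of the last iteration, up to t, at which the Hessian was refreshed. *)
Definition snapshot (m t : nat) : nat := (t %/ m * m)%N.

Definition stop_test (M rhobar eps : R) (m : nat) (xs ss : nat -> 'cV[R]_dx)
    (t : nat) : Prop :=
  M^-1 * (288 / 287) ^+ 2
  * ((M + 2 * rhobar) / Num.sqrt 2 * enorm (ss t)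
     + rhobar * enorm (xs (snapshot m t) - xs t)) ^+ 2 <= eps.

Definition momentum (k : R) : R := (Num.sqrt k - 1) / (Num.sqrt k + 1).

(* Value preceding the t-th one in a sequence whose term of index -1 is 0. *)
Definition previous (v : nat -> 'cV[R]_dy) (t : nat) : 'cV[R]_dy :=
  if t is t'.+1 then v t' else 0.

(* (xs, ys, ws, ss) is an execution of the algorithm which performs exactly
   the N iterations t = 0, ..., N-1; its output is xs N.  It is a relation
   because the cubic subproblem may have several minimizers.  Values of the
   sequences beyond the last iteration are irrelevant. *)
Record lfsba_run f g (lam M rhobar eps : R) (m T : nat)
    (kappa1 ell1 kappa2 ell2 : R) (K1 K2 : nat -> nat) (x0 : 'cV[R]_dx)
    (xs : nat -> 'cV[R]_dx) (ys ws : nat -> 'cV[R]_dy)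
    (ss : nat -> 'cV[R]_dx) (N : nat) : Prop := {
  run_init : xs 0%N = x0 ;
  run_w : forall t, (t < N)%N ->
    ws t = agd (fun w => g (col_mx (xs t) w)) (previous ws t) (K1 t)
               ell1^-1 (momentum kappa1) ;
  run_y : forall t, (t < N)%N ->
    ys t = agd (penalty f g lam (xs t)) (previous ys t) (K2 t)
               ell2^-1 (momentum kappa2) ;
  run_s : forall t, (t < N)%N ->
    let t0 := snapshot m t in
    is_argmin (cubic_model M (gest f g lam (xs t) (ys t) (ws t))
                             (Hest f g lam (xs t0) (ys t0) (ws t0))) (ss t) ;
  run_x : forall t, (t < N)%N -> xs t.+1 = xs t + ss t ;
  run_N : (0 < N <= T)%N ;
  run_continue : forall t, (t.+1 < N)%N -> ~ stop_test M rhobar eps m xs ss t ;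
  run_halt : N = T \/ stop_test M rhobar eps m xs ss N.-1
}.

(* Evaluations of first partial gradients of f and g in N iterations: one per
   AGD step on g, two (one of f, one of g) per AGD step on the penalty
   function, three for the gradient estimator. *)
Definition first_order_calls (K1 K2 : nat -> nat) (N : nat) : nat :=
  (\sum_(t < N) (K1 t + 2 * K2 t + 3))%N.

(* Each refreshed Hessian estimator evaluates nine blocks: xx, xy, yy of f and
   of g at (x, y), and xx, xy, yy of g at (x, w). *)
Definition second_order_calls (m N : nat) : nat :=
  (\sum_(t < N | m %| t) 9)%N.

Definition lambda_choice (lb kappa Delta M eps : R) : R :=
  Num.max (lb * kappa ^+ 2 / Delta)
    (Num.max (lb * kappa ^+ 3 / eps) (lb * kappa ^+ 5 / Num.sqrt (M * eps))).

Definition C2 (mu ell rho lam : R) : R :=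
  rho + lam * rho
  + (ell + lam * ell)
    * (4 * (rho + lam * rho) / (lam * mu)
       + 4 * (rho + lam * rho) * (ell + lam * ell) / (lam ^+ 2 * mu ^+ 2)).

Definition eps_inner (mu ell rho lam M eps : R) : R :=
  Num.min (576^-1 * eps / (4 * lam * ell))
          (288^-1 * Num.sqrt (M * eps) / (2 * C2 mu ell rho lam)).

Definition inner_steps (kappa kappa2 epst Rad : R) (ss : nat -> 'cV[R]_dx)
    (t : nat) : nat :=
  natceil (2 * Num.sqrt kappa2
           * ln (Num.sqrt (kappa2 + 1) / epst
                 * (if t is t'.+1 then epst + 4 * kappa * enorm (ss t')
                    else Rad))).

End Bilevel.

(* Main.v *)
(* The value V x = min_y G(x, y) of a smooth G, strongly convex in y, has gradient
   the x-block of grad G and Hessian the Schur complement of hess G, both taken at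
   the minimizer.  Since L_lambda^* is the difference of the values of f + lambda g
   and lambda g, its gradient and Hessian are g(x; y, w) and H(x; y, w) at the exact
   inner solutions, and accelerated gradient descent makes the actual estimators
   accurate to O(eps) and O(sqrt (M eps)).  The inner solutions move by at most
   4 kappa |s_t| from one iteration to the next, which is what K_t pays for.

   With e = sqrt (eps / M), one lazy cubic Newton step decreases L_lambda^* by
   c M |s_t|^3, up to M e^3 / 576 and the cube of the drift from the snapshot, which
   the power mean inequality charges to the previous steps since M >= 100 m rhobar.
   An iteration which does not stop has e <= |s_t| + drift / m, so such iterations
   number O(Delta sqrt M eps^(-3/2)) and the stopping test succeeds before T.  It
   forces |s_t| = O(e), and the optimality conditions of the cubic model then make
   the output an (O(eps), O(sqrt (M eps)))-stationary point of L_lambda^*.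

   Finally |y_lambda^* - y^*| <= C / (lambda mu), and for the chosen lambda the
   gradients of L_lambda^* and phi differ by O(eps) and their Hessians by
   O(sqrt (M eps)).  The Hessian of phi, which involves the third derivative of g,
   is obtained by differentiating the Lagrangian gradient along a frozen lift. *)

(* No implicit function theorem and no derivative of an inverse matrix is used. The inner solutions,
   value functions and gradients get expansions with an explicit quadratic remainder, controlled by
   strong monotonicity in y, and directional derivatives are read off from them. The algebra rests
   on lifts [(u, J u)], with [J] the Jacobian of the inner solution: a Hessian applied to its own
   lift has zero y-block, so differences of Schur complements are bilinear in the difference of the
   Hessians.

   Constants: with [w = D / m] the normalized drift, a step gains [0.159 M s^3], of which [0.157]
   remains once the drift is charged. Failed tests give [N e^3 <= 8 sum s^3], which absorbs the
   [e^3 / 576] terms and leaves [0.14]. Against a total descent of at most [2 Delta] this yields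
   [N M e^3 <= 115 Delta], whence the factor 200 required of [T].

   For the logarithms the obstacle is a small [M]: the hypotheses bound it below only through
   [rhobar], which may be arbitrarily small. A polynomial lower bound follows from [1 <= T], and
   step lengths are bounded by the descent budget. *)
Require Import Defs.
From HB Require Import structures.
From mathcomp Require Import all_boot all_order all_algebra.
From mathcomp Require Import all_classical all_reals all_analysis.
From mathcomp Require Import ring lra zify.
Set Implicit Arguments.
Unset Strict Implicit.
Unset Printing Implicit Defensive.
Import Order.TTheory GRing.Theory Num.Theory.
Import numFieldNormedType.Exports.
Local Open Scope classical_set_scope.
Local Open Scope ring_scope.

(** * Euclidean and spectral norms *)

Section Euclid.
Variable R : realType.
Implicit Types (m n p : nat).

Definition dot n (u v : 'cV[R]_n) : R := \sum_i u i 0 * v i 0.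

Lemma dotC n (u v : 'cV[R]_n) : dot u v = dot v u.
Proof. by apply: eq_bigr => i _; rewrite mulrC. Qed.

Lemma dotDl n (u v w : 'cV[R]_n) : dot (u + v) w = dot u w + dot v w.
Proof. by rewrite -big_split; apply: eq_bigr => i _; rewrite mxE mulrDl. Qed.

Lemma dotZl n (a : R) (u w : 'cV[R]_n) : dot (a *: u) w = a * dot u w.
Proof. by rewrite mulr_sumr; apply: eq_bigr => i _; rewrite mxE mulrA. Qed.

Lemma dotDr n (u v w : 'cV[R]_n) : dot w (u + v) = dot w u + dot w v.
Proof. by rewrite dotC dotDl !(dotC w). Qed.

Lemma dotZr n (a : R) (u w : 'cV[R]_n) : dot w (a *: u) = a * dot w u.
Proof. by rewrite dotC dotZl (dotC w). Qed.

Lemma dotNl n (u w : 'cV[R]_n) : dot (- u) w = - dot u w.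
Proof. by rewrite -scaleN1r dotZl mulN1r. Qed.

Lemma dotNr n (u w : 'cV[R]_n) : dot w (- u) = - dot w u.
Proof. by rewrite dotC dotNl dotC. Qed.

Lemma dotBl n (u v w : 'cV[R]_n) : dot (u - v) w = dot u w - dot v w.
Proof. by rewrite dotDl dotNl. Qed.

Lemma dotBr n (u v w : 'cV[R]_n) : dot w (u - v) = dot w u - dot w v.
Proof. by rewrite dotDr dotNr. Qed.

Lemma dot0l n (w : 'cV[R]_n) : dot 0 w = 0.
Proof. by rewrite -(scale0r 0) dotZl mul0r. Qed.

Lemma dot0r n (w : 'cV[R]_n) : dot w 0 = 0.
Proof. by rewrite dotC dot0l. Qed.

Lemma dot_delta n (w : 'cV[R]_n) i : dot w (delta_mx i 0) = w i 0.
Proof.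
rewrite /dot (bigD1 i) //= mxE !eqxx mulr1 big1 ?addr0 // => j ji.
by rewrite mxE (negbTE ji) mulr0.
Qed.

Lemma dotE n (u v : 'cV[R]_n) : (u^T *m v) 0 0 = dot u v.
Proof. by rewrite mxE; apply: eq_bigr => i _; rewrite mxE. Qed.

Lemma dot_mulmx m n (A : 'M[R]_(m, n)) u v : dot u (A *m v) = dot (A^T *m u) v.
Proof. by rewrite -!dotE trmx_mul trmxK mulmxA. Qed.

Lemma eq_dot n (u v : 'cV[R]_n) : (forall w, dot w u = dot w v) -> u = v.
Proof.
by move=> uv; apply/colP => i; rewrite -!dot_delta !(dotC _ (delta_mx _ _)) uv.
Qed.

Lemma dot_col_mx m n (a c : 'cV[R]_m) (b d : 'cV[R]_n) :
  dot (col_mx a b) (col_mx c d) = dot a c + dot b d.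
Proof.
rewrite /dot big_split_ord /=; congr (_ + _); apply: eq_bigr => i _.
  by rewrite !col_mxEu.
by rewrite !col_mxEd.
Qed.

Lemma dotvv_ge0 n (v : 'cV[R]_n) : 0 <= dot v v.
Proof. by apply: sumr_ge0 => i _; rewrite -expr2 sqr_ge0. Qed.

Lemma enorm_sqr n (v : 'cV[R]_n) : enorm v ^+ 2 = dot v v.
Proof.
rewrite sqr_sqrtr; first by apply: eq_bigr => i _; rewrite expr2.
by apply: sumr_ge0 => i _; exact: sqr_ge0.
Qed.

Lemma enorm_ge0 n (v : 'cV[R]_n) : 0 <= enorm v.
Proof. exact: sqrtr_ge0. Qed.

Hint Extern 0 (is_true (0 <= enorm _)) => exact: enorm_ge0 : core.

Lemma enormZ n (a : R) (v : 'cV[R]_n) : enorm (a *: v) = `|a| * enorm v.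
Proof.
apply/eqP; rewrite -(@eqrXn2 _ 2) ?mulr_ge0 ?enorm_ge0 //.
by rewrite exprMn !enorm_sqr dotZl dotZr mulrA -expr2 real_normK ?num_real.
Qed.

Lemma enormN n (v : 'cV[R]_n) : enorm (- v) = enorm v.
Proof. by rewrite -scaleN1r enormZ normrN1 mul1r. Qed.

Lemma enormBC n (u v : 'cV[R]_n) : enorm (u - v) = enorm (v - u).
Proof. by rewrite -enormN opprB. Qed.

Lemma enorm0 n : enorm (0 : 'cV[R]_n) = 0.
Proof. by rewrite -(scale0r 0) enormZ normr0 mul0r. Qed.

Lemma enorm0_eq0 n (v : 'cV[R]_n) : enorm v = 0 -> v = 0.
Proof.
move=> v0; have : dot v v = 0 by rewrite -enorm_sqr v0 expr0n.
move=> /eqP; rewrite psumr_eq0 => [|i _]; last by rewrite -expr2 sqr_ge0.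
move=> /allP vi; apply/colP => i; rewrite mxE.
by have := vi i (mem_index_enum _); rewrite /= mulf_eq0 orbb => /eqP.
Qed.

Lemma cauchy_schwarz n (u v : 'cV[R]_n) : dot u v <= enorm u * enorm v.
Proof.
have [v0|vn0] := eqVneq (enorm v) 0.
  by rewrite (enorm0_eq0 v0) dot0r enorm0 mulr0.
have vp : 0 < enorm v by rewrite lt_def vn0 enorm_ge0.
have [u0|un0] := eqVneq (enorm u) 0.
  by rewrite (enorm0_eq0 u0) dot0l enorm0 mul0r.
have up : 0 < enorm u by rewrite lt_def un0 enorm_ge0.
have := dotvv_ge0 (enorm v *: u - enorm u *: v).
rewrite dotBl !dotBr !dotZl !dotZr -!enorm_sqr (dotC v u) => h.
have uv : 0 < enorm u * enorm v by rewrite mulr_gt0.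
rewrite -subr_ge0 -(pmulr_rge0 _ uv).
by lra.
Qed.

Lemma norm_dot n (u v : 'cV[R]_n) : `|dot u v| <= enorm u * enorm v.
Proof.
rewrite ler_norml cauchy_schwarz andbT lerNl -dotNl -(enormN u).
exact: cauchy_schwarz.
Qed.

Lemma enormD n (u v : 'cV[R]_n) : enorm (u + v) <= enorm u + enorm v.
Proof.
rewrite -(@ler_pXn2r _ 2) ?nnegrE ?addr_ge0 //.
rewrite enorm_sqr dotDl !dotDr (dotC v u) -!enorm_sqr.
by have := cauchy_schwarz u v; lra.
Qed.

Lemma enormB n (u v : 'cV[R]_n) : enorm (u - v) <= enorm u + enorm v.
Proof. by rewrite -(enormN v) enormD. Qed.

Lemma enorm_triangle n (u v w : 'cV[R]_n) :
  enorm (u - w) <= enorm (u - v) + enorm (v - w).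
Proof. by rewrite -(subrKA v) enormD. Qed.

Lemma enorm_le_dot n (v : 'cV[R]_n) c : 0 <= c ->
  (forall w, dot w v <= c * enorm w) -> enorm v <= c.
Proof.
move=> c0 /(_ v); rewrite -enorm_sqr expr2.
have [->//|vn0] := eqVneq (enorm v) 0.
by rewrite ler_pM2r // lt_def vn0 enorm_ge0.
Qed.

Lemma enorm_sum n (I : Type) (r : seq I) (P : pred I) (F : I -> 'cV[R]_n) :
  enorm (\sum_(i <- r | P i) F i) <= \sum_(i <- r | P i) enorm (F i).
Proof.
elim/big_ind2 : _ => [|x1 x2 y1 y2 h1 h2|//]; first by rewrite enorm0.
by rewrite (le_trans (enormD _ _)) // lerD.
Qed.

Lemma enorm_coord n (v : 'cV[R]_n) i : `|v i 0| <= enorm v.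
Proof.
rewrite -dot_delta (le_trans (norm_dot _ _)) //.
suff -> : enorm (delta_mx i 0 : 'cV[R]_n) = 1 by rewrite mulr1.
apply/eqP; rewrite -(@eqrXn2 _ 2) // enorm_sqr dot_delta mxE !eqxx.
by rewrite expr1n.
Qed.

Lemma col_decomp n (v : 'cV[R]_n) : v = \sum_i v i 0 *: delta_mx i 0.
Proof.
rewrite {1}[v]matrix_sum_delta; apply: eq_bigr => i _.
by rewrite big_ord1.
Qed.

(** A crude bound by the images of the basis vectors. It makes the supremum in [spnorm] that of a
    bounded set, without which [sup] would be a default value. *)
Lemma enorm_mulmx_bounded m n (A : 'M[R]_(m, n)) :
  exists2 c, 0 <= c & forall v, enorm (A *m v) <= c * enorm v.
Proof.
exists (\sum_i enorm (A *m delta_mx i 0)); first exact: sumr_ge0.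
move=> v; rewrite {1}[v]col_decomp mulmx_sumr mulr_suml.
apply: (le_trans (enorm_sum _ _ _)); apply: ler_sum => i _.
by rewrite -scalemxAr enormZ mulrC ler_wpM2l // enorm_coord.
Qed.

Lemma spnorm_has_sup m n (A : 'M[R]_(m, n)) :
  has_sup [set enorm (A *m v) | v in [set v : 'cV[R]_n | enorm v <= 1]].
Proof.
split; first by exists (enorm (A *m 0)), 0; rewrite //= enorm0.
have [c c0 cA] := enorm_mulmx_bounded A.
exists c => _ [v /= v1 <-]; apply: (le_trans (cA v)).
by rewrite -[leRHS]mulr1 ler_wpM2l.
Qed.

Lemma spnorm_ge0 m n (A : 'M[R]_(m, n)) : 0 <= spnorm A.
Proof.
rewrite -(enorm0 m) -(mulmx0 1 A).
by apply: (sup_upper_bound (spnorm_has_sup A)); exists 0; rewrite //= enorm0.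
Qed.

Lemma spnormP m n (A : 'M[R]_(m, n)) v : enorm (A *m v) <= spnorm A * enorm v.
Proof.
have [v0|vn0] := eqVneq (enorm v) 0.
  by rewrite (enorm0_eq0 v0) mulmx0 !enorm0 mulr0.
have vp : 0 < enorm v by rewrite lt_def vn0 enorm_ge0.
rewrite -ler_pdivrMr // mulrC.
have -> : (enorm v)^-1 * enorm (A *m v) = enorm (A *m ((enorm v)^-1 *: v)).
  by rewrite -scalemxAr enormZ ger0_norm // invr_ge0.
apply: (sup_upper_bound (spnorm_has_sup A)); exists ((enorm v)^-1 *: v) => //=.
by rewrite enormZ ger0_norm ?invr_ge0 // mulVf.
Qed.

Lemma spnorm_le m n (A : 'M[R]_(m, n)) c : 0 <= c ->
  (forall v, enorm (A *m v) <= c * enorm v) -> spnorm A <= c.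
Proof.
move=> c0 cA; apply: ge_sup; first by have [] := spnorm_has_sup A.
move=> _ [v /= v1 <-]; apply: (le_trans (cA v)).
by rewrite -[leRHS]mulr1 ler_wpM2l.
Qed.

Lemma bilin_spnorm m n (A : 'M[R]_(m, n)) w v c : spnorm A <= c ->
  `|dot w (A *m v)| <= c * enorm w * enorm v.
Proof.
move=> Ac; rewrite (le_trans (norm_dot _ _)) // mulrC mulrAC ler_wpM2r //.
by rewrite (le_trans (spnormP _ _)) // ler_wpM2r.
Qed.

(** Linearity of [T] serves twice: decomposing [u] in the basis bounds the set whose supremum is
    [trinorm], and homogeneity rescales [u] to the unit sphere. *)
Lemma trinormP n (T : 'cV[R]_n -> 'M[R]_n) u :
  (forall a u v, T (a *: u + v) = a *: T u + T v) ->
  spnorm (T u) <= trinorm T * enorm u.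
Proof.
move=> Tlin.
have T0 : T 0 = 0 by have := Tlin (-1) 0 0; rewrite !scaleN1r oppr0 addr0 addNr.
have TZ a v : T (a *: v) = a *: T v by rewrite -[a *: v]addr0 Tlin T0 addr0.
have TD v w : T (v + w) = T v + T w by rewrite -[v]scale1r Tlin !scale1r.
have Tsup : has_sup [set spnorm (T u) | u in [set u : 'cV[R]_n | enorm u <= 1]].
  split; first by exists (spnorm (T 0)), 0; rewrite //= enorm0.
  exists (\sum_i spnorm (T (delta_mx i 0))) => _ [v /= v1 <-].
  apply: spnorm_le => [|w]; first by apply: sumr_ge0 => i _; exact: spnorm_ge0.
  rewrite {1}[v]col_decomp (big_morph T TD T0) mulmx_suml mulr_suml.
  apply: (le_trans (enorm_sum _ _ _)); apply: ler_sum => i _.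
  rewrite TZ -scalemxAl enormZ -[leRHS]mul1r.
  by rewrite ler_pM ?spnormP // (le_trans (enorm_coord _ _)).
have [v0|vn0] := eqVneq (enorm u) 0.
  rewrite (enorm0_eq0 v0) enorm0 mulr0 T0; apply: spnorm_le => // v.
  by rewrite mul0mx enorm0 mul0r.
have vp : 0 < enorm u by rewrite lt_def vn0 enorm_ge0.
apply: spnorm_le => [|w].
  rewrite mulr_ge0 // (le_trans (spnorm_ge0 (T 0))) //.
  by apply: (sup_upper_bound Tsup); exists 0; rewrite //= enorm0.
rewrite -[u in leLHS](scalerKV vn0) TZ -scalemxAl enormZ ger0_norm //.
rewrite mulrAC mulrC ler_wpM2r // (le_trans (spnormP _ _)) // ler_wpM2r //.
apply: (sup_upper_bound Tsup); exists ((enorm u)^-1 *: u) => //=.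
by rewrite enormZ ger0_norm ?invr_ge0 // mulVf.
Qed.

Lemma enorm_col_mx m n (a : 'cV[R]_m) (b : 'cV[R]_n) :
  enorm (col_mx a b) <= enorm a + enorm b.
Proof.
rewrite -(@ler_pXn2r _ 2) ?nnegrE ?addr_ge0 // enorm_sqr dot_col_mx.
rewrite -!enorm_sqr.
by have := mulr_ge0 (enorm_ge0 a) (enorm_ge0 b); lra.
Qed.

Lemma enorm_usubmx m n (v : 'cV[R]_(m + n)) : enorm (usubmx v) <= enorm v.
Proof.
rewrite -(@ler_pXn2r _ 2) ?nnegrE // !enorm_sqr -{3 4}(vsubmxK v) dot_col_mx.
by rewrite lerDl dotvv_ge0.
Qed.

Lemma enorm_dsubmx m n (v : 'cV[R]_(m + n)) : enorm (dsubmx v) <= enorm v.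
Proof.
rewrite -(@ler_pXn2r _ 2) ?nnegrE // !enorm_sqr -{3 4}(vsubmxK v) dot_col_mx.
by rewrite lerDr dotvv_ge0.
Qed.

Lemma enorm_col0 m n (b : 'cV[R]_n) : enorm (col_mx (0 : 'cV[R]_m) b) = enorm b.
Proof.
apply/eqP; rewrite -(@eqrXn2 _ 2) // !enorm_sqr dot_col_mx dot0l add0r.
exact: eqxx.
Qed.

Lemma enorm_cols0 m n (b : 'cV[R]_m) : enorm (col_mx b (0 : 'cV[R]_n)) = enorm b.
Proof.
apply/eqP; rewrite -(@eqrXn2 _ 2) // !enorm_sqr dot_col_mx dot0l addr0.
exact: eqxx.
Qed.

Lemma mul_col_mx_blocks m n (A : 'M[R]_(m + n)) (a : 'cV[R]_m)
    (b : 'cV[R]_n) :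
  A *m col_mx a b = col_mx (ulsubmx A *m a + ursubmx A *m b)
                           (dlsubmx A *m a + drsubmx A *m b).
Proof. by rewrite -{1}(submxK A) mul_block_col. Qed.

End Euclid.
#[export] Hint Extern 0 (is_true (0 <= enorm _)) => exact: enorm_ge0 : core.

(** * Taylor expansions *)

Section Calculus.
Variable R : realType.
Implicit Types (n m p : nat).

(** The entry point for derivatives of value functions: these are known only through expansions with
    quadratic remainder, applied here to the increments [t *: u]. *)
Lemma is_derive_quad n (F : 'cV[R]_n -> R) z u l c :
  (forall t, `|t| <= 1 -> `|F (z + t *: u) - F z - t * l| <= c * t ^+ 2) ->
  is_derive z u F l.
Proof.
move=> FE.
have lim : h^-1 *: ((F \o shift z) (h *: u) - F z) @[h --> 0^'] --> l.
  apply/cvgrPdist_le => e e0; near=> h.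
  have h0 : h != 0 by near: h; exact: nbhs_dnbhs_neq.
  have h1 : `|h| <= 1 by near: h; apply: dnbhs0_le.
  have he : `|h| <= e / (`|c| + 1).
    by near: h; apply: dnbhs0_le; rewrite divr_gt0 // ltr_wpDl.
  rewrite /= -normrN opprB.
  have -> : h^-1 *: (F (h *: u + z) - F z) - l =
            h^-1 * (F (z + h *: u) - F z - h * l).
    by rewrite (addrC z) mulrBr mulKf.
  rewrite normrM normfV ler_pdivrMl ?normr_gt0 //.
  apply: (le_trans (FE h h1)); rewrite -[h ^+ 2]real_normK ?num_real //.
  rewrite expr2 mulrCA ler_wpM2l // mulrC.
  apply: (@le_trans _ _ (`|h| * (`|c| + 1))).
    by rewrite ler_wpM2l // (le_trans (ler_norm _)) // lerDl.
  by rewrite -ler_pdivlMr // ltr_wpDl.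
apply: DeriveDef; first by apply/cvg_ex; exists l.
by apply/cvg_lim.
Unshelve. all: by end_near. Qed.

Lemma is_derive_line n (F : 'cV[R]_n -> R) z u t l :
  is_derive (z + t *: u) u F l -> is_derive t 1 (fun s => F (z + s *: u)) l.
Proof.
case=> dF <-.
have E : (fun h : R => h^-1 *: (((fun s => F (z + s *: u)) \o shift t) (h *: 1)
            - F (z + t *: u))) =
         (fun h => h^-1 *: ((F \o shift (z + t *: u)) (h *: u)
            - F (z + t *: u))).
  apply/funext => h /=; congr (_ *: (F _ - _)).
  by rewrite /shift /= [h *: 1]mulr1 scalerDl addrCA.
by apply: DeriveDef; rewrite /derivable /derive E.
Qed.

Lemma derive_coord n (W : normedModType R) (F : 'cV[R]_n -> W) z v :
  differentiable F z -> 'D_v F z = \sum_i v i 0 *: 'D_(delta_mx i 0) F z.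
Proof.
move=> dF; rewrite deriveE // {1}[v]col_decomp linear_sum.
by apply: eq_bigr => i _; rewrite linearZ deriveE.
Qed.

Lemma is_derive_bilin n m p (F : 'cV[R]_n -> 'M[R]_(m, p)) z v a b :
  differentiable F z ->
  is_derive z v (fun z' => dot a (F z' *m b)) (dot a ('D_v F z *m b)).
Proof.
move=> dF; have dvF : derivable F z v by exact: diff_derivable.
have dij i j : is_derive z v (fun z' => F z' i j) ('D_v F z i j).
  have /derivable_mxP/(_ i j) := dvF; move=> /derivableP.
  by rewrite (derive_mx dvF) mxE.
have E : (fun z' => dot a (F z' *m b)) =
         \sum_(i < m) \sum_(j < p) (a i 0 * b j 0) \*: (fun z' => F z' i j).
  apply/funext => z'; rewrite fct_sumE; apply: eq_bigr => i _.
  rewrite fct_sumE mxE mulr_sumr; apply: eq_bigr => j _.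
  by rewrite /= /GRing.scale /=; ring.
rewrite E.
have -> : dot a ('D_v F z *m b) =
    \sum_(i < m) \sum_(j < p) (a i 0 * b j 0) *: 'D_v F z i j.
  apply: eq_bigr => i _; rewrite mxE mulr_sumr; apply: eq_bigr => j _.
  by rewrite /GRing.scale /=; ring.
by apply: is_derive_sum => i; apply: is_derive_sum => j; apply: is_deriveZ.
Qed.

(** Only directional derivatives are recorded, tested against a fixed [w]: this is what quadratic
    expansions deliver for the penalty value function. *)
Definition C2_smooth n (h : 'cV[R]_n -> R) : Prop :=
  (forall z u, is_derive z u h (dot (grad h z) u)) /\
  (forall z u w,
     is_derive z u (fun z' => dot w (grad h z')) (dot w (hess h z *m u))).

Lemma differentiable_grad n (h : 'cV[R]_n -> R) z u :
  differentiable h z -> is_derive z u h (dot (grad h z) u).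
Proof.
move=> dh; apply: DeriveDef; first exact: diff_derivable.
by rewrite derive_coord //; apply: eq_bigr => i _; rewrite mxE mulrC.
Qed.

Lemma twice_differentiable_C2 n (h : 'cV[R]_n -> R) :
  twice_differentiable h -> C2_smooth h.
Proof.
move=> dh; split=> [z u|z u w]; first by apply: differentiable_grad; have [] := dh z.
have [_ dg] := dh z.
have := @is_derive_bilin n n 1 (grad h) z u w 1%:M dg.
rewrite mulmx1.
have -> : (fun z' => dot w (grad h z' *m 1%:M)) = (fun z' => dot w (grad h z')).
  by apply/funext => z'; rewrite mulmx1.
suff -> : 'D_u (grad h) z = hess h z *m u by [].
rewrite derive_coord //; apply/colP => i; rewrite summxE mxE.
apply: eq_bigr => j _; rewrite !mxE mulrC derive_mx; last exact: diff_derivable.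
by rewrite !mxE.
Qed.

Lemma grad_is_derive n (h : 'cV[R]_n -> R) z a :
  (forall u, is_derive z u h (dot a u)) -> grad h z = a.
Proof.
by move=> da; apply/colP => i; rewrite mxE (@derive_val _ _ _ _ _ _ _ (da _)) dot_delta.
Qed.

Lemma hess_is_derive n (h : 'cV[R]_n -> R) z A :
  (forall u w, is_derive z u (fun z' => dot w (grad h z')) (dot w (A *m u))) ->
  hess h z = A.
Proof.
move=> dA; apply/matrixP => i j; rewrite mxE.
have -> : (fun z' => grad h z' i 0) = (fun z' => dot (delta_mx i 0) (grad h z')).
  by apply/funext => z'; rewrite dotC dot_delta.
rewrite (@derive_val _ _ _ _ _ _ _ (dA _ _)) dotC dot_delta -colE.
by rewrite mxE.
Qed.

(** For a second derivative known as a linear map [Q] and not as a matrix, which is how the Hessian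
    of the hyperobjective arises. *)
Lemma hess_is_derive_lin n (h : 'cV[R]_n -> R) z (Q : 'cV[R]_n -> 'cV[R]_n) u :
  (forall u w, is_derive z u (fun z' => dot w (grad h z')) (dot w (Q u))) ->
  (forall a u v, Q (a *: u + v) = a *: Q u + Q v) ->
  hess h z *m u = Q u.
Proof.
move=> dQ Ql.
have Q0 : Q 0 = 0 by have := Ql (-1) 0 0; rewrite !scaleN1r oppr0 addr0 addNr.
have -> : Q u = \sum_j u j 0 *: Q (delta_mx j 0).
  rewrite {1}[u]col_decomp.
  elim/big_rec2 : _ => [//|j v w _ <-]; exact: Ql.
apply/colP => i; rewrite mxE summxE; apply: eq_bigr => j _.
rewrite !mxE mulrC; congr (_ * _).
have -> : (fun z' => grad h z' i 0) = (fun z' => dot (delta_mx i 0) (grad h z')).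
  by apply/funext => z'; rewrite dotC dot_delta.
by rewrite (@derive_val _ _ _ _ _ _ _ (dQ _ _)) dotC dot_delta.
Qed.

Lemma is_derive_continuous (phi : R -> R) (dphi : R -> R) :
  (forall t, is_derive t (1 : R) phi (dphi t)) -> continuous phi.
Proof.
move=> d t; apply: differentiable_continuous; apply/derivable1_diffP.
by have [] := d t.
Qed.

(** Mean value theorem for [phi t - (a t + c t^2 / 2)], whose derivative is nonpositive on the unit
    interval; it replaces an integral remainder. *)
Lemma taylor_le (phi dphi : R -> R) a c :
  (forall t, is_derive t (1 : R) phi (dphi t)) ->
  (forall t, 0 <= t <= 1 -> dphi t <= a + c * t) ->
  phi 1 - phi 0 <= a + c / 2.
Proof.
move=> dp le.
pose psi t := phi t - (a * t + c / 2 * t ^+ 2).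
have dpsi t : is_derive t (1 : R) psi (dphi t - (a + c * t)).
  have := dp t => dpt; apply: is_derive_eq.
  by rewrite /= !(mulr1, scaler1, expr1) /GRing.scale /=; field.
have [|s /itvP s01] := @MVT R psi _ 0 1 ltr01 (fun t _ => dpsi t).
  apply: continuous_subspaceT; exact: is_derive_continuous dpsi.
rewrite subr0 mulr1 /psi => E.
by have := le s; rewrite !s01 => /(_ isT); move: E; lra.
Qed.

End Calculus.

Section Taylor.
Variable R : realType.
Implicit Types (n m p : nat).

(** Replaces a limit [t -> 0] after division by a power of [t]. *)
Lemma le0_small (x k : R) : (forall t, 0 < t <= 1 -> x <= k * t) -> x <= 0.
Proof.
move=> xk; rewrite leNgt; apply/negP => x0.
have k0 : 0 < `|k| + x by rewrite ltr_wpDl.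
have := xk (x / 2 / (`|k| + x)); rewrite !divr_gt0 //= ler_pdivrMr // mul1r.
have -> : x / 2 <= `|k| + x by have := normr_ge0 k; lra.
move=> /(_ isT); apply/negP; rewrite -ltNge mulrA ltr_pdivrMr //.
have := ler_norm k; have := normr_ge0 k; nra.
Qed.

(** A one-sided bound on the difference quotients for small positive [t] suffices, as the two-sided
    limit is known to exist. Most pointwise bounds on gradients and Hessians come from here. *)
Lemma derive_le n (F : 'cV[R]_n -> R) z u l c k : is_derive z u F l ->
  (forall t, 0 < t <= 1 -> F (z + t *: u) - F z <= t * (c + k * t)) -> l <= c.
Proof.
case=> /cvg_ex[/= l' cl'] dl Fk; have ll' : l' = l by rewrite -dl; apply/esym/cvg_lim.
rewrite -subr_le0; rewrite {}ll' in cl'.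
apply/ler_addgt0Pr => e e0; rewrite add0r.
have e2 : 0 < e / 2 by rewrite divr_gt0.
have [d /= d0 dP] := (cvgrPdist_le _ _).1 cl' _ e2.
pose h := Num.min (d / 2) (Num.min 1 (e / 2 / (`|k| + 1))).
have k0 : 0 < `|k| + 1 by rewrite ltr_wpDl.
have h0 : 0 < h by rewrite !lt_min ltr01 !divr_gt0.
have hd : h < d by rewrite gt_min; apply/orP; left; rewrite gtr_pMr // invf_lt1 ?ltr1n.
have h1 : h <= 1 by rewrite !ge_min lexx orbT.
have hk : h <= e / 2 / (`|k| + 1) by rewrite !ge_min lexx !orbT.
have := dP h; rewrite /ball_/= sub0r normrN (gtr0_norm h0) => /(_ hd (lt0r_neq0 h0)).
have := Fk h; rewrite h0 h1 addrC => /(_ isT).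
rewrite (addrC z) -(ler_pdivrMl _ _ h0) => q1 q2.
have := le_trans (ler_norm _) q2; rewrite /GRing.scale /= lerBlDl => q3.
rewrite ler_pdivlMr // in hk.
have : k * h <= e / 2.
  apply: le_trans hk; rewrite mulrC ler_wpM2l ?(ltW h0) //.
  by rewrite (le_trans (ler_norm _)) // lerDl.
by move: q1 q3; rewrite (addrC (- F z)); lra.
Qed.

Section C1.
Variables (n : nat) (h : 'cV[R]_n -> R).
Hypothesis dh : forall z u, is_derive z u h (dot (grad h z) u).

Lemma is_derive_line_grad z u t :
  is_derive t (1 : R) (fun s => h (z + s *: u)) (dot (grad h (z + t *: u)) u).
Proof. exact: is_derive_line. Qed.

(** The factor [enorm u] is kept because the sign of [L] is forced only if a nonzero vector exists;
    in dimension 0 a negative constant is allowed. *)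
Lemma lipschitz_grad_ge0 L (z u : 'cV[R]_n) : lipschitz_grad L h -> 0 <= L * enorm u.
Proof.
move=> /(_ (z + u) z); rewrite [z + u]addrC addrK.
exact: le_trans.
Qed.

Lemma descent_lemma L z u : lipschitz_grad L h ->
  h (z + u) <= h z + dot (grad h z) u + L / 2 * enorm u ^+ 2.
Proof.
move=> Lh.
have := taylor_le (is_derive_line_grad z u).
move=> /(_ (dot (grad h z) u) (L * enorm u ^+ 2)).
rewrite scale1r scale0r addr0 => H.
suff /H : forall t, 0 <= t <= 1 -> dot (grad h (z + t *: u)) u <=
    dot (grad h z) u + L * enorm u ^+ 2 * t by lra.
move=> t /andP[t0 _]; rewrite -lerBlDl -dotBl.
rewrite (le_trans (cauchy_schwarz _ _)) //.
have := Lh (z + t *: u) z; rewrite [z + _]addrC addrK enormZ ger0_norm // => le.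
rewrite (le_trans (ler_wpM2r (enorm_ge0 _) le)) //.
by rewrite le_eqVlt; apply/orP; left; apply/eqP; ring.
Qed.

Lemma lipschitz_fun_grad C z : 0 <= C -> lipschitz_fun C h ->
  enorm (grad h z) <= C.
Proof.
move=> C0 Ch; apply: enorm_le_dot => // w.
rewrite dotC; apply: (derive_le (k := 0) (dh z w)) => t /andP[t0 _].
rewrite (le_trans (ler_norm _)) // (le_trans (Ch _ _)) //.
by rewrite [z + _]addrC addrK enormZ gtr0_norm // mul0r addr0 mulrCA.
Qed.

Lemma strongly_convex_grad mu z z' : strongly_convex mu h ->
  h z + dot (grad h z) (z' - z) + mu / 2 * enorm (z' - z) ^+ 2 <= h z'.
Proof.
move=> sc; suff : dot (grad h z) (z' - z) <=
    h z' - h z - mu / 2 * enorm (z' - z) ^+ 2 by lra.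
apply: (derive_le (k := mu / 2 * enorm (z' - z) ^+ 2) (dh z (z' - z))).
move=> t /andP[t0 t1]; have := sc z' z t; rewrite (ltW t0) t1 => /(_ isT).
have -> : t *: z' + (1 - t) *: z = z + t *: (z' - z).
  by rewrite scalerBr scalerBl scale1r addrCA.
by lra.
Qed.

End C1.

Lemma descent_lemma_ge n (h : 'cV[R]_n -> R) L z u :
  (forall z u, is_derive z u h (dot (grad h z) u)) -> lipschitz_grad L h ->
  h z + dot (grad h z) u - L / 2 * enorm u ^+ 2 <= h (z + u).
Proof.
move=> dh Lh.
have gN z' : grad (- h) z' = - grad h z'.
  by apply: grad_is_derive => v; rewrite dotNl; apply: is_deriveN.
have := @descent_lemma n (- h) _ L z u; rewrite gN dotNl -![(- h) _]/(- h _).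
set K := _ * enorm u ^+ 2; set D := dot _ _ => H.
suff : - h (z + u) <= - h z - D + K by lra.
apply: H => [z' v|z' z'']; first by rewrite gN dotNl; apply: is_deriveN.
by rewrite !gN -opprD enormN.
Qed.

Section C2_smooth.
Variables (n : nat) (h : 'cV[R]_n -> R).
Hypothesis Ch : C2_smooth h.

Lemma is_derive_line_hess w z u t :
  is_derive t (1 : R) (fun s => dot w (grad h (z + s *: u)))
    (dot w (hess h (z + t *: u) *m u)).
Proof.
by apply: (@is_derive_line R n (fun z' => dot w (grad h z'))); exact: Ch.2.
Qed.

Lemma lipschitz_hess_ge0 c (z u : 'cV[R]_n) : lipschitz_hess c h -> 0 <= c * enorm u.
Proof.
move=> /(_ (z + u) z); rewrite [z + u]addrC addrK.
exact/le_trans/spnorm_ge0.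
Qed.

Lemma lipschitz_grad_hess L z v : lipschitz_grad L h ->
  enorm (hess h z *m v) <= L * enorm v.
Proof.
move=> Lh; apply: enorm_le_dot => [|w]; first exact: (lipschitz_grad_ge0 z v Lh).
apply: (derive_le (k := 0) (Ch.2 z v w)) => t /andP[t0 _].
rewrite -dotBr (le_trans (cauchy_schwarz _ _)) //.
have := Lh (z + t *: v) z; rewrite [z + _]addrC addrK enormZ gtr0_norm // => le.
rewrite (le_trans (ler_wpM2l (enorm_ge0 _) le)) //.
by rewrite le_eqVlt; apply/orP; left; apply/eqP; ring.
Qed.

Lemma hess_lipschitz_dot c z u a b : lipschitz_hess c h ->
  `|dot a ((hess h (z + u) - hess h z) *m b)| <= c * enorm u * enorm a * enorm b.
Proof.
move=> ch; apply: bilin_spnorm; have := ch (z + u) z.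
by rewrite [z + u]addrC addrK.
Qed.

Lemma hess_lipschitz_enorm c z u b : lipschitz_hess c h ->
  enorm ((hess h (z + u) - hess h z) *m b) <= c * enorm u * enorm b.
Proof.
move=> ch; rewrite (le_trans (spnormP _ _)) // ler_wpM2r //.
by have := ch (z + u) z; rewrite [z + u]addrC addrK.
Qed.

Lemma grad_taylor c z u : lipschitz_hess c h ->
  enorm (grad h (z + u) - grad h z - hess h z *m u) <= c / 2 * enorm u ^+ 2.
Proof.
move=> ch; have c0 := lipschitz_hess_ge0 z u ch.
apply: enorm_le_dot => [|w]; first by have := enorm_ge0 u; nra.
have := taylor_le (is_derive_line_hess w z u).
move=> /(_ (dot w (hess h z *m u)) (c * enorm u ^+ 2 * enorm w)).
rewrite scale1r scale0r addr0 !dotBr => H.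
suff /H : forall t, 0 <= t <= 1 -> dot w (hess h (z + t *: u) *m u) <=
    dot w (hess h z *m u) + c * enorm u ^+ 2 * enorm w * t by lra.
move=> t /andP[t0 _]; rewrite -lerBlDl -dotBr -mulmxBl.
rewrite (le_trans (ler_norm _)) // (le_trans (hess_lipschitz_dot _ _ _ _ ch)) //.
rewrite enormZ ger0_norm //.
by rewrite le_eqVlt; apply/orP; left; apply/eqP; ring.
Qed.

(** The constant is [c / 4] and not the sharp [c / 6]: [taylor_le] integrates affine bounds only, so
    [t^2] is replaced by [t] in the remainder of the gradient. *)
Lemma taylor3_le c z u : lipschitz_hess c h ->
  h (z + u) <= h z + dot (grad h z) u + 2^-1 * dot u (hess h z *m u)
               + c / 4 * enorm u ^+ 3.
Proof.
move=> ch; have c0 := lipschitz_hess_ge0 z u ch.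
have := taylor_le (is_derive_line_grad Ch.1 z u).
move=> /(_ (dot (grad h z) u) (dot u (hess h z *m u) + c / 2 * enorm u ^+ 3)).
rewrite scale1r scale0r addr0 => H.
suff /H : forall t, 0 <= t <= 1 -> dot (grad h (z + t *: u)) u <=
    dot (grad h z) u + (dot u (hess h z *m u) + c / 2 * enorm u ^+ 3) * t by lra.
move=> t /andP[t0 t1].
have := cauchy_schwarz (grad h (z + t *: u) - grad h z - hess h z *m (t *: u)) u.
have := ler_wpM2r (enorm_ge0 u) (grad_taylor z (t *: u) ch).
rewrite !dotBl -scalemxAr dotZl (dotC _ u) (dotC _ u) (dotC _ u) enormZ ger0_norm // => A B.
have : c / 2 * (t * enorm u) ^+ 2 * enorm u <= c / 2 * enorm u ^+ 3 * t.
  have : 0 <= c * enorm u * (enorm u ^+ 2 * (t * (1 - t))).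
    by rewrite mulr_ge0 // mulr_ge0 ?exprn_ge0 // mulr_ge0 ?subr_ge0.
  lra.
lra.
Qed.

(** Adding the convexity inequalities at the two ends of a segment gives strong monotonicity of the
    gradient, which is then differentiated along the segment. *)
Lemma strongly_monotone_hess mu z v :
  (forall z z', h z + dot (grad h z) (z' - z) + mu / 2 * enorm (z' - z) ^+ 2 <= h z') ->
  mu * enorm v ^+ 2 <= dot v (hess h z *m v).
Proof.
move=> sc; rewrite -lerN2; apply: (derive_le (k := 0)).
  by apply: is_deriveN; apply: Ch.2.
move=> t /andP[t0 t1]; rewrite /= -[(- _) _]/(- _) -[(- _) z]/(- _).
have := sc z (z + t *: v); have := sc (z + t *: v) z.
rewrite opprD addNKr [z + _ - z]addrC addKr enormN enormZ (gtr0_norm t0).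
rewrite !dotNr !dotZr (dotC v) (dotC v) => A B.
rewrite -(ler_pM2l t0); lra.
Qed.

End C2_smooth.

(** * Symmetry of second derivatives *)

Section Schwarz.
Variables (n : nat) (F : 'cV[R]_n -> R) (G : 'cV[R]_n -> 'cV[R]_n).
Variables (B : 'cV[R]_n -> 'cV[R]_n -> R) (z : 'cV[R]_n) (c : R).
Hypothesis c0 : 0 <= c.
Hypothesis dF : forall z u, is_derive z u F (dot (G z) u).
Hypothesis Bl : forall k u u' v, B (k *: u + u') v = k * B u v + B u' v.
Hypothesis Br : forall k u v, B u (k *: v) = k * B u v.
Hypothesis GB : forall u v,
  `|dot (G (z + u) - G z) v - B u v| <= c * enorm u ^+ 2 * enorm v.

Let S (a b : 'cV[R]_n) := enorm a + enorm b.

(** The mean value theorem in the direction [b], applied to the increment of [F] in the direction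
    [a]. The two expansions of [G] leave [t^2 B a b] up to a cubic error. *)
Lemma second_difference a b t : 0 <= t ->
  `|F (z + t *: a + t *: b) - F (z + t *: a) - F (z + t *: b) + F z
    - t ^+ 2 * B a b| <= 2 * c * (t * S a b) ^+ 3.
Proof.
move=> t0.
pose psi s := F (z + t *: a + s *: (t *: b)) - F (z + s *: (t *: b)).
pose dpsi s := dot (G (z + t *: a + s *: (t *: b))) (t *: b)
               - dot (G (z + s *: (t *: b))) (t *: b).
have dp s : is_derive s (1 : R) psi (dpsi s).
  by apply: is_deriveB; apply: is_derive_line.
have dN s : is_derive s (1 : R) (- psi) (- dpsi s) by apply: is_deriveN.
have bd s : 0 <= s <= 1 -> `|dpsi s - t ^+ 2 * B a b| <= 2 * c * (t * S a b) ^+ 3.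
  move=> /andP[s0 s1]; rewrite /dpsi.
  have := GB (t *: a + s *: (t *: b)) (t *: b).
  have := GB (s *: (t *: b)) (t *: b).
  have n1 : enorm (s *: (t *: b)) <= t * S a b.
    rewrite !enormZ !ger0_norm // mulrCA ler_wpM2l //.
    by rewrite /S; have := enorm_ge0 a; have := enorm_ge0 b; nra.
  have n2 : enorm (t *: a + s *: (t *: b)) <= t * S a b.
    rewrite (le_trans (enormD _ _)) // !enormZ !ger0_norm // mulrCA -mulrDr ler_wpM2l //.
    by rewrite /S; have := enorm_ge0 b; nra.
  have n3 : enorm (t *: b) <= t * S a b.
    by rewrite enormZ ger0_norm // ler_wpM2l // lerDr.
  have cb (u : 'cV[R]_n) : enorm u <= t * S a b ->
      c * enorm u ^+ 2 * enorm (t *: b) <= c * (t * S a b) ^+ 3.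
    move=> ub; rewrite -mulrA ler_wpM2l // [leRHS]exprSr ler_pM ?exprn_ge0 //.
    by rewrite ler_pXn2r ?nnegrE // (le_trans _ ub).
  move/le_trans/(_ (cb _ n1)) => A1 /le_trans/(_ (cb _ n2)).
  move: A1; rewrite addrA Bl !Br !dotBl !ler_norml => A1 A2.
  by lra.
have E : psi 1 - psi 0 = F (z + t *: a + t *: b) - F (z + t *: a) - F (z + t *: b) + F z.
  by rewrite /psi !scale1r !scale0r !addr0; ring.
rewrite -E ler_norml; apply/andP; split.
  have := taylor_le (a := - (t ^+ 2 * B a b) + 2 * c * (t * S a b) ^+ 3) (c := 0) dN.
  rewrite -![(- psi) _]/(- psi _) => H.
  suff /H : forall s, 0 <= s <= 1 -> - dpsi s <= - (t ^+ 2 * B a b)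
      + 2 * c * (t * S a b) ^+ 3 + 0 * s by lra.
  by move=> s /bd; rewrite ler_norml; lra.
have := taylor_le (a := t ^+ 2 * B a b + 2 * c * (t * S a b) ^+ 3) (c := 0) dp.
move=> H.
suff /H : forall s, 0 <= s <= 1 -> dpsi s <= t ^+ 2 * B a b
    + 2 * c * (t * S a b) ^+ 3 + 0 * s by lra.
by move=> s /bd; rewrite ler_norml; lra.
Qed.

(** The second difference is symmetric in [a] and [b], so [t^2 (B a b - B b a)] is cubic in [t]. *)
Lemma schwarz_le a b : B a b <= B b a.
Proof.
rewrite -subr_le0; apply: (le0_small (k := 4 * c * S a b ^+ 3)) => t /andP[t0 _].
have := second_difference a b (ltW t0); have := second_difference b a (ltW t0).
rewrite [z + t *: b + t *: a]addrAC {1}/S [enorm b + _]addrC -/(S a b).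
rewrite !ler_norml => A1 A2.
by rewrite -(ler_pM2l (exprn_gt0 2 t0)); lra.
Qed.

Lemma schwarz a b : B a b = B b a.
Proof. by apply/eqP; rewrite eq_le !schwarz_le. Qed.

End Schwarz.

Lemma hess_sym n (h : 'cV[R]_n -> R) c z : C2_smooth h -> lipschitz_hess c h ->
  (hess h z)^T = hess h z.
Proof.
move=> Ch ch; apply/matrixP => i j.
have [b b0 bP] : exists2 b, 0 <= b & forall u,
    enorm (grad h (z + u) - grad h z - hess h z *m u) <= b * enorm u ^+ 2.
  exists (`|c| / 2); first by rewrite divr_ge0.
  move=> u; rewrite (le_trans (grad_taylor Ch z u ch)) //.
  by rewrite !ler_wpM2r ?exprn_ge0 ?invr_ge0 ?ler_norm.
have := @schwarz n h (grad h) (fun u v => dot (hess h z *m u) v) z b b0 Ch.1.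
have -> : (hess h z)^T i j = dot (hess h z *m delta_mx i 0) (delta_mx j 0).
  by rewrite -colE dot_delta !mxE.
have -> : hess h z i j = dot (hess h z *m delta_mx j 0) (delta_mx i 0).
  by rewrite -colE dot_delta !mxE.
apply.
- by move=> k u u' v; rewrite mulmxDr dotDl -scalemxAr dotZl.
- by move=> k u v; rewrite dotZr.
- by move=> u v; rewrite -dotBl (le_trans (norm_dot _ _)) // ler_wpM2r.
Qed.

(** * Consequences of the Lipschitz third derivative *)

Section Third.
Variables (n : nat) (h : 'cV[R]_n -> R) (c nu : R).
Hypothesis Ch : C2_smooth h.
Hypothesis dH : forall z, differentiable (hess h) z.
Hypothesis ch : lipschitz_hess c h.
Hypothesis nuh : lipschitz_third nu h.

Lemma derive_hess_linear z k u v :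
  'D_(k *: u + v) (hess h) z = k *: 'D_u (hess h) z + 'D_v (hess h) z.
Proof. by rewrite !deriveE // linearP. Qed.

Lemma third_lipschitz_dot z z' u a b :
  `|dot a (('D_u (hess h) z - 'D_u (hess h) z') *m b)|
  <= nu * enorm (z - z') * enorm u * enorm a * enorm b.
Proof.
apply: bilin_spnorm.
have := trinormP (T := fun u => 'D_u (hess h) z - 'D_u (hess h) z') u.
move=> /(_ _)/le_trans; apply.
  by move=> k v w; rewrite !derive_hess_linear opprD addrACA scalerBr.
by rewrite ler_wpM2r.
Qed.

Lemma hess_taylor_dot z u a b :
  dot a ((hess h (z + u) - hess h z - 'D_u (hess h) z) *m b)
  <= nu / 2 * enorm u ^+ 2 * enorm a * enorm b.
Proof.
have dl t : is_derive t (1 : R) (fun s => dot a (hess h (z + s *: u) *m b))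
    (dot a ('D_u (hess h) (z + t *: u) *m b)).
  apply: (@is_derive_line R n (fun z' => dot a (hess h z' *m b))).
  exact: is_derive_bilin.
have := taylor_le (a := dot a ('D_u (hess h) z *m b))
  (c := nu * enorm u ^+ 2 * enorm a * enorm b) dl.
rewrite scale1r scale0r addr0 !mulmxBl !dotBr => H.
rewrite lerBlDl (le_trans (H _)) //; last first.
  by rewrite lerD2l le_eqVlt; apply/orP; left; apply/eqP; ring.
move=> t /andP[t0 _]; rewrite -lerBlDl -dotBr -mulmxBl.
rewrite (le_trans (ler_norm _)) // (le_trans (third_lipschitz_dot _ _ _ _ _)) //.
rewrite [z + _]addrC addrK enormZ ger0_norm //.
by rewrite le_eqVlt; apply/orP; left; apply/eqP; ring.
Qed.

Lemma third_ge0 (z u : 'cV[R]_n) : 0 <= nu * enorm u.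
Proof.
have [->|un0] := eqVneq (enorm u) 0; first by rewrite mulr0.
have up : 0 < enorm u by rewrite lt_def un0 enorm_ge0.
have := trinormP (T := fun v => 'D_v (hess h) (z + u) - 'D_v (hess h) z) u.
move=> /(_ _)/(le_trans (spnorm_ge0 _)) H.
have := nuh (z + u) z; rewrite [z + u]addrC addrK [u + z]addrC.
apply: le_trans; rewrite -(pmulr_lge0 _ up); apply: H => k v w.
by rewrite !derive_hess_linear opprD addrACA scalerBr.
Qed.

Lemma hess_taylor z u b :
  enorm ((hess h (z + u) - hess h z - 'D_u (hess h) z) *m b)
  <= nu / 2 * enorm u ^+ 2 * enorm b.
Proof.
apply: enorm_le_dot => [|w].
  by have := mulr_ge0 (third_ge0 z u) (mulr_ge0 (enorm_ge0 u) (enorm_ge0 b)); lra.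
rewrite (le_trans (hess_taylor_dot _ _ _ _)) //.
by rewrite le_eqVlt; apply/orP; left; apply/eqP; ring.
Qed.

Lemma derive_hess_le z u b :
  enorm ('D_u (hess h) z *m b) <= c * enorm u * enorm b.
Proof.
apply: enorm_le_dot => [|w].
  by rewrite mulr_ge0 // (lipschitz_hess_ge0 z u ch).
have db : is_derive z u (fun z' => dot w (hess h z' *m b)) (dot w ('D_u (hess h) z *m b)).
  exact: is_derive_bilin.
apply: (derive_le (k := 0) db) => t /andP[t0 _].
rewrite -dotBr -mulmxBl (le_trans (ler_norm _)) //.
rewrite (le_trans (hess_lipschitz_dot _ _ _ _ ch)) // enormZ gtr0_norm //.
by rewrite le_eqVlt; apply/orP; left; apply/eqP; ring.
Qed.

(** The Schwarz argument applied to the scalar function [dot w (grad h z)], whose gradient is the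
    transposed Hessian applied to [w]. *)
Lemma derive_hess_sym z a b :
  'D_a (hess h) z *m b = 'D_b (hess h) z *m a.
Proof.
apply: eq_dot => w.
have := @schwarz n (fun z => dot w (grad h z)) (fun z => (hess h z)^T *m w)
  (fun u v => dot w ('D_u (hess h) z *m v)) z (`|nu| / 2 * enorm w).
apply.
- by rewrite mulr_ge0 ?divr_ge0.
- by move=> z' u; rewrite -dot_mulmx -[X in is_derive _ _ _ X]dotC dotC; exact: Ch.2.
- by move=> k u u' v; rewrite derive_hess_linear mulmxDl dotDr -scalemxAl dotZr.
- by move=> k u v; rewrite -scalemxAr dotZr.
move=> u v; rewrite -mulmxBl -linearB /= -dot_mulmx -dotBr -mulmxBl.
rewrite (le_trans (norm_dot _ _)) //.
have := ler_wpM2l (enorm_ge0 w) (hess_taylor z u v); move/le_trans; apply.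
have : 0 <= (`|nu| - nu) * (enorm u ^+ 2 * enorm v * enorm w).
  by rewrite mulr_ge0 ?subr_ge0 ?ler_norm // !mulr_ge0 ?exprn_ge0.
by lra.
Qed.

End Third.

End Taylor.

(** * Strongly convex minimization *)

Section Convex.
Variable R : realType.
Implicit Types (n m p : nat).

(** The first-order form of strong convexity. Unlike the chord form it combines directly with the
    descent lemma when a smooth nonconvex term is added. *)
Definition grad_strongly_convex n (mu : R) (h : 'cV[R]_n -> R) : Prop :=
  forall z z',
    h z + dot (grad h z) (z' - z) + mu / 2 * enorm (z' - z) ^+ 2 <= h z'.

Lemma enorm_le_normr n (v : 'cV[R]_n) : enorm v <= n%:R * `|v|.
Proof.
rewrite {1}[v]col_decomp (le_trans (enorm_sum _ _ _)) //.
rewrite mulr_natl -[X in _ *+ X]card_ord -sumr_const; apply: ler_sum => i _.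
rewrite enormZ.
have -> : enorm (delta_mx i 0 : 'cV[R]_n) = 1.
  by apply/eqP; rewrite -(@eqrXn2 _ 2) // enorm_sqr dot_delta mxE !eqxx expr1n.
rewrite mulr1 [leRHS]/Num.Def.normr/= mx_normrE.
exact: (le_trans _ (le_bigmax _ _ (i, 0))).
Qed.

Section OneFunction.
Variables (n : nat) (h : 'cV[R]_n -> R) (mu L : R).
Hypothesis dh : forall z u, is_derive z u h (dot (grad h z) u).
Hypothesis mu0 : 0 < mu.
Hypothesis sc : grad_strongly_convex mu h.
Hypothesis Lh : lipschitz_grad L h.

Lemma argmin_grad z : is_argmin h z -> grad h z = 0.
Proof.
move=> hz; apply: enorm0_eq0; apply/eqP; rewrite -sqrf_eq0 eq_le exprn_ge0 // andbT.
rewrite enorm_sqr; have dN : is_derive z (- grad h z) (- h) (- dot (grad h z) (- grad h z)).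
  exact: is_deriveN.
rewrite -[dot _ _]opprK -dotNr; apply: (derive_le (k := 0) dN) => t _.
rewrite -![(- h) _]/(- h _) mul0r addr0 mulr0.
by have := hz (z + t *: (- grad h z)); lra.
Qed.

(** Strong convexity bounds [h] from below near [z] and the descent lemma from above;
    [enorm_le_normr] passes to the sup norm that defines the topology. *)
Lemma continuous_lipschitz_grad : continuous h.
Proof.
move=> z B /nbhs_ballP[e e0 eB].
pose k := (enorm (grad h z) + `|L|) * n%:R + 1.
have k0 : 0 < k by rewrite ltr_wpDl // mulr_ge0 // addr_ge0.
have n0 : 0 < (n%:R + 1 : R) by rewrite ltr_wpDl.
apply/nbhs_ballP; exists (Num.min (n%:R + 1)^-1 (e / k)).
  by rewrite /= lt_min invr_gt0 n0 divr_gt0.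
move=> y; rewrite -ball_normE /= lt_min => /andP[/ltW y1 ye].
apply: eB; rewrite -ball_normE /=.
have ey : enorm (y - z) <= n%:R * `|z - y| by rewrite distrC enorm_le_normr.
have e1 : enorm (y - z) <= 1.
  rewrite (le_trans ey) // (le_trans (ler_wpM2l _ y1)) // ler_pdivrMr //.
  by rewrite mul1r lerDl.
have A1 := sc z y; have := descent_lemma dh z (y - z) Lh.
rewrite [z + _]addrC subrK => A2.
have := norm_dot (grad h z) (y - z); rewrite ler_norml => A3.
have A4 : L / 2 * enorm (y - z) ^+ 2 <= `|L| * enorm (y - z).
  have : 0 <= (`|L| - L) * enorm (y - z) ^+ 2.
    by rewrite mulr_ge0 ?exprn_ge0 // subr_ge0 ler_norm.
  have : 0 <= `|L| * (enorm (y - z) * (1 - enorm (y - z))).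
    by rewrite mulr_ge0 // mulr_ge0 // subr_ge0.
  have : 0 <= `|L| * enorm (y - z) ^+ 2 by rewrite mulr_ge0 ?exprn_ge0.
  lra.
have A5 : 0 <= mu / 2 * enorm (y - z) ^+ 2.
  by rewrite mulr_ge0 ?exprn_ge0 // divr_ge0 // ltW.
have : (enorm (grad h z) + `|L|) * enorm (y - z) < e.
  apply: (@le_lt_trans _ _ (k * `|z - y|)); last by rewrite mulrC -ltr_pdivlMr.
  rewrite [leRHS]mulrDl -mulrA mul1r; apply: (@le_trans _ _ ((enorm (grad h z) + `|L|) * (n%:R * `|z - y|))).
    by rewrite ler_wpM2l // addr_ge0.
  by rewrite lerDl.
have : 0 <= `|L| * enorm (y - z) by rewrite mulr_ge0.
by rewrite mulrDl ltr_norml; lra.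
Qed.

(** Beyond [r] the quadratic term [mu / 2 |z|^2] dominates the linear term of the minorant at 0, so
    [h] exceeds [h 0] there. Inside the closed ball of radius [r] the extreme value theorem, stated
    for row vectors, gives the minimizer. *)
Lemma argmin_exists : exists z, is_argmin h z.
Proof.
pose r := 2 * enorm (grad h 0) / mu + 1.
have r0 : 0 < r by rewrite ltr_wpDl // divr_ge0 ?mulr_ge0 // ltW.
pose A : set 'rV[R]_n := closed_ball (0 : 'rV[R]_n) r.
have [|||c _ cmin] := @EVT_min_rV R n (fun v => h v^T) A.
- by exists 0; exact: closed_ballxx.
- apply: bounded_closed_compact; last exact: closed_ball_closed.
  exists r; split; first exact: num_real.
  move=> x rx v; rewrite /A closed_ballE // /closed_ball_ /= sub0r normrN.
  by move=> /le_trans; apply; exact: ltW.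
- apply: continuous_subspaceT => v.
  apply: (@continuous_comp _ _ _ trmx h); last exact: continuous_lipschitz_grad.
  move=> B /nbhs_ballP[e e0 eB]; apply/nbhs_ballP; exists e => // w vw.
  by apply: eB; case: vw => _ vw; split=> // i j; rewrite !mxE; exact: vw.
exists c^T => z.
have [zr|zr] := leP `|z^T| r.
  by have := cmin z^T; rewrite trmxK inE /A closed_ballE // /closed_ball_ /= sub0r normrN; apply.
have h0 : h c^T <= h 0.
  by have := cmin 0; rewrite trmx0; apply; rewrite inE; exact: closed_ballxx.
apply: (le_trans h0).
have zn : r <= enorm z.
  rewrite (le_trans (ltW zr)) //.
  rewrite [leLHS]/Num.Def.normr/= mx_normrE bigmax_le // => -[i j] _ /=.
  by rewrite mxE ord1 enorm_coord.
have := sc 0 z; rewrite subr0.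
have := norm_dot (grad h 0) z; rewrite ler_norml => A1 A2.
have : 0 <= enorm z * (mu / 2 * enorm z - enorm (grad h 0)).
  rewrite mulr_ge0 // subr_ge0; apply: (@le_trans _ _ (mu / 2 * r)).
    have -> : mu / 2 * r = enorm (grad h 0) + mu / 2.
      by rewrite /r; field; rewrite gt_eqF.
    by rewrite lerDl divr_ge0 // ltW.
  by rewrite ler_wpM2l // divr_ge0 // ltW.
by lra.
Qed.

Lemma argminP : is_argmin h (argmin h).
Proof. by rewrite /argmin; apply: xgetPex; exact: argmin_exists. Qed.

Lemma grad_argmin : grad h (argmin h) = 0.
Proof. by apply: argmin_grad; exact: argminP. Qed.

Lemma strongly_monotone_grad z z' :
  mu * enorm (z' - z) ^+ 2 <= dot (grad h z' - grad h z) (z' - z).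
Proof.
have := sc z z'; have := sc z' z.
by rewrite -opprB enormN dotNr dotBl; lra.
Qed.

Lemma dist_argmin_grad z : mu * enorm (z - argmin h) <= enorm (grad h z).
Proof.
have := strongly_monotone_grad (argmin h) z; rewrite grad_argmin subr0.
move=> /le_trans/(_ (cauchy_schwarz _ _)).
have [->|e0] := eqVneq (enorm (z - argmin h)) 0; first by rewrite !mulr0.
have ep : 0 < enorm (z - argmin h) by rewrite lt_def e0 enorm_ge0.
by rewrite expr2 mulrA ler_pM2r.
Qed.

Lemma quadratic_growth z :
  mu / 2 * enorm (z - argmin h) ^+ 2 <= h z - h (argmin h).
Proof. by have := sc (argmin h) z; rewrite grad_argmin dot0l; lra. Qed.

Lemma strong_convexity_le_smoothness : (0 < n)%N -> mu <= L.
Proof.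
move=> n0; pose e : 'cV[R]_n := delta_mx (Ordinal n0) 0.
have e1 : enorm e = 1.
  by apply/eqP; rewrite -(@eqrXn2 _ 2) // enorm_sqr dot_delta mxE !eqxx expr1n.
have := strongly_monotone_grad 0 e; rewrite subr0 e1 expr1n mulr1.
move=> /le_trans; apply; rewrite (le_trans (cauchy_schwarz _ _)) //.
by rewrite e1 mulr1 (le_trans (Lh _ _)) // subr0 e1 mulr1.
Qed.

End OneFunction.

(** * Accelerated gradient descent *)

Section Agd.
Variables (n : nat) (h : 'cV[R]_n -> R) (L kappa : R).
Hypothesis dh : forall z u, is_derive z u h (dot (grad h z) u).
Hypothesis kappa1 : 1 <= kappa.
Hypothesis L0 : 0 < L.
Hypothesis sc : grad_strongly_convex (L / kappa) h.
Hypothesis Lh : lipschitz_grad L h.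

Let mu := L / kappa.
Let zs := argmin h.
Let sk := Num.sqrt kappa.

(* Nesterov's Lyapunov function: [zt + sqrt kappa (zt - z)] is the auxiliary
   sequence of the estimate-sequence analysis. *)
Let energy (s : 'cV[R]_n * 'cV[R]_n) : R :=
  h s.1 - h zs + mu / 2 * enorm (s.2 + sk *: (s.2 - s.1) - zs) ^+ 2.

(** One step contracts the energy by [1 - q] with [q = 1 / sqrt kappa]. The inequalities combined
    are descent from [zt] to [z1], and convexity at [zt] towards [zs] with weight [q] and towards
    [z] with weight [1 - q]. *)
Lemma agd_energy z0 k :
  energy (agd_state h z0 L^-1 (momentum kappa) k) <=
  (1 - sk^-1) ^+ k * energy (z0, z0).
Proof.
have kp : 0 < kappa by apply: lt_le_trans kappa1.
have s1 : 1 <= sk by rewrite -sqrtr1 ler_wsqrtr.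
have s0 : 0 < sk by apply: lt_le_trans s1.
have ss : sk ^+ 2 = kappa by rewrite sqr_sqrtr // ltW.
elim: k => [|k IH]; first by rewrite expr0 mul1r.
set q := sk^-1; have q0 : 0 < q by rewrite invr_gt0.
have q1 : 0 <= 1 - q by rewrite subr_ge0 invf_le1.
rewrite exprS -mulrA (le_trans _ (ler_wpM2l q1 IH)) //.
rewrite /energy /=; case: (agd_state _ _ _ _ _) => z zt /=.
set d := grad h zt; set z1 := zt - L^-1 *: d.
have sq : sk * q = 1 by rewrite mulfV // gt_eqF.
set A := zt - zs; set W := zt + sk *: (zt - z) - zs.
have zE : zt - z = q *: (W - A).
  have -> : W - A = sk *: (zt - z) by rewrite /W /A opprB addrA subrK addrC addKr.
  by rewrite scalerA mulrC sq scale1r.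
(* With this momentum the auxiliary point moves to a convex combination of its old position and
   [zt], followed by a gradient step of length [sk / L]. *)
have -> : z1 + momentum kappa *: (z1 - z)
    + sk *: (z1 + momentum kappa *: (z1 - z) - z1) - zs =
    (1 - q) *: W + q *: A - (sk / L) *: d.
  apply/colP => i; rewrite /z1 /W /A /q /momentum -/sk !mxE; field.
  by rewrite !gt_eqF // addr_gt0.
have F1 : h z1 <= h zt - dot d d / (2 * L).
  have := descent_lemma dh zt (- (L^-1 *: d)) Lh.
  rewrite enormN enormZ exprMn real_normK ?num_real // enorm_sqr dotNr dotZr -/d -/z1.
  move=> le; apply: (le_trans le); rewrite le_eqVlt; apply/orP; left; apply/eqP.
  by field; rewrite gt_eqF.
have := sc zt zs; rewrite -opprB -/A enormN dotNr -/d enorm_sqr -/mu => F2.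
have := sc zt z; rewrite -opprB enormN dotNr -/d zE dotZr dotBr => F3.
have mu0 : 0 <= mu / 2 by rewrite !divr_ge0 // ltW.
have F3' := le_trans (ler_wpDr (mulr_ge0 mu0 (exprn_ge0 2 (enorm_ge0 _))) (lexx _)) F3.
have F4 := mulr_ge0 (mulr_ge0 mu0 (mulr_ge0 (ltW q0) q1)) (dotvv_ge0 (W - A)).
clearbody d W A; rewrite !enorm_sqr; move: F1 F2 F3' F4.
rewrite !(dotBl, dotBr, dotDl, dotDr, dotZl, dotZr) (dotC A W) (dotC W d) (dotC A d).
move=> F1 F2 F3' F4.
set X := mu / 2 * _.
(* As [mu * sk ^+ 2 = L], the square of the gradient step is exactly the decrease in [F1], and the
   cross terms in [d] match those of [F2] and [F3']. What remains is convexity of the squared norm,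
   that is [F4]. *)
have -> : X = mu / 2 * ((1 - q) ^+ 2 * dot W W + 2 * (q * (1 - q)) * dot W A
    + q ^+ 2 * dot A A) - q * ((1 - q) * dot d W + q * dot d A)
    + dot d d / (2 * L).
  by rewrite /X /mu -ss /q; field; rewrite !gt_eqF.
have := ler_wpM2l (ltW q0) F2; have := ler_wpM2l q1 F3'.
by lra.
Qed.

End Agd.
End Convex.

Section AgdRate.
Variable R : realType.

Lemma natceil_ge (r : R) : r <= (natceil r)%:R.
Proof.
have m0 : (0 <= Num.max 0 (Num.ceil r))%R by rewrite le_max lexx.
rewrite /natceil natr_absz ger0_norm //.
rewrite (le_trans (Num.Theory.ceil_ge r)) // ler_int le_max lexx orbT //.
Qed.

Lemma natceil_le (r : R) : 0 <= r -> (natceil r)%:R <= r + 1.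
Proof.
move=> r0; have c0 : (0 <= Num.ceil r)%R by rewrite Num.Theory.ceil_ge0 (lt_le_trans _ r0) // ltrN10.
rewrite /natceil natr_absz (max_idPr c0) ger0_norm //.
by have := Num.Theory.gt_pred_ceil r; rewrite intrB ltrBlDr => /ltW.
Qed.

Variables (n : nat) (h : 'cV[R]_n -> R) (L kappa : R).
Hypothesis dh : forall z u, is_derive z u h (dot (grad h z) u).
Hypothesis kappa1 : 1 <= kappa.
Hypothesis L0 : 0 < L.
Hypothesis sc : grad_strongly_convex (L / kappa) h.
Hypothesis Lh : lipschitz_grad L h.

(** Quadratic growth bounds the distance by the energy, and the initial energy is at most
    [(L + mu) / 2] times the squared initial distance; the ratio to [mu / 2] is [kappa + 1]. *)
Lemma agd_dist z0 k :
  enorm (agd h z0 k L^-1 (momentum kappa) - argmin h) ^+ 2 <=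
  (kappa + 1) * (1 - (Num.sqrt kappa)^-1) ^+ k * enorm (z0 - argmin h) ^+ 2.
Proof.
have kp : 0 < kappa by apply: lt_le_trans kappa1.
have mu0 : 0 < L / kappa by rewrite divr_gt0.
have s1 : 1 <= Num.sqrt kappa by rewrite -sqrtr1 ler_wsqrtr.
have s0 : 0 < Num.sqrt kappa by apply: lt_le_trans s1.
have q1 : 0 <= 1 - (Num.sqrt kappa)^-1 by rewrite subr_ge0 invf_le1.
have := agd_energy dh kappa1 L0 sc Lh z0 k; rewrite /= subrr scaler0 addr0 => E.
set Q := (1 - _) ^+ k in E *; have Q0 : 0 <= Q by rewrite exprn_ge0.
have := quadratic_growth dh mu0 sc Lh (agd h z0 k L^-1 (momentum kappa)).
have := descent_lemma dh (argmin h) (z0 - argmin h) Lh.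
rewrite (grad_argmin dh mu0 sc Lh) dot0l addr0 [argmin h + _]addrC subrK => E0 E1.
rewrite -(ler_pM2l (divr_gt0 mu0 (ltr0n _ 2))).
apply: (le_trans E1); apply: (@le_trans _ _ (Q * (h z0 - h (argmin h) +
   L / kappa / 2 * enorm (z0 - argmin h) ^+ 2))).
  apply: le_trans E; rewrite lerDl mulr_ge0 ?exprn_ge0 // divr_ge0 // ltW //.
rewrite [leRHS](_ : _ = Q * ((L / 2 + L / kappa / 2) * enorm (z0 - argmin h) ^+ 2)).
  by rewrite ler_wpM2l //; lra.
by field; rewrite gt_eqF.
Qed.

(** The squared error contracts like [exp (- K / sqrt kappa)], and [K] is chosen to make this at
    most [a^-2]. Allowing [kappa2 >= kappa] lets both inner problems share one iteration count. *)
Lemma agd_converges kappa2 e D z0 : kappa <= kappa2 -> 0 < e ->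
  enorm (z0 - argmin h) <= D ->
  enorm (agd h z0 (natceil (2 * Num.sqrt kappa2 *
            ln (Num.sqrt (kappa2 + 1) / e * D))) L^-1 (momentum kappa)
         - argmin h) <= e.
Proof.
move=> k2 e0 zD; set K := natceil _.
have kp : 0 < kappa by apply: lt_le_trans kappa1.
have k2p : 0 < kappa2 by apply: lt_le_trans k2.
have s1 : 1 <= Num.sqrt kappa by rewrite -sqrtr1 ler_wsqrtr.
have s0 : 0 < Num.sqrt kappa by apply: lt_le_trans s1.
have ss2 : Num.sqrt kappa <= Num.sqrt kappa2 by rewrite ler_wsqrtr.
have s20 : 0 < Num.sqrt kappa2 by apply: lt_le_trans ss2.
have D0 : 0 <= D by apply: le_trans zD.
rewrite -(@ler_pXn2r _ 2) ?nnegrE ?(ltW e0) //; apply: (le_trans (agd_dist z0 K)).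
set q := (Num.sqrt kappa)^-1.
have q0 : 0 < q by rewrite invr_gt0.
have q1 : 0 <= 1 - q by rewrite subr_ge0 invf_le1.
set Q := (1 - q) ^+ K; have Q0 : 0 <= Q by rewrite exprn_ge0.
set a := Num.sqrt (kappa2 + 1) / e * D.
suff Qa : Q * a ^+ 2 <= 1.
  have -> : e ^+ 2 = e ^+ 2 * 1 by rewrite mulr1.
  apply: le_trans (ler_wpM2l (exprn_ge0 2 (ltW e0)) Qa).
  have -> : e ^+ 2 * (Q * a ^+ 2) = (kappa2 + 1) * Q * D ^+ 2.
    rewrite /a -[kappa2 + 1 in RHS]sqr_sqrtr ?addr_ge0 ?(ltW k2p) //.
    by field; rewrite gt_eqF.
  rewrite ler_pM ?mulr_ge0 ?addr_ge0 ?exprn_ge0 ?(ltW kp) //.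
    by rewrite ler_wpM2r // lerD2r.
  by rewrite ler_pXn2r ?nnegrE.
have [D00|Dn0] := eqVneq D 0.
  by rewrite /a D00 mulr0 expr0n mulr0.
have Dp : 0 < D by rewrite lt_def Dn0.
have ap : 0 < a by rewrite !mulr_gt0 ?invr_gt0 // sqrtr_gt0 addr_gt0.
(* Here the logarithm is nonpositive and the count may be 0; the initial point is accurate enough,
   as [Q <= 1] suffices. *)
have [a1|a1] := leP a 1.
  by rewrite -[leRHS](mul1r 1) ler_pM ?exprn_ge0 ?exprn_ile1 ?(ltW ap) // gerBl ltW.
have QE : Q <= expR (- (q * K%:R)).
  rewrite -mulNr expRM_natr; apply: lerXn2r; rewrite ?nnegrE ?expR_ge0 //.
  by have := expR_ge1Dx (- q).
have Kq : 2 * ln a <= q * K%:R.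
  have l0 : 0 <= ln a by rewrite ln_ge0 // ltW.
  have := natceil_ge (2 * Num.sqrt kappa2 * ln a); rewrite -/K => H.
  rewrite [leRHS]mulrC /q ler_pdivlMr // (le_trans _ H) // mulrAC ler_wpM2r //.
  by rewrite ler_wpM2l.
have aE : a ^+ 2 = expR (2 * ln a).
  by rewrite expRM_natl lnK // posrE.
rewrite aE (le_trans (ler_wpM2r (expR_ge0 _) QE)) // -expRD -[leRHS]expR0 ler_expR.
by rewrite addrC subr_le0.
Qed.

End AgdRate.

(** * Coercive matrices and Schur complements *)

Section Coercive.
Variable R : realType.
Variables (n : nat) (A : 'M[R]_n) (mu : R).
Hypothesis mu0 : 0 < mu.
Hypothesis cA : forall v, mu * enorm v ^+ 2 <= dot v (A *m v).

Lemma coercive_enorm v : mu * enorm v <= enorm (A *m v).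
Proof.
have [v0|v0] := eqVneq (enorm v) 0; first by rewrite v0 mulr0.
have vp : 0 < enorm v by rewrite lt_def v0 enorm_ge0.
rewrite -(ler_pM2r vp) -mulrA -expr2 (le_trans (cA v)) // mulrC.
exact: cauchy_schwarz.
Qed.

Lemma coercive_unitmx : A \in unitmx.
Proof.
rewrite -unitmx_tr -row_free_unit; apply: inj_row_free => v vA.
have : A *m v^T = 0 by rewrite -[A]trmxK -trmx_mul vA trmx0.
move=> Av; have := coercive_enorm v^T; rewrite Av enorm0 pmulr_rle0 // => le.
by apply: trmx_inj; rewrite trmx0; apply: enorm0_eq0; apply/eqP; rewrite eq_le le enorm_ge0.
Qed.

Lemma coercive_invmx b : mu * enorm (invmx A *m b) <= enorm b.
Proof.
by rewrite (le_trans (coercive_enorm _)) // mulmxA mulmxV ?mul1mx // coercive_unitmx.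
Qed.

End Coercive.

Section SchurComplement.
Variables (R : realType) (dx dy : nat).
Implicit Types A H : 'M[R]_(dx + dy).

Definition schur A : 'M[R]_dx :=
  ulsubmx A - ursubmx A *m invmx (drsubmx A) *m dlsubmx A.

(** The Jacobian of the inner solution when [A] is the Hessian at that solution; [schur_lift] is
    then the tangent to its graph. *)
Definition schur_jac A : 'M[R]_(dy, dx) := - (invmx (drsubmx A) *m dlsubmx A).

Definition schur_lift A (u : 'cV[R]_dx) : 'cV[R]_(dx + dy) :=
  col_mx u (schur_jac A *m u).

Lemma dsubmxB (u v : 'cV[R]_(dx + dy)) : dsubmx (u - v) = dsubmx u - dsubmx v.
Proof. exact: linearB. Qed.

Lemma dsubmxD (u v : 'cV[R]_(dx + dy)) : dsubmx (u + v) = dsubmx u + dsubmx v.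
Proof. exact: linearD. Qed.

Lemma usubmxB (u v : 'cV[R]_(dx + dy)) : usubmx (u - v) = usubmx u - usubmx v.
Proof. exact: linearB. Qed.

Lemma dot_dsubmx (z : 'cV[R]_(dx + dy)) v : dot z (col_mx 0 v) = dot (dsubmx z) v.
Proof. by rewrite -{1}(vsubmxK z) dot_col_mx dot0r add0r. Qed.

Lemma dot_usubmx (z : 'cV[R]_(dx + dy)) v : dot z (col_mx v 0) = dot (usubmx z) v.
Proof. by rewrite -{1}(vsubmxK z) dot_col_mx dot0r addr0. Qed.

Variables (A : 'M[R]_(dx + dy)) (mu L : R).
Hypothesis mu0 : 0 < mu.
Hypothesis cA : forall v, mu * enorm v ^+ 2 <= dot v (drsubmx A *m v).
Hypothesis LA : forall v, enorm (A *m v) <= L * enorm v.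

Lemma schur_lift_ker u : A *m schur_lift A u = col_mx (schur A *m u) 0.
Proof.
rewrite /schur_lift mul_col_mx_blocks /schur /schur_jac; congr col_mx.
  by rewrite !(mulmxBl, mulNmx, mulmxN, mulmxA).
rewrite mulNmx mulmxN !mulmxA mulmxV ?mul1mx ?subrr //.
exact: coercive_unitmx mu0 cA.
Qed.

Lemma schur_jac_le u : enorm (schur_jac A *m u) <= L / mu * enorm u.
Proof.
rewrite mulrAC ler_pdivlMr // mulrC mulNmx enormN -mulmxA.
rewrite (le_trans (coercive_invmx mu0 cA _)) //.
have -> : dlsubmx A *m u = dsubmx (A *m col_mx u 0).
  by rewrite mul_col_mx_blocks !mulmx0 !addr0 col_mxKd.
rewrite (le_trans (enorm_dsubmx _)) // (le_trans (LA _)) //.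
by rewrite enorm_cols0.
Qed.

Lemma schur_lift_le u : enorm (schur_lift A u) <= (1 + L / mu) * enorm u.
Proof.
rewrite (le_trans (enorm_col_mx _ _)) //.
by rewrite mulrDl mul1r lerD2l schur_jac_le.
Qed.

Lemma dot_schur u v : dot (schur_lift A v) (A *m schur_lift A u) = dot v (schur A *m u).
Proof. by rewrite schur_lift_ker dot_usubmx col_mxKu. Qed.

Hypothesis sA : A^T = A.

Lemma schur_sym : (schur A)^T = schur A.
Proof.
apply/matrixP => i j; rewrite mxE.
have E k l : schur A k l = dot (delta_mx k 0) (schur A *m delta_mx l 0).
  by rewrite -colE dotC dot_delta [RHS]mxE.
by rewrite !E -!dot_schur dot_mulmx sA dotC.
Qed.

End SchurComplement.

Section SchurCompare.
Variables (R : realType) (dx dy : nat) (A H : 'M[R]_(dx + dy)) (mu muH : R).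
Hypothesis mu0 : 0 < mu.
Hypothesis muH0 : 0 < muH.
Hypothesis cA : forall v, mu * enorm v ^+ 2 <= dot v (drsubmx A *m v).
Hypothesis cH : forall v, muH * enorm v ^+ 2 <= dot v (drsubmx H *m v).
Hypothesis sH : H^T = H.

Lemma dot_schur_l u v :
  dot (schur_lift H v) (H *m schur_lift A u) = dot v (schur H *m u).
Proof.
rewrite dot_mulmx sH (schur_lift_ker muH0 cH) dot_col_mx dot0l addr0 dotC.
by rewrite dot_mulmx (schur_sym muH0 cH sH) dotC.
Qed.

(** Each matrix sends its own lift into the x-block, and the two lifts have prescribed x-parts.
    Hence the difference is exactly bilinear in [H - A], and no difference of inverses has to be
    estimated. *)
Lemma dot_schurB u v :
  dot v ((schur H - schur A) *m u) =
  dot (schur_lift H v) ((H - A) *m schur_lift A u).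
Proof.
rewrite mulmxBl dotBr [in RHS]mulmxBl [in RHS]dotBr dot_schur_l.
by rewrite (schur_lift_ker mu0 cA) dot_usubmx col_mxKu.
Qed.

(** Completing the square: the Schur complement is the minimum of the quadratic form over all
    vectors with x-part [u], so the lift of any other matrix gives an upper bound. *)
Lemma schur_le_quad u :
  dot u (schur H *m u) <= dot (schur_lift A u) (H *m schur_lift A u).
Proof.
rewrite -dot_schur_l -subr_ge0.
have D : schur_lift A u - schur_lift H u = col_mx 0 (schur_jac A *m u - schur_jac H *m u).
  by rewrite /schur_lift opp_col_mx add_col_mx subrr.
have E : dot (schur_lift H u) (H *m schur_lift A u) =
         dot (schur_lift A u) (H *m schur_lift H u).
  by rewrite dot_mulmx sH dotC.
have K : dot (schur_lift A u - schur_lift H u) (H *m schur_lift H u) = 0.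
  by rewrite D (schur_lift_ker muH0 cH) dot_col_mx dot0l dot0r addr0.
have -> : dot (schur_lift A u) (H *m schur_lift A u)
    - dot (schur_lift H u) (H *m schur_lift A u) =
    dot (schur_lift A u - schur_lift H u) (H *m (schur_lift A u - schur_lift H u)).
  by rewrite mulmxBr [RHS]dotBr K subr0 dotBl.
rewrite D dotC dot_dsubmx mul_col_mx_blocks mulmx0 add0r col_mxKd dotC mulmx0 add0r.
by apply: le_trans (cH _); rewrite mulr_ge0 ?exprn_ge0 // ltW.
Qed.

End SchurCompare.

(** * The value function of a strongly convex problem *)

Section Partial.
Variable R : realType.

Lemma is_derive_comb n (f g : 'cV[R]_n -> R) a z u df dg :
  is_derive z u f df -> is_derive z u g dg ->
  is_derive z u (fun z' => f z' + a * g z') (df + a * dg).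
Proof.
move=> Df Dg.
have -> : (fun z' => f z' + a * g z') = f + a \*: g by apply/funext.
by apply: is_deriveD => //; apply: is_deriveZ.
Qed.

Lemma C2_comb n (f g : 'cV[R]_n -> R) a : C2_smooth f -> C2_smooth g ->
  let F z := f z + a * g z in
  [/\ C2_smooth F, (forall z, grad F z = grad f z + a *: grad g z) &
      (forall z, hess F z = hess f z + a *: hess g z)].
Proof.
move=> [f1 f2] [g1 g2] F.
have gE z : grad F z = grad f z + a *: grad g z.
  apply: grad_is_derive => u; rewrite dotDl dotZl.
  by apply: is_derive_comb.
have d2 z u w : is_derive z u (fun z' => dot w (grad F z'))
    (dot w ((hess f z + a *: hess g z) *m u)).
  have -> : (fun z' => dot w (grad F z')) =
            (fun z' => dot w (grad f z') + a * dot w (grad g z')).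
    by apply/funext => z'; rewrite gE dotDr dotZr.
  by rewrite mulmxDl -scalemxAl dotDr dotZr; apply: is_derive_comb.
have hE z : hess F z = hess f z + a *: hess g z by apply: hess_is_derive.
split; [split|exact: gE|exact: hE].
  by move=> z u; rewrite gE dotDl dotZl; apply: is_derive_comb.
by move=> z u w; rewrite hE; exact: d2.
Qed.

Lemma grad_addr n (h : 'cV[R]_n -> R) c z :
  grad (fun z' => h z' + c) z = grad h z.
Proof.
apply/colP => i; rewrite !mxE.
rewrite /derive.
have -> // : (fun t : R => t^-1 *: (((fun z' => h z' + c) \o shift z)
                (t *: delta_mx i 0) - (h z + c))) =
          (fun t => t^-1 *: ((h \o shift z) (t *: delta_mx i 0) - h z)).
by apply/funext => t /=; rewrite opprD addrACA subrr addr0.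
Qed.

Lemma argmin_addr n (h : 'cV[R]_n -> R) c :
  argmin (fun z' => h z' + c) = argmin h.
Proof.
rewrite /argmin; congr (xget _); apply/funext => z; apply/propext; split=> H z'.
  by have := H z'; rewrite lerD2r.
by rewrite lerD2r.
Qed.

Variables (dx dy : nat) (G : 'cV[R]_(dx + dy) -> R) (x : 'cV[R]_dx).

Lemma is_derive_partial (F : 'cV[R]_(dx + dy) -> R) y v l :
  is_derive (col_mx x y) (col_mx 0 v) F l ->
  is_derive y v (fun y' => F (col_mx x y')) l.
Proof.
case=> dF <-.
have E : (fun t : R => t^-1 *: (((fun y' => F (col_mx x y')) \o shift y) (t *: v)
            - F (col_mx x y))) =
         (fun t => t^-1 *: ((F \o shift (col_mx x y)) (t *: col_mx 0 v)
            - F (col_mx x y))).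
  apply/funext => t /=; congr (_ *: (F _ - _)).
  by rewrite /shift /= scale_col_mx add_col_mx scaler0 add0r.
by apply: DeriveDef; rewrite /derivable /derive E.
Qed.

Hypothesis CG : C2_smooth G.

Lemma grad_partial y : grad (fun y' => G (col_mx x y')) y = dsubmx (grad G (col_mx x y)).
Proof.
apply: grad_is_derive => u; rewrite -dot_dsubmx.
by apply: is_derive_partial; exact: CG.1.
Qed.

Lemma hess_partial y : hess (fun y' => G (col_mx x y')) y = drsubmx (hess G (col_mx x y)).
Proof.
apply: hess_is_derive => u w.
have -> : (fun y' => dot w (grad (fun y => G (col_mx x y)) y')) =
   (fun y' => (fun z => dot (col_mx 0 w) (grad G z)) (col_mx x y')).
  by apply/funext => y'; rewrite grad_partial [RHS]dotC dot_dsubmx dotC.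
have := CG.2 (col_mx x y) (col_mx 0 u) (col_mx 0 w) => H.
suff -> : dot w (drsubmx (hess G (col_mx x y)) *m u) =
   dot (col_mx 0 w) (hess G (col_mx x y) *m col_mx 0 u).
  exact: (is_derive_partial (F := fun z => dot (col_mx 0 w) (grad G z))).
by rewrite mul_col_mx_blocks dot_col_mx dot0l add0r mulmx0 add0r.
Qed.

Lemma C2_partial : C2_smooth (fun y => G (col_mx x y)).
Proof.
split=> y u.
  rewrite grad_partial -dot_dsubmx.
  by apply: is_derive_partial; exact: CG.1.
move=> w; rewrite hess_partial.
have -> : (fun y' => dot w (grad (fun y => G (col_mx x y)) y')) =
   (fun y' => (fun z => dot (col_mx 0 w) (grad G z)) (col_mx x y')).
  by apply/funext => y'; rewrite grad_partial [RHS]dotC dot_dsubmx dotC.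
suff -> : dot w (drsubmx (hess G (col_mx x y)) *m u) =
   dot (col_mx 0 w) (hess G (col_mx x y) *m col_mx 0 u).
  by apply: (is_derive_partial (F := fun z => dot (col_mx 0 w) (grad G z))); exact: CG.2.
by rewrite mul_col_mx_blocks dot_col_mx dot0l add0r mulmx0 add0r.
Qed.

Lemma lipschitz_grad_partial L :
  lipschitz_grad L G -> lipschitz_grad L (fun y => G (col_mx x y)).
Proof.
move=> LG y y'; rewrite !grad_partial -dsubmxB.
rewrite (le_trans (enorm_dsubmx _)) // (le_trans (LG _ _)) //.
by rewrite opp_col_mx add_col_mx subrr enorm_col0.
Qed.

End Partial.

Section ValueFunction.
Variables (R : realType) (dx dy : nat) (G : 'cV[R]_(dx + dy) -> R).
Variables (mu L rho : R).
Hypothesis mu0 : 0 < mu.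
Hypothesis CG : C2_smooth G.
Hypothesis sc : forall x, grad_strongly_convex mu (fun y => G (col_mx x y)).
Hypothesis LG : lipschitz_grad L G.
Hypothesis rhoG : lipschitz_hess rho G.
Hypothesis L0 : 0 <= L.
Hypothesis rho0 : 0 <= rho.

Local Notation ys := (ystar G).
Definition zstar x := col_mx x (ys x).
Local Notation zs := zstar.

Lemma grad_ystar x : dsubmx (grad G (zs x)) = 0.
Proof.
rewrite -grad_partial //; apply: (grad_argmin (C2_partial x CG).1 mu0) => //.
exact: lipschitz_grad_partial.
Qed.

Lemma dist_ystar x y :
  mu * enorm (y - ys x) <= enorm (dsubmx (grad G (col_mx x y))).
Proof.
rewrite -grad_partial //; apply: (dist_argmin_grad (C2_partial x CG).1 mu0) => //.
exact: lipschitz_grad_partial.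
Qed.

Lemma ystar_min x y : G (zs x) <= G (col_mx x y).
Proof.
apply: (argminP (C2_partial x CG).1 mu0 (@sc x)).
by apply: lipschitz_grad_partial; [exact: CG|exact: LG].
Qed.

(** The old solution is nearly stationary for the new problem: its y-gradient there has norm at most
    [L * enorm (x' - x)]. *)
Lemma ystar_lipschitz x x' : enorm (ys x' - ys x) <= L / mu * enorm (x' - x).
Proof.
rewrite mulrAC ler_pdivlMr // mulrC enormBC (le_trans (dist_ystar _ _)) //.
rewrite -[dsubmx _]subr0 -(grad_ystar x) -dsubmxB.
rewrite (le_trans (enorm_dsubmx _)) // (le_trans (LG _ _)) //.
by rewrite opp_col_mx add_col_mx subrr enorm_cols0.
Qed.

Lemma zstar_lipschitz x x' : enorm (zs x' - zs x) <= (1 + L / mu) * enorm (x' - x).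
Proof.
rewrite /zs opp_col_mx add_col_mx (le_trans (enorm_col_mx _ _)) //.
by rewrite mulrDl mul1r lerD2l ystar_lipschitz.
Qed.

Lemma hessyy_coercive x y v :
  mu * enorm v ^+ 2 <= dot v (drsubmx (hess G (col_mx x y)) *m v).
Proof.
rewrite -hess_partial //; apply: strongly_monotone_hess; last exact: sc.
exact: C2_partial.
Qed.

Lemma zstar_lift_ker x u :
  hess G (zs x) *m schur_lift (hess G (zs x)) u = col_mx (schur (hess G (zs x)) *m u) 0.
Proof. exact: schur_lift_ker mu0 (hessyy_coercive _ _) _. Qed.

Lemma zstar_lift_le x u :
  enorm (schur_lift (hess G (zs x)) u) <= (1 + L / mu) * enorm u.
Proof.
apply: schur_lift_le mu0 (hessyy_coercive _ _) _ _ => v.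
exact: lipschitz_grad_hess.
Qed.

Let c1 := rho / 2 * (1 + L / mu) ^+ 2 / mu.
Let c1_ge0 : 0 <= c1.
Proof. by rewrite !(divr_ge0, mulr_ge0, exprn_ge0) ?addr_ge0 ?divr_ge0 ?(ltW mu0). Qed.

Lemma grad_zstar_taylor x u :
  enorm (grad G (zs (x + u)) - grad G (zs x)
         - hess G (zs x) *m (zs (x + u) - zs x))
  <= rho / 2 * (1 + L / mu) ^+ 2 * enorm u ^+ 2.
Proof.
have := grad_taylor CG (zs x) (zs (x + u) - zs x) rhoG.
rewrite [zs x + _]addrC subrK => /le_trans; apply.
rewrite -[leRHS]mulrA ler_wpM2l ?divr_ge0 // -exprMn ler_pXn2r ?nnegrE //.
  by have := zstar_lipschitz x (x + u); rewrite [x + u]addrC addrK.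
by rewrite mulr_ge0 // addr_ge0 // divr_ge0 // ltW.
Qed.

(** The y-gradient vanishes at both solutions, so the yy-block applied to the remainder is minus the
    y-part of the Taylor remainder of [grad G]; coercivity of that block then bounds the
    remainder. *)
Lemma ystar_expansion x u :
  enorm (ys (x + u) - ys x - schur_jac (hess G (zs x)) *m u) <= c1 * enorm u ^+ 2.
Proof.
rewrite /c1 mulrAC ler_pdivlMr // mulrC.
rewrite (le_trans (coercive_enorm (hessyy_coercive x (ys x)) _)) //.
apply: le_trans (grad_zstar_taylor x u).
have -> : drsubmx (hess G (col_mx x (ys x))) *m (ys (x + u) - ys x - schur_jac (hess G (zs x)) *m u)
  = - dsubmx (grad G (zs (x + u)) - grad G (zs x)
              - hess G (zs x) *m (zs (x + u) - zs x)).
  rewrite !dsubmxB !grad_ystar subrr sub0r opprK [in RHS]opp_col_mx add_col_mx.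
  rewrite [x + u]addrC addrK mul_col_mx_blocks col_mxKd mulmxBr /schur_jac.
  rewrite mulNmx mulmxN opprK !mulmxA mulmxV ?mul1mx; first by rewrite [RHS]addrC.
  exact: coercive_unitmx mu0 (hessyy_coercive _ _).
by rewrite enormN enorm_dsubmx.
Qed.

Lemma zstar_expansion x u :
  enorm (zs (x + u) - zs x - schur_lift (hess G (zs x)) u) <= c1 * enorm u ^+ 2.
Proof.
rewrite /zs /schur_lift !opp_col_mx !add_col_mx [x + u]addrC addrK subrr enorm_col0.
by rewrite [u + x]addrC ystar_expansion.
Qed.

(** Envelope argument: each end value is compared with the other end's inner solution held fixed, so
    only displacements in x enter and the derivative of [ys] drops out. *)
Lemma value_expansion x u :
  `|G (zs (x + u)) - G (zs x) - dot (usubmx (grad G (zs x))) u|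
  <= L * (2 + L / mu) * enorm u ^+ 2.
Proof.
have m0 : 0 <= L / mu by rewrite divr_ge0 // ltW.
have A1 := ystar_min (x + u) (ys x).
have A2 := ystar_min x (ys (x + u)).
have := descent_lemma CG.1 (zs x) (col_mx u 0) LG.
rewrite dot_usubmx enorm_cols0 {2}/zs add_col_mx addr0 => B1.
have := descent_lemma CG.1 (zs (x + u)) (col_mx (- u) 0) LG.
rewrite dot_usubmx enorm_cols0 enormN {2}/zs add_col_mx addr0 addrK dotNr => B2.
have : - dot (usubmx (grad G (zs (x + u))) - usubmx (grad G (zs x))) u
       <= L * (1 + L / mu) * enorm u ^+ 2.
  rewrite -dotNr (le_trans (cauchy_schwarz _ _)) // enormN expr2 mulrA ler_wpM2r //.
  rewrite -usubmxB (le_trans (enorm_usubmx _)) // (le_trans (LG _ _)) // -mulrA ler_wpM2l //.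
  by have := zstar_lipschitz x (x + u); rewrite [x + u]addrC addrK.
rewrite dotBl => B3.
have : 0 <= L * enorm u ^+ 2 by rewrite mulr_ge0 ?exprn_ge0.
have := mulr_ge0 (mulr_ge0 L0 m0) (exprn_ge0 2 (enorm_ge0 u)).
rewrite ler_norml; move: A1 A2 B1 B2 B3.
move: (G (zs x)) (G (zs (x + u))) (G (col_mx (x + u) _)) (G (col_mx x _)).
move: (dot _ _) (dot _ _) (enorm u ^+ 2) (L / mu) => *.
by lra.
Qed.

Let V x := G (zs x).

Lemma is_derive_value x u : is_derive x u V (dot (usubmx (grad G (zs x))) u).
Proof.
apply: (is_derive_quad (c := L * (2 + L / mu) * enorm u ^+ 2)) => t _.
have := value_expansion x (t *: u).
by rewrite dotZr enormZ exprMn real_normK ?num_real // mulrA mulrAC.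
Qed.

Lemma grad_value x : grad V x = usubmx (grad G (zs x)).
Proof. by apply: grad_is_derive => u; exact: is_derive_value. Qed.

Let c2 := rho / 2 * (1 + L / mu) ^+ 2 + L * c1.

(** Replacing the increment of [zs] by its lift costs a quadratic error, and the Hessian applied to
    the lift has the Schur complement as its x-block. *)
Lemma grad_value_expansion x u :
  enorm (grad V (x + u) - grad V x - schur (hess G (zs x)) *m u)
  <= c2 * enorm u ^+ 2.
Proof.
rewrite !grad_value.
have -> : schur (hess G (zs x)) *m u = usubmx (hess G (zs x) *m schur_lift (hess G (zs x)) u).
  by rewrite zstar_lift_ker col_mxKu.
rewrite -!usubmxB (le_trans (enorm_usubmx _)) //.
rewrite (le_trans (enorm_triangle _ (hess G (zs x) *m (zs (x + u) - zs x)) _)) //.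
rewrite /c2 mulrDl lerD ?grad_zstar_taylor //.
rewrite -mulmxBr (le_trans (lipschitz_grad_hess CG _ _ LG)) // -mulrA ler_wpM2l //.
exact: zstar_expansion.
Qed.

Lemma is_derive_grad_value x u w :
  is_derive x u (fun x' => dot w (grad V x')) (dot w (schur (hess G (zs x)) *m u)).
Proof.
apply: (is_derive_quad (c := enorm w * (c2 * enorm u ^+ 2))) => t _.
rewrite -dotBr -dotZr -dotBr (le_trans (norm_dot _ _)) // -mulrA ler_wpM2l //.
rewrite scalemxAr (le_trans (grad_value_expansion _ _)) //.
rewrite enormZ exprMn real_normK ?num_real //.
by rewrite le_eqVlt; apply/orP; left; apply/eqP; ring.
Qed.

Lemma hess_value x : hess V x = schur (hess G (zs x)).
Proof. by apply: hess_is_derive => u w; exact: is_derive_grad_value. Qed.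

Lemma C2_value : C2_smooth V.
Proof.
split=> [x u|x u w]; first by rewrite grad_value; exact: is_derive_value.
by rewrite hess_value; exact: is_derive_grad_value.
Qed.

End ValueFunction.

(** * The hyperobjective *)

(** Difference of the linear systems defining two multipliers. The right-hand side is small when the
    data are close, so coercivity makes the multiplier Lipschitz. *)
Lemma lagr_shift (R : realType) dx dy (A A' : 'M[R]_(dx + dy)) (F F' : 'cV[R]_(dx + dy))
    (p p' : 'cV[R]_dy) :
  drsubmx A *m p = - dsubmx F -> drsubmx A' *m p' = - dsubmx F' ->
  drsubmx A' *m (p' - p) = - dsubmx (F' - F + (A' - A) *m col_mx 0 p).
Proof.
move=> Ap Ap'; rewrite mulmxBr Ap' mulmxBl dsubmxD !dsubmxB.
rewrite (mul_col_mx_blocks A' 0 p) (mul_col_mx_blocks A 0 p) !col_mxKd.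
rewrite (mulmx0 _ (dlsubmx A')) (mulmx0 _ (dlsubmx A)) !add0r Ap.
by rewrite opprK [_ + dsubmx F]addrC addrA subrK opprD.
Qed.

(** The product rule with explicit remainders. Here [d] is the true increment of the base point and
    [w] its linearization, while [D] and [D'] are the derivatives of the lower Hessian along [d] and
    [w]. *)
Lemma lagr_decomp (R : realType) n (A A' B D D' : 'M[R]_n) (F F' d w q q' : 'cV[R]_n) :
  F' + A' *m q' - (F + A *m q) - (B *m w + D' *m q) =
  (F' - F - B *m d) + B *m (d - w) + (A' - A - D) *m q + (D - D') *m q
  + (A' - A) *m (q' - q) + A *m (q' - q).
Proof.
rewrite !(mulmxBl, mulmxBr).
move: (A *m q) (A *m q') (A' *m q) (A' *m q') (B *m w) (B *m d) (D *m q) (D' *m q).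
by move=> *; apply/colP => i; rewrite !mxE; ring.
Qed.

Lemma col_mx0B (R : realType) dx dy (q q' : 'cV[R]_dy) :
  col_mx 0 (q' - q) = col_mx 0 q' - col_mx 0 q :> 'cV[R]_(dx + dy).
Proof. by rewrite opp_col_mx add_col_mx subrr. Qed.

Section Hyper.
Variables (R : realType) (dx dy : nat) (f g : 'cV[R]_(dx + dy) -> R).
Variables (mu C L rho nu : R).
Hypothesis mu0 : 0 < mu.
Hypothesis C0 : 0 <= C.
Hypothesis L0 : 0 <= L.
Hypothesis rho0 : 0 <= rho.
Hypothesis nu0 : 0 <= nu.
Hypothesis Cf : C2_smooth f.
Hypothesis Cg : C2_smooth g.
Hypothesis sc : forall x, grad_strongly_convex mu (fun y => g (col_mx x y)).
Hypothesis Lf : lipschitz_grad L f.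
Hypothesis Lg : lipschitz_grad L g.
Hypothesis Hf : lipschitz_hess rho f.
Hypothesis Hg : lipschitz_hess rho g.
Hypothesis dHg : forall z, differentiable (hess g) z.
Hypothesis Tg : lipschitz_third nu g.
Hypothesis fC : lipschitz_fun C f.

Local Notation zs := (zstar g).
Let A x := hess g (zs x).
Let B x := hess f (zs x).
Let P x := schur_lift (A x).

Lemma hessg_sym z : (hess g z)^T = hess g z.
Proof. exact: hess_sym Cg Hg. Qed.

Lemma A_coercive x v : mu * enorm v ^+ 2 <= dot v (drsubmx (A x) *m v).
Proof. exact: hessyy_coercive. Qed.

Lemma gradf_le z : enorm (grad f z) <= C.
Proof. exact: (lipschitz_fun_grad Cf.1 z C0 fC). Qed.

(** The Lagrange multiplier of the constraint that the y-gradient of [g] vanishes. *)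
Definition multiplier x : 'cV[R]_dy :=
  - (invmx (drsubmx (A x)) *m dsubmx (grad f (zs x))).
Local Notation p := multiplier.

Lemma multiplier_eq x : drsubmx (A x) *m p x = - dsubmx (grad f (zs x)).
Proof.
rewrite mulmxN mulmxA mulmxV ?mul1mx //.
exact: coercive_unitmx mu0 (A_coercive x).
Qed.

Lemma multiplier_le x : enorm (p x) <= C / mu.
Proof.
rewrite ler_pdivlMr // mulrC (le_trans (coercive_enorm (A_coercive x) _)) //.
by rewrite multiplier_eq enormN (le_trans (enorm_dsubmx _)) // gradf_le.
Qed.

(** The adjoint of the lift [P x]. *)
Definition lift_adj x (z : 'cV[R]_(dx + dy)) : 'cV[R]_dx :=
  usubmx z + (schur_jac (A x))^T *m dsubmx z.

Lemma lift_adjE x z u : dot (lift_adj x z) u = dot z (P x u).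
Proof.
by rewrite dotDl -dot_mulmx -[in RHS](vsubmxK z) dot_col_mx.
Qed.

Lemma lift_adjB x z z' : lift_adj x (z - z') = lift_adj x z - lift_adj x z'.
Proof. by apply: eq_dot => w; rewrite dotBr ![dot w _]dotC !lift_adjE dotBl. Qed.

Lemma lift_adjD x z z' : lift_adj x (z + z') = lift_adj x z + lift_adj x z'.
Proof. by apply: eq_dot => w; rewrite dotDr ![dot w _]dotC !lift_adjE dotDl. Qed.

Lemma P_le x u : enorm (P x u) <= (1 + L / mu) * enorm u.
Proof. exact: zstar_lift_le. Qed.

Let k := 1 + L / mu.
Let k_ge0 : 0 <= k. Proof. by rewrite addr_ge0 // divr_ge0 // ltW. Qed.

Lemma lift_adj_le x z : enorm (lift_adj x z) <= k * enorm z.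
Proof.
apply: enorm_le_dot => [|w]; first by rewrite mulr_ge0.
rewrite dotC lift_adjE (le_trans (cauchy_schwarz _ _)) // mulrC mulrAC.
by rewrite ler_wpM2r // P_le.
Qed.

(** By symmetry [A x] moves onto the lift and leaves only an x-block, orthogonal to [col_mx 0 q].
    This is what makes multiplier terms disappear. *)
Lemma lift_adj_A0 x q : lift_adj x (A x *m col_mx 0 q) = 0.
Proof.
apply: eq_dot => w; rewrite dotC lift_adjE dotC dot_mulmx hessg_sym.
by rewrite (zstar_lift_ker mu0 Cg sc) dot_col_mx !(dot0r, dot0l) addr0.
Qed.

(** The gradient in z of the Lagrangian, with the multiplier held fixed. *)
Definition lagr_grad x := grad f (zs x) + A x *m col_mx 0 (p x).

Lemma lagr_grad_dsub x : dsubmx (lagr_grad x) = 0.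
Proof.
rewrite /lagr_grad mul_col_mx_blocks dsubmxD col_mxKd mulmx0 add0r.
by rewrite multiplier_eq subrr.
Qed.

Definition hyper_grad x : 'cV[R]_dx := lift_adj x (grad f (zs x)).

(* The y-block of [lagr_grad] vanishes, so the lift may be frozen at any base
   point [x]; hence the hypergradient is differentiated without differentiating
   the inverse of the lower-level Hessian. *)
Lemma hyper_gradE x x' : hyper_grad x' = lift_adj x (lagr_grad x').
Proof.
transitivity (lift_adj x' (lagr_grad x')).
  apply: eq_dot => w; rewrite dotC [RHS]dotC !lift_adjE dotDl -!lift_adjE.
  by rewrite lift_adj_A0 dot0l addr0.
rewrite /lift_adj (lagr_grad_dsub x').
by rewrite [X in _ + X = _]mulmx0 [X in _ = _ + X]mulmx0.
Qed.

Let c1 := rho / 2 * k ^+ 2 / mu.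
Let c1_ge0 : 0 <= c1.
Proof. by rewrite divr_ge0 ?mulr_ge0 ?divr_ge0 ?exprn_ge0 // ltW. Qed.

Lemma zs_expansion x u : enorm (zs (x + u) - zs x - P x u) <= c1 * enorm u ^+ 2.
Proof. exact: zstar_expansion. Qed.

Lemma zs_lip x u : enorm (zs (x + u) - zs x) <= k * enorm u.
Proof.
have := zstar_lipschitz mu0 Cg sc Lg x (x + u).
by rewrite [x + u]addrC addrK.
Qed.

Lemma hyper_expansion x u :
  `|hyperobj f g (x + u) - hyperobj f g x - dot (hyper_grad x) u|
  <= (2 * L * k ^+ 2 + C * c1) * enorm u ^+ 2.
Proof.
rewrite /hyperobj -!/(zs _) lift_adjE.
have := descent_lemma Cf.1 (zs x) (zs (x + u) - zs x) Lf.
have := descent_lemma Cf.1 (zs (x + u)) (zs x - zs (x + u)) Lf.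
rewrite ![_ + (_ - _)]addrC !subrK enormBC.
set d := zs (x + u) - zs x => B2 B1.
have dE : zs x - zs (x + u) = - d by rewrite opprB.
have := norm_dot (grad f (zs (x + u)) - grad f (zs x)) d.
have dk : enorm d ^+ 2 <= k ^+ 2 * enorm u ^+ 2.
  by rewrite -exprMn ler_pXn2r ?nnegrE ?mulr_ge0 // zs_lip.
have := Lf (zs (x + u)) (zs x); rewrite -/d => B3.
move/le_trans/(_ (ler_wpM2r (enorm_ge0 _) B3)).
have := norm_dot (grad f (zs x)) (d - P x u).
have B4 : enorm (grad f (zs x)) * enorm (d - P x u) <= C * (c1 * enorm u ^+ 2).
  by rewrite ler_pM // ?gradf_le // zs_expansion.
move/le_trans/(_ B4); move: B1 B2; rewrite dE !dotNr dotBr dotBl !ler_norml.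
have := ler_wpM2l L0 dk.
move: (f (zs x)) (f (zs (x + u))) (dot (grad f (zs x)) d) (dot (grad f (zs (x + u))) d).
move: (dot (grad f (zs x)) (P x u)) => *; lra.
Qed.

Lemma is_derive_hyper x u : is_derive x u (hyperobj f g) (dot (hyper_grad x) u).
Proof.
apply: (is_derive_quad (c := (2 * L * k ^+ 2 + C * c1) * enorm u ^+ 2)) => t _.
have := hyper_expansion x (t *: u).
by rewrite dotZr enormZ exprMn real_normK ?num_real // mulrA mulrAC.
Qed.

Lemma grad_hyper x : grad (hyperobj f g) x = hyper_grad x.
Proof. by apply: grad_is_derive => u; exact: is_derive_hyper. Qed.

Definition hyper_hess x (u : 'cV[R]_dx) : 'cV[R]_dx :=
  lift_adj x (B x *m P x u + 'D_(P x u) (hess g) (zs x) *m col_mx 0 (p x)).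

Lemma PD x a u v : P x (a *: u + v) = a *: P x u + P x v.
Proof.
by rewrite /P /schur_lift mulmxDr -scalemxAr scale_col_mx add_col_mx.
Qed.

Lemma hyper_hess_linear x a u v :
  hyper_hess x (a *: u + v) = a *: hyper_hess x u + hyper_hess x v.
Proof.
rewrite /hyper_hess PD (derive_hess_linear dHg) mulmxDr -scalemxAr.
rewrite mulmxDl -scalemxAl addrACA -scalerDr lift_adjD; congr (_ + _).
by apply: eq_dot => w; rewrite [in RHS]dotZr ![dot w _]dotC !lift_adjE dotZl.
Qed.

Let kp := (L + rho * (C / mu)) / mu.

Lemma multiplier_lip x u : enorm (p (x + u) - p x) <= kp * (k * enorm u).
Proof.
rewrite /kp mulrAC ler_pdivlMr // mulrC.
rewrite (le_trans (coercive_enorm (A_coercive (x + u)) _)) //.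
have -> : drsubmx (A (x + u)) *m (p (x + u) - p x) =
  - dsubmx (grad f (zs (x + u)) - grad f (zs x)
            + (A (x + u) - A x) *m col_mx 0 (p x)).
  by apply: lagr_shift; exact: multiplier_eq.
rewrite enormN (le_trans (enorm_dsubmx _)) // (le_trans (enormD _ _)) // mulrDl lerD //.
  by rewrite (le_trans (Lf _ _)) // ler_wpM2l // zs_lip.
have := hess_lipschitz_enorm (zs x) (zs (x + u) - zs x) (col_mx 0 (p x)) Hg.
rewrite [zs x + _]addrC subrK enorm_col0 => /le_trans; apply.
rewrite [leRHS]mulrAC ler_pM ?multiplier_le ?mulr_ge0 // ler_wpM2l //.
exact: zs_lip.
Qed.

Let c3 := k * (rho / 2 * k ^+ 2 + L * c1 + nu / 2 * k ^+ 2 * (C / mu)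
               + rho * c1 * (C / mu) + rho * k * (kp * k)).

Lemma hyper_grad_expansion x u :
  enorm (hyper_grad (x + u) - hyper_grad x - hyper_hess x u) <= c3 * enorm u ^+ 2.
Proof.
rewrite (hyper_gradE x (x + u)) (hyper_gradE x x) /hyper_hess -!lift_adjB.
set d := zs (x + u) - zs x.
have zd : zs (x + u) = zs x + d by rewrite /d [RHS]addrC subrK.
set p' := p (x + u).
have -> : lagr_grad (x + u) - lagr_grad x
    - (B x *m P x u + 'D_(P x u) (hess g) (zs x) *m col_mx 0 (p x)) =
  (grad f (zs (x + u)) - grad f (zs x) - B x *m d)
  + B x *m (d - P x u)
  + (A (x + u) - A x - 'D_d (hess g) (zs x)) *m col_mx 0 (p x)
  + 'D_(d - P x u) (hess g) (zs x) *m col_mx 0 (p x)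
  + (A (x + u) - A x) *m col_mx 0 (p' - p x)
  + A x *m col_mx 0 (p' - p x).
  have -> : 'D_(d - P x u) (hess g) (zs x) =
      'D_d (hess g) (zs x) - 'D_(P x u) (hess g) (zs x).
    rewrite -[d - _]addrC -scaleN1r (derive_hess_linear dHg) scaleN1r.
    by rewrite addrC.
  rewrite col_mx0B; exact: lagr_decomp.
(* The last summand, the only one that is merely of first order in [u], is annihilated; the other
   five are quadratic. *)
rewrite lift_adjD lift_adj_A0 addr0 (le_trans (lift_adj_le _ _)) // -mulrA ler_wpM2l //.
have u2 : 0 <= enorm u ^+ 2 by rewrite exprn_ge0.
have dk : enorm d <= k * enorm u by exact: zs_lip.
have dk2 : enorm d ^+ 2 <= k ^+ 2 * enorm u ^+ 2.
  by rewrite -exprMn ler_pXn2r ?nnegrE ?mulr_ge0.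
have pb : enorm (col_mx (0 : 'cV[R]_dx) (p x)) <= C / mu.
  by rewrite enorm_col0 multiplier_le.
have dP : enorm (d - P x u) <= c1 * enorm u ^+ 2 by exact: zs_expansion.
have T1 : enorm (grad f (zs (x + u)) - grad f (zs x) - B x *m d)
    <= rho / 2 * k ^+ 2 * enorm u ^+ 2.
  have := grad_taylor Cf (zs x) d Hf; rewrite -zd => /le_trans; apply.
  by rewrite -[leRHS]mulrA ler_wpM2l // divr_ge0.
have T2 : enorm (B x *m (d - P x u)) <= L * c1 * enorm u ^+ 2.
  by rewrite (le_trans (lipschitz_grad_hess Cf _ _ Lf)) // -mulrA ler_wpM2l.
have T3 : enorm ((A (x + u) - A x - 'D_d (hess g) (zs x)) *m col_mx 0 (p x))
    <= nu / 2 * k ^+ 2 * (C / mu) * enorm u ^+ 2.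
  have := hess_taylor dHg Tg (zs x) d (col_mx 0 (p x)).
  rewrite -zd => /le_trans; apply; rewrite [leRHS]mulrAC.
  rewrite ler_pM ?mulr_ge0 ?divr_ge0 ?exprn_ge0 //.
  by rewrite -[leRHS]mulrA ler_wpM2l // divr_ge0.
have T4 : enorm ('D_(d - P x u) (hess g) (zs x) *m col_mx 0 (p x))
    <= rho * c1 * (C / mu) * enorm u ^+ 2.
  have := derive_hess_le dHg Hg (zs x) (d - P x u) (col_mx 0 (p x)).
  move/le_trans; apply; rewrite [leRHS]mulrAC ler_pM ?mulr_ge0 //.
  by rewrite -mulrA ler_wpM2l.
have T5 : enorm ((A (x + u) - A x) *m col_mx 0 (p' - p x))
    <= rho * k * (kp * k) * enorm u ^+ 2.
  have := hess_lipschitz_enorm (zs x) d (col_mx 0 (p' - p x)) Hg.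
  rewrite -zd => /le_trans; apply; rewrite enorm_col0.
  have -> : rho * k * (kp * k) * enorm u ^+ 2 = rho * (k * enorm u) * (kp * (k * enorm u)).
    by ring.
  by rewrite ler_pM ?mulr_ge0 ?multiplier_lip // ler_wpM2l.
rewrite !mulrDl; apply: (le_trans (enormD _ _)); apply: lerD T5.
apply: (le_trans (enormD _ _)); apply: lerD T4.
apply: (le_trans (enormD _ _)); apply: lerD T3.
by apply: (le_trans (enormD _ _)); apply: lerD.
Qed.

Lemma is_derive_grad_hyper x u w :
  is_derive x u (fun x' => dot w (grad (hyperobj f g) x')) (dot w (hyper_hess x u)).
Proof.
apply: (is_derive_quad (c := enorm w * (c3 * enorm u ^+ 2))) => t _.
rewrite !grad_hyper -dotBr -dotZr -dotBr (le_trans (norm_dot _ _)) // -mulrA ler_wpM2l //.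
have -> : t *: hyper_hess x u = hyper_hess x (t *: u).
  have hyper0 : hyper_hess x 0 = 0.
    by have := hyper_hess_linear x (-1) 0 0; rewrite !scaleN1r oppr0 addr0 addNr.
  by rewrite -[t *: u]addr0 hyper_hess_linear hyper0 addr0.
rewrite (le_trans (hyper_grad_expansion _ _)) //.
rewrite enormZ exprMn real_normK ?num_real //.
by rewrite le_eqVlt; apply/orP; left; apply/eqP; ring.
Qed.

Lemma hess_hyper x u : hess (hyperobj f g) x *m u = hyper_hess x u.
Proof.
apply: hess_is_derive_lin => [v w|a v w]; first exact: is_derive_grad_hyper.
exact: hyper_hess_linear.
Qed.

End Hyper.

(** * The penalized problem *)

Section HestMx.
Variables (R : realType) (dx dy : nat) (lam : R) (F G W : 'M[R]_(dx + dy)).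
Hypothesis sF : F^T = F.
Hypothesis sG : G^T = G.
Hypothesis sW : W^T = W.

(** Symmetry identifies the transposed xy-blocks in the estimator with the yx-blocks of the Schur
    complements. *)
Lemma Hest_schur :
  ulsubmx F + lam *: (ulsubmx G - ulsubmx W)
  - (ursubmx F + lam *: ursubmx G) *m invmx (drsubmx F + lam *: drsubmx G)
    *m (ursubmx F + lam *: ursubmx G)^T
  + lam *: (ursubmx W *m invmx (drsubmx W) *m (ursubmx W)^T)
  = schur (F + lam *: G) - lam *: schur W.
Proof.
have -> : (ursubmx F + lam *: ursubmx G)^T = dlsubmx (F + lam *: G).
  by rewrite -[in RHS]sF -[in RHS]sG; apply/matrixP => i j; rewrite !mxE.
have -> : (ursubmx W)^T = dlsubmx W by rewrite trmx_ursub sW.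
rewrite /schur.
have -> : ulsubmx (F + lam *: G) = ulsubmx F + lam *: ulsubmx G.
  by apply/matrixP => i j; rewrite !mxE.
have -> : ursubmx (F + lam *: G) = ursubmx F + lam *: ursubmx G.
  by apply/matrixP => i j; rewrite !mxE.
have -> : drsubmx (F + lam *: G) = drsubmx F + lam *: drsubmx G.
  by apply/matrixP => i j; rewrite !mxE.
rewrite !scalerBr; move: (ulsubmx F) (lam *: ulsubmx G) (lam *: ulsubmx W).
move: (_ *m dlsubmx (F + lam *: G)) (lam *: (_ *m dlsubmx W)) => a b c d e.
by rewrite opprB addrA [c + d - e - a]addrAC -!addrA [- e + b]addrC.
Qed.

End HestMx.

Section Penalty.
Variables (R : realType) (dx dy : nat) (f g : 'cV[R]_(dx + dy) -> R).
Variables (mu C L rho nu lam : R).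
Hypothesis mu0 : 0 < mu.
Hypothesis C0 : 0 <= C.
Hypothesis L0 : 0 <= L.
Hypothesis rho0 : 0 <= rho.
Hypothesis nu0 : 0 <= nu.
Hypothesis Cf : C2_smooth f.
Hypothesis Cg : C2_smooth g.
Hypothesis sc : forall x, grad_strongly_convex mu (fun y => g (col_mx x y)).
Hypothesis Lf : lipschitz_grad L f.
Hypothesis Lg : lipschitz_grad L g.
Hypothesis Hf : lipschitz_hess rho f.
Hypothesis Hg : lipschitz_hess rho g.
Hypothesis lam0 : 0 < lam.
Hypothesis lamL : 2 * L <= lam * mu.

Definition penalized z := f z + lam * g z.
Local Notation G := penalized.

Lemma penalizedP :
  [/\ C2_smooth G, (forall z, grad G z = grad f z + lam *: grad g z) &
      (forall z, hess G z = hess f z + lam *: hess g z)].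
Proof. exact: C2_comb. Qed.

Lemma penalized_C2 : C2_smooth G. Proof. by have [] := penalizedP. Qed.
Lemma grad_penalized z : grad G z = grad f z + lam *: grad g z.
Proof. by have [] := penalizedP. Qed.
Lemma hess_penalized z : hess G z = hess f z + lam *: hess g z.
Proof. by have [] := penalizedP. Qed.

Lemma penalized_lip_grad : lipschitz_grad ((1 + lam) * L) G.
Proof.
move=> z z'; rewrite !grad_penalized opprD addrACA -scalerBr.
rewrite (le_trans (enormD _ _)) // mulrDl mul1r mulrDl lerD ?Lf //.
by rewrite enormZ gtr0_norm // -mulrA ler_wpM2l ?(ltW lam0) ?Lg.
Qed.

Lemma penalized_lip_hess : lipschitz_hess ((1 + lam) * rho) G.
Proof.
move=> z z'; apply: spnorm_le => [|v]; first by rewrite !mulr_ge0 // addr_ge0 ?(ltW lam0).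
rewrite !hess_penalized opprD addrACA -scalerBr mulmxDl -scalemxAl.
rewrite (le_trans (enormD _ _)) // mulrDl mul1r mulrDl mulrDl lerD //.
  by rewrite (le_trans (spnormP _ _)) // ler_wpM2r ?Hf.
rewrite enormZ gtr0_norm // -!mulrA ler_wpM2l ?(ltW lam0) //.
by rewrite (le_trans (spnormP _ _)) // mulrA ler_wpM2r // Hg.
Qed.

(** The curvature of [f] is at least [- L], and [lam * mu - L >= lam * mu / 2] by [lamL]. *)
Lemma penalized_sc x : grad_strongly_convex (lam * mu / 2) (fun y => G (col_mx x y)).
Proof.
move=> y y'; rewrite (grad_partial _ penalized_C2) grad_penalized.
have := sc x y y'; rewrite (grad_partial _ Cg) => A1.
have := descent_lemma_ge y (y' - y) (C2_partial x Cf).1 (lipschitz_grad_partial x Cf Lf).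
rewrite (grad_partial _ Cf) [y + _]addrC subrK /penalized => A2.
have A3 := ler_wpM2l (ltW lam0) A1.
have A4 : 0 <= (lam * mu - 2 * L) * enorm (y' - y) ^+ 2.
  by rewrite mulr_ge0 ?exprn_ge0 // subr_ge0.
rewrite dsubmxD dotDl.
have -> : dsubmx (lam *: grad g (col_mx x y)) = lam *: dsubmx (grad g (col_mx x y)).
  exact: linearZ.
rewrite dotZl; move: A2 A3 A4.
move: (enorm _ ^+ 2) (dot _ _) (dot _ _) (f _) (f _) (g _) (g _) => *.
by lra.
Qed.

Lemma penaltyE x : penalty f g lam x =
  (fun y => G (col_mx x y) + - (lam * g (zstar g x))).
Proof. by apply/funext => y; rewrite /penalty /penalized mulrBr addrA. Qed.

Lemma grad_penalty x y : grad (penalty f g lam x) y = grad (fun y => G (col_mx x y)) y.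
Proof. by rewrite penaltyE grad_addr. Qed.

Lemma ylamE x : ylam f g lam x = ystar G x.
Proof. by rewrite /ylam penaltyE argmin_addr. Qed.

Lemma penalty_optE : penalty_opt f g lam =
  (fun x => G (zstar G x) + (- lam) * g (zstar g x)).
Proof. by apply/funext => x; rewrite /penalty_opt penaltyE ylamE mulNr. Qed.

Let muG := lam * mu / 2.
Let muG0 : 0 < muG. Proof. by rewrite divr_gt0 // mulr_gt0. Qed.
Let lam1 : 0 <= 1 + lam. Proof. by rewrite addr_ge0 // ltW. Qed.
Let LG0 : 0 <= (1 + lam) * L. Proof. by rewrite mulr_ge0. Qed.
Let rhoG0 : 0 <= (1 + lam) * rho. Proof. by rewrite mulr_ge0. Qed.

Lemma penalty_optP : let F := penalty_opt f g lam in
  [/\ C2_smooth F,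
      (forall x, grad F x =
         usubmx (grad G (zstar G x)) - lam *: usubmx (grad g (zstar g x))) &
      (forall x, hess F x =
         schur (hess G (zstar G x)) - lam *: schur (hess g (zstar g x)))].
Proof.
have V1 := C2_value muG0 penalized_C2 penalized_sc penalized_lip_grad
  penalized_lip_hess LG0 rhoG0.
have V2 := C2_value mu0 Cg sc Lg Hg L0 rho0.
have [W1 W2 W3] := C2_comb (- lam) V1 V2.
rewrite /= penalty_optE; split; first exact: W1.
  move=> x; rewrite W2 scaleNr; congr (_ - _ *: _).
    exact: (grad_value muG0 penalized_C2 penalized_sc penalized_lip_grad LG0).
  exact: (grad_value mu0 Cg sc Lg L0).
move=> x; rewrite W3 scaleNr; congr (_ - _ *: _).
  exact: (hess_value muG0 penalized_C2 penalized_sc penalized_lip_grad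
    penalized_lip_hess LG0 rhoG0).
exact: (hess_value mu0 Cg sc Lg Hg L0 rho0).
Qed.

Lemma C2_penalty_opt : C2_smooth (penalty_opt f g lam).
Proof. by have [] := penalty_optP. Qed.

Lemma grad_penalty_opt x :
  grad (penalty_opt f g lam) x = gest f g lam x (ylam f g lam x) (ystar g x).
Proof.
have [_ -> _] := penalty_optP; rewrite /gest /gradx ylamE grad_penalized.
have -> : forall u v : 'cV[R]_(dx + dy), usubmx (u + lam *: v) = usubmx u + lam *: usubmx v.
  by move=> u v; rewrite addrC linearP addrC.
by rewrite scalerBr addrA.
Qed.

Lemma hess_f_sym z : (hess f z)^T = hess f z.
Proof. exact: hess_sym Cf Hf. Qed.
Lemma hess_g_sym z : (hess g z)^T = hess g z.
Proof. exact: hess_sym Cg Hg. Qed.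

Lemma HestE x y w : Hest f g lam x y w =
  schur (hess G (col_mx x y)) - lam *: schur (hess g (col_mx x w)).
Proof.
rewrite hess_penalized; apply: Hest_schur; first exact: hess_f_sym.
  exact: hess_g_sym.
exact: hess_g_sym.
Qed.

Lemma hess_penalty_opt x :
  hess (penalty_opt f g lam) x = Hest f g lam x (ylam f g lam x) (ystar g x).
Proof. by have [_ _ ->] := penalty_optP; rewrite HestE ylamE. Qed.

End Penalty.

Record regular (R : realType) (dx dy : nat) (f g : 'cV[R]_(dx + dy) -> R)
    (mu C L rho nu : R) : Prop := {
  reg_mu : 0 < mu;
  reg_C : 0 <= C;
  reg_L : 0 <= L;
  reg_rho : 0 <= rho;
  reg_nu : 0 <= nu;
  reg_Cf : C2_smooth f;
  reg_Cg : C2_smooth g;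
  reg_sc : forall x, grad_strongly_convex mu (fun y => g (col_mx x y));
  reg_Lf : lipschitz_grad L f;
  reg_Lg : lipschitz_grad L g;
  reg_Hf : lipschitz_hess rho f;
  reg_Hg : lipschitz_hess rho g;
  reg_dHg : forall z, differentiable (hess g) z;
  reg_Tg : lipschitz_third nu g;
  reg_fC : lipschitz_fun C f }.

Lemma sub_scaled (R : pzRingType) (V : lmodType R) (k : R) (a b a' b' : V) :
  a - k *: b - (a' - k *: b') = (a - a') - k *: (b - b').
Proof. by rewrite scalerBr !opprB addrACA [RHS]addrACA [- (k *: b) - a']addrC. Qed.

Lemma trmx_sub_scaled (R : comPzRingType) n (k : R) (A B : 'M[R]_n) :
  A^T = A -> B^T = B -> (A - k *: B)^T = A - k *: B.
Proof. by move=> sA sB; rewrite linearB linearZ /= sA sB. Qed.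

Lemma derive_hess_sub (R : realType) n (h : 'cV[R]_n -> R) z k u v :
  (forall z', differentiable (hess h) z') ->
  'D_(k *: u - v) (hess h) z = k *: 'D_u (hess h) z - 'D_v (hess h) z.
Proof. by move=> dH; rewrite !deriveE // linearB linearZ. Qed.

Lemma quad_decomp (R : realType) n k (w : 'cV[R]_n) (H B G A D D' : 'M[R]_n) :
  dot w (H *m w + k *: (G *m w)) - k * dot w (A *m w) - dot w (B *m w + D' *m w)
  = dot w ((H - B) *m w) + k * dot w ((G - A - D) *m w) + dot w ((k *: D - D') *m w).
Proof.
by rewrite !(mulmxBl, mulmxDl, mulNmx) -!scalemxAl !(dotBr, dotDr, dotZr, dotNr); ring.
Qed.

(** * Estimator errors and comparison with the hyperobjective *)

Section Errors.
Variables (R : realType) (dx dy : nat) (f g : 'cV[R]_(dx + dy) -> R).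
Variables (mu C L rho nu lam : R).
Hypothesis reg : regular f g mu C L rho nu.
Hypothesis lam0 : 0 < lam.
Hypothesis lamL : 2 * L <= lam * mu.

Let mu0 := reg_mu reg.
Let C0 := reg_C reg.
Let L0 := reg_L reg.
Let rho0 := reg_rho reg.
Let nu0 := reg_nu reg.
Let Cf := reg_Cf reg.
Let Cg := reg_Cg reg.
Let sc := reg_sc reg.
Let Lf := reg_Lf reg.
Let Lg := reg_Lg reg.
Let Hf := reg_Hf reg.
Let Hg := reg_Hg reg.
Let dHg := reg_dHg reg.
Let Tg := reg_Tg reg.
Let fC := reg_fC reg.

Local Notation G := (penalized f g lam).
Local Notation F := (penalty_opt f g lam).
Local Notation phi := (hyperobj f g).
Local Notation yl := (ylam f g lam).
Local Notation y0 := (ystar g).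

Let CG : C2_smooth G. Proof. exact: penalized_C2. Qed.
Let scG x : grad_strongly_convex (lam * mu / 2) (fun y => G (col_mx x y)).
Proof. exact: (penalized_sc Cf Cg sc Lf lam0 lamL). Qed.
Let LG : lipschitz_grad ((1 + lam) * L) G.
Proof. exact: penalized_lip_grad. Qed.
Let HG : lipschitz_hess ((1 + lam) * rho) G.
Proof. exact: penalized_lip_hess. Qed.
Let muG0 : 0 < lam * mu / 2. Proof. by rewrite divr_gt0 // mulr_gt0. Qed.
Let LG0 : 0 <= (1 + lam) * L. Proof. by rewrite mulr_ge0 // addr_ge0 // ltW. Qed.
Let rhoG0 : 0 <= (1 + lam) * rho. Proof. by rewrite mulr_ge0 // addr_ge0 // ltW. Qed.

Lemma penalty_opt_C2 : C2_smooth F.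
Proof. exact: (C2_penalty_opt mu0 L0 rho0 Cf Cg sc Lf Lg Hf Hg lam0 lamL). Qed.

Lemma penalty_opt_grad x : grad F x = gest f g lam x (yl x) (y0 x).
Proof. exact: (grad_penalty_opt mu0 L0 rho0 Cf Cg sc Lf Lg Hf Hg lam0 lamL). Qed.

Lemma penalty_opt_hess x : hess F x = Hest f g lam x (yl x) (y0 x).
Proof. exact: (hess_penalty_opt mu0 L0 rho0 Cf Cg sc Lf Lg Hf Hg lam0 lamL). Qed.

Lemma col_mxB_r (x : 'cV[R]_dx) (y y' : 'cV[R]_dy) : col_mx x y - col_mx x y' = col_mx 0 (y - y').
Proof. by rewrite opp_col_mx add_col_mx subrr. Qed.

Lemma gest_error x y w :
  enorm (gest f g lam x y w - grad F x) <=
  (1 + lam) * L * enorm (y - yl x) + lam * L * enorm (w - y0 x).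
Proof.
have E y' w' : gest f g lam x y' w' =
    usubmx (grad G (col_mx x y')) - lam *: usubmx (grad g (col_mx x w')).
  rewrite /gest /gradx (grad_penalized lam Cf Cg).
  have -> : forall u v : 'cV[R]_(dx + dy), usubmx (u + lam *: v) = usubmx u + lam *: usubmx v.
    by move=> u v; rewrite addrC linearP addrC.
  by rewrite scalerBr addrA.
rewrite penalty_opt_grad !E.
rewrite sub_scaled (le_trans (enormB _ _)) // enormZ gtr0_norm // -mulrA lerD //.
  rewrite -usubmxB (le_trans (enorm_usubmx _)) // (le_trans (LG _ _)) //.
  by rewrite col_mxB_r enorm_col0 mulrA.
rewrite -mulrA ler_wpM2l ?(ltW lam0) // -usubmxB (le_trans (enorm_usubmx _)) //.
by rewrite (le_trans (Lg _ _)) // col_mxB_r enorm_col0.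
Qed.

(** By [dot_schurB] the difference is the change of the Hessian tested between two lifts, each
    costing a factor [1 + l / m]. *)
Lemma schur_lipschitz (h : 'cV[R]_(dx + dy) -> R) m l r x y y' u :
  0 < m -> 0 <= l -> 0 <= r -> C2_smooth h ->
  (forall x, grad_strongly_convex m (fun y => h (col_mx x y))) ->
  lipschitz_grad l h -> lipschitz_hess r h ->
  enorm ((schur (hess h (col_mx x y)) - schur (hess h (col_mx x y'))) *m u)
  <= r * (1 + l / m) ^+ 2 * enorm (y - y') * enorm u.
Proof.
move=> m0 l0 r0 Ch sch Lh Hh; have k0 : 0 <= 1 + l / m by rewrite addr_ge0 ?divr_ge0 // ltW.
apply: enorm_le_dot => [|w]; first by rewrite !mulr_ge0 ?exprn_ge0.
rewrite (dot_schurB m0 m0 (hessyy_coercive Ch sch x y') (hessyy_coercive Ch sch x y)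
  (hess_sym (col_mx x y) Ch Hh)).
rewrite (le_trans (cauchy_schwarz _ _)) //.
have lb (z : 'cV[R]_dy) v :
    enorm (schur_lift (hess h (col_mx x z)) v) <= (1 + l / m) * enorm v.
  apply: (schur_lift_le m0 (hessyy_coercive Ch sch x z)) => v'.
  exact: (lipschitz_grad_hess Ch _ _ Lh).
have := hess_lipschitz_enorm (col_mx x y') (col_mx x y - col_mx x y')
  (schur_lift (hess h (col_mx x y')) u) Hh.
rewrite [col_mx x y' + _]addrC subrK col_mxB_r enorm_col0 => A1.
have A2 := ler_pM (enorm_ge0 _) (enorm_ge0 _) (lb y w) A1.
apply: (le_trans A2).
have A3 := ler_wpM2l (mulr_ge0 r0 (enorm_ge0 (y - y'))) (lb y' u).
apply: (le_trans (ler_wpM2l (mulr_ge0 k0 (enorm_ge0 w)) A3)).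
by rewrite le_eqVlt; apply/orP; left; apply/eqP; ring.
Qed.

Lemma Hest_error x y w u :
  enorm ((Hest f g lam x y w - hess F x) *m u) <=
  ((1 + lam) * rho * (1 + (1 + lam) * L / (lam * mu / 2)) ^+ 2 * enorm (y - yl x)
   + lam * (rho * (1 + L / mu) ^+ 2 * enorm (w - y0 x))) * enorm u.
Proof.
rewrite penalty_opt_hess !(HestE lam Cf Cg Hf Hg).
rewrite sub_scaled mulmxBl (le_trans (enormB _ _)) // -scalemxAl enormZ gtr0_norm //.
rewrite mulrDl lerD //; first exact: schur_lipschitz.
by rewrite -mulrA ler_wpM2l ?(ltW lam0) // schur_lipschitz.
Qed.

Lemma Hest_sym x y w : (Hest f g lam x y w)^T = Hest f g lam x y w.
Proof.
rewrite (HestE lam Cf Cg Hf Hg).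
have S1 := schur_sym muG0 (hessyy_coercive CG scG x y) (hess_sym (col_mx x y) CG HG).
have S2 := schur_sym mu0 (hessyy_coercive Cg sc x w) (hess_sym (col_mx x w) Cg Hg).
exact: (trmx_sub_scaled lam S1 S2).
Qed.

Lemma penalized_stationary x :
  dsubmx (grad f (col_mx x (yl x))) + lam *: dsubmx (grad g (col_mx x (yl x))) = 0.
Proof.
have := grad_ystar muG0 CG scG LG x.
rewrite /zstar (ylamE _ _ lam) (grad_penalized lam Cf Cg) dsubmxD => <-.
by congr (_ + _); rewrite linearZ.
Qed.

(** Stationarity of the penalty gives [lam] times the y-gradient of [g] the norm of the y-gradient
    of [f], which is at most [C]; strong convexity of [g] turns this into a distance. *)
Lemma ylam_dist x : lam * mu * enorm (yl x - y0 x) <= C.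
Proof.
have := dist_ystar mu0 Cg sc Lg x (yl x); rewrite -(ler_pM2l lam0) mulrA.
move=> /le_trans; apply.
have -> : lam * enorm (dsubmx (grad g (col_mx x (yl x)))) =
    enorm (dsubmx (grad f (col_mx x (yl x)))).
  rewrite -[X in X * _ = _](gtr0_norm lam0) -enormZ -[RHS]enormN; congr enorm.
  by apply/eqP; rewrite -addr_eq0 addrC penalized_stationary.
rewrite (le_trans (enorm_dsubmx _)) //.
exact: (lipschitz_fun_grad Cf.1 _ C0 fC).
Qed.

Let z0 x := col_mx x (y0 x).
Let zl x := col_mx x (yl x).
Let A x := hess g (z0 x).
Let B x := hess f (z0 x).
Let d x := col_mx (0 : 'cV[R]_dx) (yl x - y0 x).
Let delta x := enorm (yl x - y0 x).
Local Notation p := (multiplier f g).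

Let zlE x : zl x = z0 x + d x.
Proof. by rewrite /zl /z0 /d add_col_mx addr0 addrC subrK. Qed.
Let dE x : enorm (d x) = delta x. Proof. exact: enorm_col0. Qed.

(** Inserting [y0 x] into the penalty gives the lower inequality. For the upper one the nonnegative
    penalty term is dropped and [f] is Lipschitz. *)
Lemma value_compare x : F x <= phi x <= F x + C * delta x.
Proof.
have E : F x = f (zl x) + lam * (g (zl x) - g (z0 x)) by [].
apply/andP; split.
  rewrite E; have := ystar_min muG0 CG scG LG x (y0 x).
  by rewrite /zstar -(ylamE f g lam x) /penalized /hyperobj -/(z0 x) -/(zl x); lra.
have := ystar_min mu0 Cg sc Lg x (yl x); rewrite /zstar -/(z0 x) -/(zl x) => A1.
have A2 : 0 <= lam * (g (zl x) - g (z0 x)) by rewrite mulr_ge0 ?subr_ge0 // ltW.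
have := fC (z0 x) (zl x).
rewrite col_mxB_r enorm_col0 enormBC -/(delta x) E /hyperobj -/(z0 x) ler_norml.
by move: A2; move: (lam * _) (f _) (f _) (C * _) => *; lra.
Qed.

(** Both gradients are values of the same [lift_adj g x]: for the penalty this holds because [Z] has
    zero y-block. *)
Lemma grad_compare x :
  enorm (grad F x - grad phi x) <=
  (1 + L / mu) * (L * delta x + lam * (rho / 2 * delta x ^+ 2)).
Proof.
pose Z := grad f (zl x) + lam *: (grad g (zl x) - grad g (z0 x)).
pose Y := grad f (zl x) - grad f (z0 x)
         + lam *: (grad g (zl x) - grad g (z0 x) - A x *m d x).
have ZE : gest f g lam x (yl x) (y0 x) = lift_adj g x Z.
  rewrite /lift_adj /Z dsubmxD.
  have -> : dsubmx (lam *: (grad g (zl x) - grad g (z0 x))) =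
      lam *: dsubmx (grad g (zl x)).
    have gz : dsubmx (grad g (z0 x)) = 0 by exact: (grad_ystar mu0 Cg sc Lg x).
    by rewrite scalerBr dsubmxB linearZ [X in _ - X]linearZ /= gz scaler0 subr0.
  rewrite penalized_stationary mulmx0 addr0 /gest /gradx -usubmxB.
  by rewrite addrC -linearP addrC.
have -> : grad F x - grad phi x = lift_adj g x Y.
  rewrite (grad_hyper mu0 C0 L0 rho0 Cf Cg sc Lf Lg Hg fC) /hyper_grad penalty_opt_grad ZE.
  (* Subtracting this null term turns the increment of [grad g] into a Taylor remainder, so the
     factor [lam] meets [delta ^+ 2] and not [delta]. *)
  have AE : lift_adj g x (A x *m col_mx 0 (lam *: (yl x - y0 x))) = 0.
    exact: (lift_adj_A0 mu0 Cg sc Hg).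
  rewrite -lift_adjB -[LHS]subr0 -AE -lift_adjB; congr (lift_adj g x _).
  have -> : col_mx 0 (lam *: (yl x - y0 x)) = lam *: d x.
    by rewrite /d scale_col_mx scaler0.
  rewrite -scalemxAr /Z /Y [in RHS]scalerBr addrA; congr (_ - _).
  by rewrite addrAC.
apply: (le_trans (lift_adj_le mu0 L0 Cg sc Lg x Y)).
rewrite ler_wpM2l ?addr_ge0 ?divr_ge0 ?(ltW mu0) // (le_trans (enormD _ _)) // lerD //.
  by rewrite (le_trans (Lf _ _)) // col_mxB_r enorm_col0.
rewrite enormZ gtr0_norm // ler_wpM2l ?(ltW lam0) //.
by have := grad_taylor Cg (z0 x) (d x) Hg; rewrite -zlE dE.
Qed.

(** The penalty's stationarity condition, linearized at [y0 x], is the multiplier equation with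
    unknown [lam *: (yl x - y0 x)], up to Taylor remainders. *)
Lemma multiplier_approx x :
  mu * enorm (lam *: (yl x - y0 x) - p x) <=
  L * delta x + lam * (rho / 2 * delta x ^+ 2).
Proof.
have cA := hessyy_coercive Cg sc x (y0 x).
apply: (le_trans (coercive_enorm cA _)).
have pE : drsubmx (A x) *m p x = - dsubmx (grad f (z0 x)).
  exact: (multiplier_eq f mu0 Cg sc x).
have dA : drsubmx (A x) *m (yl x - y0 x) = dsubmx (A x *m d x).
  by rewrite /d mul_col_mx_blocks col_mxKd mulmx0 add0r.
have gz : dsubmx (grad g (z0 x)) = 0 by exact: (grad_ystar mu0 Cg sc Lg x).
have st := penalized_stationary x; rewrite -/(zl x) in st.
have -> : drsubmx (hess g (col_mx x (y0 x))) *m (lam *: (yl x - y0 x) - p x) =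
  - (dsubmx (grad f (zl x) - grad f (z0 x))
     + lam *: dsubmx (grad g (zl x) - grad g (z0 x) - A x *m d x)).
  rewrite -[hess g (col_mx x (y0 x))]/(A x) mulmxBr -scalemxAr dA pE opprK.
  rewrite !dsubmxB gz subr0 scalerBr.
  have -> : dsubmx (grad f (zl x)) = - (lam *: dsubmx (grad g (zl x))).
    by apply/eqP; rewrite -addr_eq0 st.
  move: (lam *: dsubmx (A x *m d x)) (lam *: dsubmx (grad g (zl x))) (dsubmx (grad f (z0 x))) => a b c.
  by apply/colP => i; rewrite !mxE; ring.
rewrite enormN (le_trans (enormD _ _)) // enormZ gtr0_norm // lerD //.
  rewrite (le_trans (enorm_dsubmx _)) // (le_trans (Lf _ _)) //.
  by rewrite col_mxB_r enorm_col0.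
rewrite ler_wpM2l ?(ltW lam0) // (le_trans (enorm_dsubmx _)) //.
by have := grad_taylor Cg (z0 x) (d x) Hg; rewrite -zlE dE.
Qed.

(* Only a lower bound on [hess phi] is needed, so [hess F] is bounded above: its
   Schur complement is a minimum over lifts, hence the lift of [A x] can be used
   for both, and then [lam *: (yl x - y0 x)] is close to the multiplier [p x]. *)
Lemma hess_compare x u :
  dot u (hess F x *m u) <= dot u (hess phi x *m u) +
  (1 + L / mu) ^+ 2 * (rho * delta x + lam * (nu / 2 * delta x ^+ 2)
     + rho * ((L * delta x + lam * (rho / 2 * delta x ^+ 2)) / mu)) * enorm u ^+ 2.
Proof.
pose Pu := schur_lift (A x) u.
have cA := hessyy_coercive Cg sc x (y0 x).
(* Symmetry of the third derivative moves the multiplier into the direction of differentiation,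
   where it can be compared with [lam *: d x]. *)
have Ephi : dot u (hess phi x *m u) =
   dot Pu (B x *m Pu + 'D_(col_mx 0 (p x)) (hess g) (z0 x) *m Pu).
  rewrite (hess_hyper mu0 C0 L0 rho0 nu0 Cf Cg sc Lf Lg Hf Hg dHg Tg fC x u).
  rewrite /hyper_hess dotC lift_adjE dotC.
  by congr (dot _ (_ + _)); exact: (derive_hess_sym Cg dHg Tg).
have EF : dot u (hess F x *m u) =
    dot u (schur (hess G (zl x)) *m u) - lam * dot u (schur (A x) *m u).
  by rewrite penalty_opt_hess (HestE lam Cf Cg Hf Hg) mulmxBl -scalemxAl dotBr dotZr.
have S1 := @schur_le_quad _ _ _ (A x) _ _ muG0 (hessyy_coercive CG scG x (yl x))
  (hess_sym (col_mx x (yl x)) CG HG) u.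
rewrite (hess_penalized lam Cf Cg) in S1.
have S2 : dot u (schur (A x) *m u) = dot Pu (A x *m Pu).
  by rewrite (dot_schur mu0 cA).
rewrite [X in X <= _]EF [X in _ - lam * X]S2 [X in _ <= X + _]Ephi.
rewrite (hess_penalized lam Cf Cg).
apply: (le_trans (lerD S1 (lexx _))).
rewrite mulmxDl -scalemxAl -lerBlDl.
pose q := lam *: (yl x - y0 x) - p x.
have -> : dot Pu (hess f (zl x) *m Pu + lam *: (hess g (zl x) *m Pu))
    - lam * dot Pu (A x *m Pu)
    - dot Pu (B x *m Pu + 'D_(col_mx 0 (p x)) (hess g) (z0 x) *m Pu) =
  dot Pu ((hess f (zl x) - B x) *m Pu)
  + lam * dot Pu ((hess g (zl x) - A x - 'D_(d x) (hess g) (z0 x)) *m Pu)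
  + dot Pu ('D_(col_mx 0 q) (hess g) (z0 x) *m Pu).
  have -> : col_mx 0 q = lam *: d x - col_mx 0 (p x).
    by rewrite /d scale_col_mx opp_col_mx add_col_mx scaler0 subr0.
  rewrite (derive_hess_sub (z0 x) lam (d x) (col_mx 0 (p x)) dHg).
  exact: quad_decomp.
have Pk : enorm Pu ^+ 2 <= (1 + L / mu) ^+ 2 * enorm u ^+ 2.
  rewrite -exprMn ler_pXn2r ?nnegrE ?mulr_ge0 ?addr_ge0 ?divr_ge0 ?(ltW mu0) //.
  exact: (P_le mu0 Cg sc Lg).
set K := (X in _ * X * _); set k2 := (1 + L / mu) ^+ 2 in Pk *.
have K0 : 0 <= K.
  have dl0 : 0 <= delta x by exact: enorm_ge0.
  have t2 c : 0 <= c -> 0 <= lam * (c / 2 * delta x ^+ 2).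
    by move=> c0; rewrite !mulr_ge0 ?exprn_ge0 // ltW.
  rewrite /K addr_ge0 //; first by rewrite addr_ge0 ?t2 // mulr_ge0.
  by rewrite mulr_ge0 // divr_ge0 ?(ltW mu0) // addr_ge0 ?t2 // mulr_ge0.
have -> : k2 * K * enorm u ^+ 2 = K * (k2 * enorm u ^+ 2) by ring.
apply: (le_trans _ (ler_wpM2l K0 Pk)); rewrite /K !mulrDl expr2.
apply: lerD; first apply: lerD.
- rewrite (le_trans (cauchy_schwarz _ _)) // [leRHS]mulrCA ler_wpM2l //.
  have := hess_lipschitz_enorm (z0 x) (d x) Pu Hf; by rewrite -zlE dE.
- rewrite -[leRHS]mulrA ler_wpM2l ?(ltW lam0) // (le_trans (cauchy_schwarz _ _)) //.
  rewrite [leRHS]mulrCA ler_wpM2l //.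
  by have := hess_taylor dHg Tg (z0 x) (d x) Pu; rewrite -zlE dE.
rewrite (le_trans (cauchy_schwarz _ _)) // [leRHS]mulrCA ler_wpM2l //.
rewrite (le_trans (derive_hess_le dHg Hg _ _ _)) // ler_wpM2r // ler_wpM2l //.
by rewrite enorm_col0 -mulrDl ler_pdivlMr // mulrC multiplier_approx.
Qed.

End Errors.

(** * Lazy cubic Newton steps *)

Section Cubic.
Variables (R : realType) (n : nat) (M : R) (gv : 'cV[R]_n) (H : 'M[R]_n) (s : 'cV[R]_n).
Hypothesis M0 : 0 <= M.
Hypothesis sH : H^T = H.
Hypothesis smin : is_argmin (cubic_model M gv H) s.

Lemma cubic_modelE u :
  cubic_model M gv H u = dot gv u + 2^-1 * dot u (H *m u) + M / 6 * enorm u ^+ 3.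
Proof. by rewrite /cubic_model -mulmxA !dotE. Qed.

Lemma cubic_model_le0 : dot gv s + 2^-1 * dot s (H *m s) <= - (M / 6 * enorm s ^+ 3).
Proof.
have := smin 0; rewrite !cubic_modelE dot0r dot0l enorm0 expr0n !mulr0 !addr0.
by lra.
Qed.

(** Bounding the shifted norm by the triangle inequality avoids differentiating the cubed norm, and
    covers the case [s = 0]. *)
Lemma cubic_model_shift v t : 0 <= t ->
  0 <= t * dot (gv + H *m s) v + 2^-1 * t ^+ 2 * dot v (H *m v)
       + M / 6 * ((enorm s + t * enorm v) ^+ 3 - enorm s ^+ 3).
Proof.
move=> t0; have := smin (s + t *: v); rewrite !cubic_modelE => le.
have n3 : enorm (s + t *: v) ^+ 3 <= (enorm s + t * enorm v) ^+ 3.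
  rewrite ler_pXn2r ?nnegrE ?addr_ge0 ?mulr_ge0 // (le_trans (enormD _ _)) //.
  by rewrite enormZ ger0_norm.
have := ler_wpM2l (divr_ge0 M0 (ler0n _ 6)) n3.
have sw : dot s (H *m v) = dot v (H *m s) by rewrite dot_mulmx sH dotC.
move: le; rewrite mulmxDr -scalemxAr !(dotDr, dotDl, dotZr, dotZl) sw [dot (H *m s) v]dotC.
by lra.
Qed.

Lemma cubic_first_order : enorm (gv + H *m s) <= M / 2 * enorm s ^+ 2.
Proof.
apply: enorm_le_dot => [|v]; first by rewrite mulr_ge0 ?exprn_ge0 ?divr_ge0.
have key u : dot (gv + H *m s) (- u) <= M / 2 * enorm s ^+ 2 * enorm (- u).
  rewrite -subr_le0; pose k := 2^-1 * `|dot u (H *m u)|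
    + M / 6 * (3 * enorm s * enorm u ^+ 2 + enorm u ^+ 3).
  apply: (le0_small (k := k)) => t /andP[t0 t1].
  have := cubic_model_shift u (ltW t0); rewrite enormN dotNr /k.
  have := ler_norm (dot u (H *m u)).
  have := enorm_ge0 s; have := enorm_ge0 u.
  move: (dot _ u) (dot u _) (enorm s) (enorm u) => a b c d d0 c0 lb le.
  rewrite -(ler_pM2l t0).
  have A1 : t ^+ 2 * b <= t ^+ 2 * `|b| by rewrite ler_wpM2l // exprn_ge0 // ltW.
  have A2 : 0 <= M * d ^+ 3 * (t ^+ 2 * (1 - t)).
    by rewrite !mulr_ge0 ?exprn_ge0 ?subr_ge0 // ltW.
  by lra.
have := key (- v); rewrite opprK => kv.
by rewrite dotC; lra.
Qed.

(** Adding the shifts along [v] and [- v] cancels the linear term. The length [t] makes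
    [t * enorm v] slightly larger than [enorm s], where the cubic increment is at most
    [8 (t |v|)^3]; the excess [e] keeps [t] positive and then tends to 0. *)
Lemma cubic_second_order v : - (8 / 3 * M * enorm s * enorm v ^+ 2) <= dot v (H *m v).
Proof.
have [v0|v0] := eqVneq (enorm v) 0.
  by rewrite v0 expr0n mulr0 (enorm0_eq0 v0) dot0l oppr0.
have vp : 0 < enorm v by rewrite lt_def v0 enorm_ge0.
pose d := enorm v.
suff key e : 0 < e -> 0 <= dot v (H *m v) + 8 / 3 * M * (enorm s + e * d) * d ^+ 2.
  rewrite -subr_ge0 opprK.
  rewrite -lerN2 oppr0; apply: (le0_small (k := 8 / 3 * M * d ^+ 3)) => t /andP[t0 _].
  by have := key t t0; rewrite -/d; lra.
move=> e0; pose t := enorm s / d + e.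
have t0 : 0 < t by rewrite ltr_wpDl // divr_ge0 // ltW.
have td : t * d = enorm s + e * d by rewrite mulrDl divfK.
have := cubic_model_shift v (ltW t0); have := cubic_model_shift (- v) (ltW t0).
rewrite !enormN mulmxN !(dotNr, dotNl) opprK -/d td.
have s0 := enorm_ge0 s; have ed : 0 <= e * d by rewrite mulr_ge0 // ltW.
have A1 : (enorm s + (enorm s + e * d)) ^+ 3 - enorm s ^+ 3 <= 8 * (t * d) ^+ 3.
  rewrite td; move: ed s0; move: (enorm s) (e * d) => a b b0 a0.
  have : 0 <= a ^+ 3 by rewrite exprn_ge0.
  have := mulr_ge0 (exprn_ge0 2 a0) b0; have := mulr_ge0 a0 (exprn_ge0 2 b0).
  have : 0 <= b ^+ 3 by rewrite exprn_ge0.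
  by lra.
have A2 := ler_wpM2l (divr_ge0 M0 (ler0n _ 6)) A1.
move=> B1 B2; rewrite -td -(pmulr_rge0 _ (exprn_gt0 2 t0)).
by move: A2 B1 B2; lra.
Qed.

End Cubic.

(** * Power means over windows of steps *)

Section PowerMean.
Variable R : realType.

(** The cube lies above its tangent at the mean [a]; summing the tangent inequalities gives the
    claim. *)
Lemma sum_cube_le (m : nat) (c : 'I_m -> R) : (forall i, 0 <= c i) ->
  (\sum_i c i) ^+ 3 <= m%:R ^+ 2 * \sum_i c i ^+ 3.
Proof.
case: m c => [|m] c c0; first by rewrite !big_ord0 expr0n mulr0.
have mp : 0 < (m.+1%:R : R) by [].
pose S := \sum_i c i; pose a := S / m.+1%:R.
have a0 : 0 <= a by rewrite divr_ge0 // sumr_ge0.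
have : \sum_i (3 * a ^+ 2 * c i - 2 * a ^+ 3) <= \sum_i c i ^+ 3.
  apply: ler_sum => i _; rewrite -subr_ge0.
  have -> : c i ^+ 3 - (3 * a ^+ 2 * c i - 2 * a ^+ 3) = (c i - a) ^+ 2 * (c i + 2 * a) by ring.
  by rewrite mulr_ge0 ?sqr_ge0 // addr_ge0 // mulr_ge0.
rewrite big_split /= sumrN sumr_const card_ord -mulr_sumr -/S => le.
have -> : S ^+ 3 = m.+1%:R ^+ 2 * (3 * a ^+ 2 * S - 2 * a ^+ 3 *+ m.+1).
  by rewrite /a -mulr_natr; field; rewrite nat1r pnatr_eq0.
by rewrite ler_wpM2l // exprn_ge0.
Qed.

Lemma sum_prefix_le (k N : nat) (a : nat -> R) : (forall j, 0 <= a j) ->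
  (k <= N)%N -> \sum_(j < k) a j <= \sum_(j < N) a j.
Proof.
move=> a0; elim: N => [|N IH]; first by rewrite leqn0 => /eqP ->.
rewrite leq_eqVlt => /predU1P[->//|]; rewrite ltnS => /IH le.
by rewrite big_ord_recr /= (le_trans le) // lerDl.
Qed.

(** After exchanging the sums, each of the [m] lags contributes a prefix sum of [a]. *)
Lemma sum_window_le (m N : nat) (a : nat -> R) : (forall j, 0 <= a j) ->
  \sum_(t < N) \sum_(i < m) (if (i < t)%N then a (t.-1 - i)%N else 0)
  <= m%:R * \sum_(j < N) a j.
Proof.
move=> a0; rewrite exchange_big /= mulr_natl -[X in _ *+ X]card_ord -sumr_const.
apply: ler_sum => i _.
have -> : \sum_(t < N) (if (i < t)%N then a (t.-1 - i)%N else 0) =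
    \sum_(j < N.-1 - i) a j.
  elim: N => [|N IH]; first by rewrite !big_ord0.
  rewrite big_ord_recr /= IH; case: ltnP => iN.
    have -> : (N - i = (N.-1 - i).+1)%N by lia.
    by rewrite big_ord_recr.
  have -> : (N - i = 0)%N by lia.
  have -> : (N.-1 - i = 0)%N by lia.
  by rewrite !big_ord0 addr0.
by apply: sum_prefix_le => //; lia.
Qed.

End PowerMean.

(** [gF], [qx] are the gradient and Hessian terms of [F], [gg], [qH] those of the model, [q0] the
    quadratic form of the true Hessian at the snapshot. Splitting mixed products by Young's
    inequality leaves exactly [w^3 / 600] and [e^3 / 576], and the [s^3] coefficient drops from
    [1 / 6] to just above [0.159]. *)
Lemma newton_arith (R : realFieldType)
    (M e rb s w D F1 F2 gF gg qx q0 qH ng nH : R) :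
  F2 <= F1 + gF + 2^-1 * qx + rb / 4 * s ^+ 3 ->
  gg + 2^-1 * qH <= - (M / 6 * s ^+ 3) ->
  gF - gg <= ng * s -> ng * s <= M * e ^+ 2 / 576 * s ->
  q0 - qH <= s * nH -> qx - q0 <= rb * D * s * s ->
  s * nH <= s * (M * e / 288 * s) ->
  rb * D * (s * s) <= M * w / 100 * (s * s) ->
  rb * s ^+ 3 <= M / 100 * s ^+ 3 ->
  M * (3 * (e ^+ 2 * s)) <= M * (2 * e ^+ 3 + s ^+ 3) ->
  M * (3 * (s ^+ 2 * e)) <= M * (2 * s ^+ 3 + e ^+ 3) ->
  M * (3 * (s ^+ 2 * w)) <= M * (2 * s ^+ 3 + w ^+ 3) ->
  0 <= M * s ^+ 3 ->
  F2 - F1 <= M * (- (159 / 1000) * s ^+ 3 + w ^+ 3 / 600 + e ^+ 3 / 576).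
Proof. by move=> *; lra. Qed.

(** With [s <= 2 e] the model gives [16 / 3], the snapshot drift [1], and the other two terms about
    [0.03]: in total below 7. *)
Lemma final_hess_arith (R : realFieldType) (M e rb s D v qy q0 qH nH d : R) :
  - (8 / 3 * M * s * v ^+ 2) <= qH -> qH - q0 <= v * nH ->
  v * nH <= v * (M * e / 288 * v) -> - (qy - q0) <= rb * d * v * v ->
  rb * d * v ^+ 2 <= rb * (s + D) * v ^+ 2 ->
  rb * D * v ^+ 2 <= M * e * v ^+ 2 ->
  s * (M * v ^+ 2) <= 2 * e * (M * v ^+ 2) ->
  rb * (s * v ^+ 2) <= M / 100 * (s * v ^+ 2) ->
  0 <= M * e * v ^+ 2 ->
  - (7 * (M * e)) * v ^+ 2 <= qy.
Proof. by move=> *; lra. Qed.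

Lemma final_grad_decomp (R : realType) n (a b g d : 'cV[R]_n) (K K0 H : 'M[R]_n) :
  a = (a - b - K *m d) - (g - b) + (g + H *m d) - (H - K0) *m d + (K - K0) *m d.
Proof.
rewrite !mulmxBl; move: (K *m d) (K0 *m d) (H *m d) => *.
by apply/colP => i; rewrite !mxE; ring.
Qed.

(** The cubic term and the drift term contribute 2 each, the remaining ones less than 1. *)
Lemma final_grad_arith (R : realFieldType) (M e rb s D : R) :
  rb * s ^+ 2 <= rb * (4 * e ^+ 2) -> rb * e ^+ 2 <= M / 100 * e ^+ 2 ->
  rb * D * s <= M * e * s -> M * e * s <= M * e * (2 * e) ->
  M * s ^+ 2 <= M * (4 * e ^+ 2) -> 0 <= M * e ^+ 2 ->
  rb / 2 * s ^+ 2 + M * e ^+ 2 / 576 + M / 2 * s ^+ 2 + M * e / 288 * s + rb * D * s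
  <= 5 * (M * e ^+ 2).
Proof. by move=> *; lra. Qed.

Section LazyCubicNewton.
Variables (R : realType) (n m N : nat) (F : 'cV[R]_n -> R) (M e rb : R).
(* [e] stands for [Num.sqrt (eps / M)]. *)
Variables (xs ss gs : nat -> 'cV[R]_n) (Hs : nat -> 'M[R]_n).
Hypothesis m0 : (0 < m)%N.
Hypothesis M0 : 0 < M.
Hypothesis e0 : 0 < e.
Hypothesis rb0 : 0 <= rb.
Hypothesis Mrb : 100 * m%:R * rb <= M.
Hypothesis CF : C2_smooth F.
Hypothesis HF : lipschitz_hess rb F.
Hypothesis gE : forall t, (t < N)%N -> enorm (gs t - grad F (xs t)) <= M * e ^+ 2 / 576.
Hypothesis HE : forall t, (t < N)%N -> forall u,
  enorm ((Hs t - hess F (xs t)) *m u) <= M * e / 288 * enorm u.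
Hypothesis sH : forall t, (Hs t)^T = Hs t.
Hypothesis smin : forall t, (t < N)%N ->
  is_argmin (cubic_model M (gs t) (Hs (snapshot m t))) (ss t).
Hypothesis xS : forall t, (t < N)%N -> xs t.+1 = xs t + ss t.

Let s t := enorm (ss t).
Let D t := enorm (xs (snapshot m t) - xs t).
Let w t := D t / m%:R.

Let s0 t : 0 <= s t. Proof. exact: enorm_ge0. Qed.
Let mp : 0 < (m%:R : R). Proof. by rewrite ltr0n. Qed.
Let w0 t : 0 <= w t. Proof. by rewrite divr_ge0 // enorm_ge0. Qed.
Let DE t : D t = m%:R * w t.
Proof. by rewrite /w mulrC divfK // gt_eqF. Qed.

Let rbD t : rb * D t <= M * w t / 100.
Proof. by rewrite DE; have := ler_wpM2r (w0 t) Mrb; lra. Qed.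

Let rbM : rb <= M / 100.
Proof.
have : 1 <= (m%:R : R) by rewrite ler1n.
by move=> /(ler_wpM2r rb0); move: Mrb; lra.
Qed.

Lemma snapshot_le t : (snapshot m t <= t)%N.
Proof. by rewrite /snapshot leq_trunc_div. Qed.

Lemma snapshot_lt t : (t < snapshot m t + m)%N.
Proof. by rewrite /snapshot {1}(divn_eq t m) ltn_add2l ltn_mod. Qed.

(** The window is given the full length [m] whatever the age of the snapshot, with zeros before time
    0: the uniform shape that [sum_window_le] sums. *)
Lemma drift_le t : (t <= N)%N ->
  D t <= \sum_(i < m) (if (i < t)%N then s (t.-1 - i)%N else 0).
Proof.
move=> tN.
have H k : (k <= t)%N -> enorm (xs (t - k)%N - xs t) <=
    \sum_(i < k) (if (i < t)%N then s (t.-1 - i)%N else 0).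
  elim: k => [|k IH] kt; first by rewrite big_ord0 subn0 subrr enorm0.
  rewrite big_ord_recr /= kt (le_trans (enorm_triangle _ (xs (t - k)%N) _)) //.
  rewrite addrC lerD ?IH ?(ltnW kt) //.
  have -> : (t - k = (t.-1 - k).+1)%N by lia.
  have -> : (t - k.+1 = t.-1 - k)%N by lia.
  rewrite xS; last by lia.
  by rewrite opprD addNKr enormN.
have E : snapshot m t = (t - (t - snapshot m t))%N.
  by rewrite subKn // snapshot_le.
rewrite /D {1}E (le_trans (H _ _)) ?leq_subr //.
apply: (sum_prefix_le (a := fun i => if (i < t)%N then s (t.-1 - i)%N else 0)).
  by move=> j; case: ifP.
by have := snapshot_lt t; lia.
Qed.

(** The power mean costs [m^2] and the overlap of windows [m], together the [m^3] by which the
    normalization [w = D / m] divides the cubed drift. *)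
Lemma drift_cube_sum N' : (N' <= N)%N ->
  \sum_(t < N') w t ^+ 3 <= \sum_(t < N') s t ^+ 3.
Proof.
move=> N'N; have := sum_window_le m N' (a := fun j => s j ^+ 3).
move=> /(_ (fun j => exprn_ge0 3 (s0 j))) W.
rewrite -(ler_pM2l mp); apply: le_trans W; rewrite mulr_sumr; apply: ler_sum => t _.
have tN : (t <= N)%N by have := ltn_ord t; lia.
pose c (i : 'I_m) := if (i < t)%N then s (t.-1 - i)%N else 0.
have c0 i : 0 <= c i by rewrite /c; case: ifP.
have := sum_cube_le c0.
have -> : \sum_(i < m) c i ^+ 3 =
    \sum_(i < m) (if (i < t)%N then s (t.-1 - i)%N ^+ 3 else 0).
  by apply: eq_bigr => i _; rewrite /c; case: ifP; rewrite ?expr0n.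
have D3 : D t ^+ 3 <= (\sum_(i < m) c i) ^+ 3.
  by rewrite ler_pXn2r ?nnegrE ?enorm_ge0 ?sumr_ge0 // drift_le.
move/(le_trans D3); rewrite DE exprMn => le.
rewrite -(ler_pM2l (exprn_gt0 2 mp)); apply: le_trans le.
by rewrite mulrA -exprSr.
Qed.

Lemma newton_step t : (t < N)%N ->
  F (xs t.+1) - F (xs t) <=
  M * (- (159 / 1000) * s t ^+ 3 + w t ^+ 3 / 600 + e ^+ 3 / 576).
Proof.
move=> tN; have t0N : (snapshot m t < N)%N := leq_ltn_trans (snapshot_le t) tN.
rewrite xS //; set x := xs t; set d := ss t; set H := Hs (snapshot m t).
have A1 := taylor3_le CF x d HF.
have A2 := cubic_model_le0 (smin tN); rewrite -/d -/H in A2.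
have := cauchy_schwarz (grad F x - gs t) d; rewrite dotBl => A3.
have := ler_wpM2r (s0 t) (gE tN); rewrite -/x enormBC -/(s t) => A4.
have := cauchy_schwarz d ((hess F (xs (snapshot m t)) - H) *m d) => A5.
have := HE t0N d; rewrite -/H -enormN -mulNmx opprB => A6.
have A7 := hess_lipschitz_dot (xs (snapshot m t)) (x - xs (snapshot m t)) d d HF.
rewrite [xs (snapshot m t) + _]addrC subrK enormBC -/(D t) in A7.
have A8 := le_trans (ler_norm _) A7.
have A9 := ler_wpM2l (s0 t) A6.
have B1 := ler_wpM2r (mulr_ge0 (s0 t) (s0 t)) (rbD t).
have B2 := ler_wpM2r (exprn_ge0 3 (s0 t)) rbM.
rewrite -/d -/(s t) in A1 A2 A3 A5 A8 A9 B1 B2.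
have A5' : dot d (hess F (xs (snapshot m t)) *m d) - dot d (H *m d)
    <= s t * enorm ((hess F (xs (snapshot m t)) - H) *m d).
  by rewrite -dotBr -mulmxBl.
rewrite mulmxBl dotBr in A8.
have Y (a b : R) : 0 <= a -> 0 <= b -> 3 * (a ^+ 2 * b) <= 2 * a ^+ 3 + b ^+ 3.
  move=> a0 b0; rewrite -subr_ge0.
  have -> : 2 * a ^+ 3 + b ^+ 3 - 3 * (a ^+ 2 * b) = (a - b) ^+ 2 * (2 * a + b) by ring.
  by rewrite mulr_ge0 ?sqr_ge0 // addr_ge0 // mulr_ge0.
have Y1 := ler_wpM2l (ltW M0) (Y e (s t) (ltW e0) (s0 t)).
have Y2 := ler_wpM2l (ltW M0) (Y (s t) e (s0 t) (ltW e0)).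
have Y3 := ler_wpM2l (ltW M0) (Y (s t) (w t) (s0 t) (w0 t)).
have Ms := mulr_ge0 (ltW M0) (exprn_ge0 3 (s0 t)).
exact: (newton_arith A1 A2 A3 A4 A5' A8 A9 B1 B2 Y1 Y2 Y3 Ms).
Qed.

Lemma newton_sum N' : (N' <= N)%N ->
  F (xs N') - F (xs 0%N) <=
  M * (- (157 / 1000) * \sum_(t < N') s t ^+ 3 + N'%:R * (e ^+ 3 / 576)).
Proof.
move=> N'N.
have H k : (k <= N)%N -> F (xs k) - F (xs 0%N) <=
    M * (- (159 / 1000) * \sum_(t < k) s t ^+ 3 + (\sum_(t < k) w t ^+ 3) / 600
         + k%:R * (e ^+ 3 / 576)).
  elim: k => [|k IH] kN; first by rewrite !big_ord0 subrr; lra.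
  rewrite !big_ord_recr /= -natr1.
  have := IH (ltnW kN); have := newton_step kN.
  by lra.
apply: (le_trans (H _ N'N)); rewrite ler_pM2l // lerD2r.
have := drift_cube_sum N'N.
have : 0 <= \sum_(t < N') s t ^+ 3 by apply: sumr_ge0 => t _; rewrite exprn_ge0.
by lra.
Qed.

(** As [sqrt 2 >= 1.4] and [rb <= M / 100], the tested quantity is at most [M (0.729 s + w / 100)],
    which leaves room for the factor [288 / 287]. *)
Lemma not_stopped t : ~ stop_test M rb (M * e ^+ 2) m xs ss t -> e <= s t + w t.
Proof.
move=> /negP; rewrite -ltNge -/(D t) -/(s t).
set X := (M + 2 * rb) / Num.sqrt 2 * s t + rb * D t => lt.
have r2 : 14 / 10 <= (Num.sqrt 2 : R).
  rewrite -(@ler_pXn2r _ 2) ?nnegrE ?sqrtr_ge0 ?divr_ge0 // sqr_sqrtr //; lra.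
have r20 : 0 < (Num.sqrt 2 : R) by apply: lt_le_trans r2; lra.
have X0 : 0 <= X.
  have D0 : 0 <= D t by exact: enorm_ge0.
  by rewrite addr_ge0 ?(mulr_ge0 rb0 D0) // mulr_ge0 // divr_ge0 ?(ltW r20) //
     addr_ge0 ?(ltW M0) // mulr_ge0.
have XM : X <= M * (729 / 1000 * s t + w t / 100).
  have q : (M + 2 * rb) / Num.sqrt 2 <= M * (729 / 1000).
    by rewrite ler_pdivrMr //; have := ler_wpM2l (ltW M0) r2; have := rbM; have := M0; lra.
  rewrite /X mulrDr lerD //; first by rewrite mulrA ler_wpM2r.
  by rewrite mulrA.
have : (M * e) ^+ 2 < (288 / 287 * X) ^+ 2.
  have := lt; rewrite -(ltr_pM2l M0).
  have -> : M * (M^-1 * (288 / 287) ^+ 2 * X ^+ 2) = (288 / 287 * X) ^+ 2.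
    by field; rewrite gt_eqF.
  by have -> : M * (M * e ^+ 2) = (M * e) ^+ 2 by ring.
have Me0 : 0 <= M * e by rewrite mulr_ge0 // ltW.
have X20 : 0 <= 288 / 287 * X := mulr_ge0 (divr_ge0 (ler0n _ _) (ler0n _ _)) X0.
rewrite ltr_pXn2r ?nnegrE ?Me0 ?X20 // => lt2.
rewrite -(ler_pM2l M0).
have := mulr_ge0 (ltW M0) (s0 t); have := mulr_ge0 (ltW M0) (w0 t).
by move: lt2 XM; lra.
Qed.

(** [(s + w)^3 <= 4 (s^3 + w^3)], and the cubed drifts sum to no more than the cubed steps, hence
    [8]. *)
Lemma fail_cube_sum N' : (N' <= N)%N ->
  (forall t, (t < N')%N -> ~ stop_test M rb (M * e ^+ 2) m xs ss t) ->
  N'%:R * e ^+ 3 <= 8 * \sum_(t < N') s t ^+ 3.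
Proof.
move=> N'N fl; have W := drift_cube_sum N'N.
apply: (@le_trans _ _ (\sum_(t < N') (4 * s t ^+ 3 + 4 * w t ^+ 3))); last first.
  by rewrite big_split /= -!mulr_sumr; lra.
rewrite mulr_natl -[X in _ *+ X]card_ord -sumr_const; apply: ler_sum => t _.
have le := not_stopped (fl t (ltn_ord t)).
have : e ^+ 3 <= (s t + w t) ^+ 3.
  by rewrite ler_pXn2r ?nnegrE ?addr_ge0 // ltW.
move/le_trans; apply; rewrite -subr_ge0.
have -> : 4 * s t ^+ 3 + 4 * w t ^+ 3 - (s t + w t) ^+ 3 =
    3 * ((s t - w t) ^+ 2 * (s t + w t)) by ring.
by rewrite mulr_ge0 // mulr_ge0 ?sqr_ge0 // addr_ge0.
Qed.

(** The error terms [e^3 / 576] are paid by the failed tests: [0.157 - 8 / 576] exceeds [0.14]. *)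
Lemma descent_budget N' : (N' <= N)%N ->
  (forall t, (t < N')%N -> ~ stop_test M rb (M * e ^+ 2) m xs ss t) ->
  14 / 100 * M * \sum_(t < N') s t ^+ 3 <= F (xs 0%N) - F (xs N').
Proof.
move=> N'N fl; have A1 := newton_sum N'N.
have := ler_wpM2l (ltW M0) (fail_cube_sum N'N fl).
have : 0 <= M * \sum_(t < N') s t ^+ 3.
  by rewrite mulr_ge0 ?(ltW M0) //; apply: sumr_ge0 => t _; rewrite exprn_ge0.
by move: A1; lra.
Qed.

Lemma stopped_small t : stop_test M rb (M * e ^+ 2) m xs ss t ->
  s t <= 2 * e /\ rb * D t <= M * e.
Proof.
rewrite /stop_test -/(D t) -/(s t).
set X := (M + 2 * rb) / Num.sqrt 2 * s t + rb * D t => le.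
have r2 : (Num.sqrt 2 : R) <= 2.
  rewrite -(@ler_pXn2r _ 2) ?nnegrE ?sqrtr_ge0 // sqr_sqrtr //; lra.
have r20 : 0 < (Num.sqrt 2 : R) by rewrite sqrtr_gt0.
have D0 : 0 <= D t by exact: enorm_ge0.
have X1 : M / 2 * s t <= (M + 2 * rb) / Num.sqrt 2 * s t.
  rewrite ler_wpM2r // ler_pM ?invr_ge0 ?(ltW M0) //; first by rewrite lerDl mulr_ge0.
  by rewrite lef_pV2 ?posrE.
have rbD0 : 0 <= rb * D t by rewrite mulr_ge0.
have Ms0 : 0 <= M / 2 * s t by rewrite mulr_ge0 // divr_ge0 // ltW.
have X0 : 0 <= X by rewrite addr_ge0 // (le_trans Ms0).
have : (288 / 287 * X) ^+ 2 <= (M * e) ^+ 2.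
  have := le; rewrite -(ler_pM2l M0).
  have -> : M * (M^-1 * (288 / 287) ^+ 2 * X ^+ 2) = (288 / 287 * X) ^+ 2.
    by field; rewrite gt_eqF.
  by have -> : M * (M * e ^+ 2) = (M * e) ^+ 2 by ring.
have Me0 : 0 <= M * e by rewrite mulr_ge0 // ltW.
have X20 : 0 <= 288 / 287 * X := mulr_ge0 (divr_ge0 (ler0n _ _) (ler0n _ _)) X0.
rewrite ler_pXn2r ?nnegrE ?Me0 ?X20 // => le2.
have XM : X <= M * e by lra.
split; last by move: XM; rewrite /X; lra.
by rewrite -(ler_pM2l M0); move: XM X1; rewrite /X; lra.
Qed.

Lemma newton_final_grad t : (t < N)%N ->
  stop_test M rb (M * e ^+ 2) m xs ss t -> enorm (grad F (xs t.+1)) <= 5 * (M * e ^+ 2).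
Proof.
move=> tN /stopped_small[se De].
have t0N : (snapshot m t < N)%N := leq_ltn_trans (snapshot_le t) tN.
rewrite xS //; set x := xs t; set d := ss t; set H := Hs (snapshot m t).
set x0 := xs (snapshot m t).
have -> : grad F (x + d) = (grad F (x + d) - grad F x - hess F x *m d)
    - (gs t - grad F x) + (gs t + H *m d) - (H - hess F x0) *m d
    + (hess F x - hess F x0) *m d.
  exact: final_grad_decomp.
have A1 := grad_taylor CF x d HF.
have A2 := gE tN.
have A3 := cubic_first_order (ltW M0) (sH _) (smin tN).
have A4 := HE t0N d.
have := hess_lipschitz_enorm x0 (x - x0) d HF; rewrite [x0 + _]addrC subrK => A5.
rewrite [enorm (x - x0)]enormBC -/(D t) -/d -/H -/(s t) in A1 A3 A4 A5.
have B1 : s t ^+ 2 <= 4 * e ^+ 2.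
  have -> : 4 * e ^+ 2 = (2 * e) ^+ 2 by ring.
  by rewrite ler_pXn2r ?nnegrE ?mulr_ge0 // ltW.
have B2 := ler_wpM2l rb0 B1.
have B3 := ler_wpM2r (exprn_ge0 2 (ltW e0)) rbM.
have B4 := ler_wpM2r (s0 t) De.
have B5 := ler_wpM2l (mulr_ge0 (ltW M0) (ltW e0)) se.
have B6 := ler_wpM2l (ltW M0) B1.
have Me : 0 <= M * e ^+ 2 by rewrite mulr_ge0 ?exprn_ge0 // ltW.
apply: (le_trans (enormD _ _)); apply: (le_trans (lerD (enormB _ _) (lexx _))).
apply: (le_trans (lerD (lerD (enormD _ _) (lexx _)) (lexx _))).
apply: (le_trans (lerD (lerD (lerD (enormB _ _) (lexx _)) (lexx _)) (lexx _))).
apply: (le_trans (lerD (lerD (lerD (lerD A1 A2) A3) A4) A5)).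
exact: (final_grad_arith B2 B3 B4 B5 B6 Me).
Qed.

Lemma newton_final_hess t v : (t < N)%N ->
  stop_test M rb (M * e ^+ 2) m xs ss t ->
  - (7 * (M * e)) * enorm v ^+ 2 <= dot v (hess F (xs t.+1) *m v).
Proof.
move=> tN /stopped_small[se De].
have t0N : (snapshot m t < N)%N := leq_ltn_trans (snapshot_le t) tN.
set y := xs t.+1; set x := xs t; set H := Hs (snapshot m t).
set x0 := xs (snapshot m t).
have A1 := cubic_second_order (ltW M0) (sH _) (smin tN) v.
have A2 := cauchy_schwarz v ((H - hess F x0) *m v).
have A3 := ler_wpM2l (enorm_ge0 v) (HE t0N v).
have := hess_lipschitz_dot x0 (y - x0) v v HF; rewrite [x0 + _]addrC subrK => A4.
have A5 : enorm (y - x0) <= s t + D t.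
  rewrite (le_trans (enorm_triangle _ x _)) // lerD //; last by rewrite enormBC.
  by rewrite /y xS // [_ + ss t]addrC addrK.
have v2 : 0 <= enorm v ^+ 2 by rewrite exprn_ge0.
have B0 := ler_wpM2l rb0 A5.
have B1 := ler_wpM2r v2 B0.
have B2 := ler_wpM2r v2 De.
have B3 := ler_wpM2r (mulr_ge0 (ltW M0) v2) se.
have B4 := ler_wpM2r (mulr_ge0 (s0 t) v2) rbM.
have Me : 0 <= M * e * enorm v ^+ 2 by rewrite !mulr_ge0 // ltW.
have A6 : - dot v ((hess F y - hess F x0) *m v) <= rb * enorm (y - x0) * enorm v * enorm v.
  by move: A4; rewrite ler_norml lerNl => /andP[].
rewrite -/H -/(s t) in A1 A2 A3.
have A2' : dot v (H *m v) - dot v (hess F x0 *m v) <= enorm v * enorm ((H - hess F x0) *m v).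
  by rewrite -dotBr -mulmxBl.
rewrite mulmxBl dotBr in A6.
exact: (final_hess_arith A1 A2' A3 A6 B1 B2 B3 B4 Me).
Qed.

End LazyCubicNewton.

(** * Inner loops *)

Section Standing.
Variables (R : realType) (dx dy : nat) (f g : 'cV[R]_(dx + dy) -> R).
Variables (mu C ell rho nu : R).
Hypothesis dx0 : (0 < dx)%N.
Hypothesis dy0 : (0 < dy)%N.
Hypothesis sa : standing_assumption f g mu C ell rho nu.

Let Cf : C2_smooth f. Proof. exact/twice_differentiable_C2/(sa_f_diff sa). Qed.
Let Cg : C2_smooth g. Proof. by apply: twice_differentiable_C2; have [] := sa_g_diff sa. Qed.

Lemma standing_grad_sc x : grad_strongly_convex mu (fun y => g (col_mx x y)).
Proof.
by move=> y y'; apply: (strongly_convex_grad (C2_partial x Cg).1); exact: (sa_g_sc sa).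
Qed.

Lemma standing_mu_le : mu <= ell.
Proof.
have sc := standing_grad_sc 0.
exact: (strong_convexity_le_smoothness sc
  (lipschitz_grad_partial 0 Cg (sa_g_grad sa)) dy0).
Qed.

(** The signs of [C] and [nu] follow by evaluating the Lipschitz bounds on a unit vector, available
    since [dx] is positive. *)
Lemma standing_regular : regular f g mu C ell rho nu.
Proof.
have n0 : (0 < dx + dy)%N by rewrite addn_gt0 dx0.
pose u : 'cV[R]_(dx + dy) := delta_mx (Ordinal n0) 0.
have u1 : enorm u = 1.
  by apply/eqP; rewrite -(@eqrXn2 _ 2) // enorm_sqr dot_delta mxE !eqxx expr1n.
have [dg dH] := sa_g_diff sa.
split => //; try by case: sa.
- have := sa_f_lip sa u 0; rewrite subr0 u1 mulr1; exact: le_trans.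
- by rewrite (le_trans _ standing_mu_le) // ltW // (sa_mu sa).
- exact/ltW/(sa_rho sa).
- by have := third_ge0 dH (sa_g_third sa) 0 u; rewrite u1 mulr1.
exact: standing_grad_sc.
Qed.

End Standing.

Section InnerLoop.
Variables (R : realType) (dx dy : nat) (f g : 'cV[R]_(dx + dy) -> R).
Variables (mu C L rho nu lam kappa : R).
Hypothesis reg : regular f g mu C L rho nu.
Hypothesis muL : mu <= L.
Hypothesis kappaL : L / mu <= kappa.
Hypothesis lam2 : 2 <= lam.
Hypothesis lamL : 2 * L <= lam * mu.

Let mu0 := reg_mu reg.
Let L0 : 0 < L. Proof. exact: lt_le_trans muL. Qed.
Let lam0 : 0 < lam. Proof. by apply: lt_le_trans lam2. Qed.
Let kappa1 : 1 <= kappa.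
Proof. by apply: le_trans kappaL; rewrite ler_pdivlMr // mul1r. Qed.
Let Cf := reg_Cf reg.
Let Cg := reg_Cg reg.
Local Notation G := (penalized f g lam).
Let CG : C2_smooth G. Proof. exact: penalized_C2. Qed.
Let LG : lipschitz_grad ((1 + lam) * L) G.
Proof. by apply: penalized_lip_grad => //; [exact: (reg_Lf reg)|exact: (reg_Lg reg)]. Qed.
Let scG x : grad_strongly_convex (lam * mu / 2) (fun y => G (col_mx x y)).
Proof. exact: (penalized_sc Cf Cg (reg_sc reg) (reg_Lf reg) lam0 lamL). Qed.
Let muG0 : 0 < lam * mu / 2. Proof. by rewrite divr_gt0 // mulr_gt0. Qed.

(** The momentum is tuned to an upper bound of the condition number, so the convexity modulus is
    lowered to match it. *)
Lemma grad_strongly_convex_le n (h : 'cV[R]_n -> R) a b : a <= b ->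
  grad_strongly_convex b h -> grad_strongly_convex a h.
Proof.
move=> ab sb z z'; apply: le_trans (sb z z'); rewrite lerD2l ler_wpM2r ?exprn_ge0 //.
by rewrite ler_wpM2r.
Qed.

Lemma agd_lower x z e D k2 : kappa <= k2 -> 0 < e -> enorm (z - ystar g x) <= D ->
  enorm (agd (fun y => g (col_mx x y)) z
    (natceil (2 * Num.sqrt k2 * ln (Num.sqrt (k2 + 1) / e * D))) L^-1 (momentum kappa)
    - ystar g x) <= e.
Proof.
move=> kk e0 zD.
have sc : grad_strongly_convex (L / kappa) (fun y => g (col_mx x y)).
  apply: grad_strongly_convex_le (reg_sc reg x).
  rewrite ler_pdivrMr; last by apply: lt_le_trans kappa1.
  by move: kappaL; rewrite ler_pdivrMr // mulrC.
exact: (agd_converges (C2_partial x Cg).1 kappa1 L0 sc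
  (lipschitz_grad_partial x Cg (reg_Lg reg)) kk e0 zD).
Qed.

(** The condition number is at most [3 kappa]: since [lam >= 2], [1 + lam <= 3 / 2 * lam], so [(1 +
    lam) * L / (3 * kappa) <= lam * mu / 2]. *)
Lemma agd_penalty x z e D : 0 < e -> enorm (z - ylam f g lam x) <= D ->
  enorm (agd (penalty f g lam x) z
    (natceil (2 * Num.sqrt (3 * kappa) * ln (Num.sqrt (3 * kappa + 1) / e * D)))
    ((1 + lam) * L)^-1 (momentum (3 * kappa))
    - ylam f g lam x) <= e.
Proof.
move=> e0 zD.
have k3 : 1 <= 3 * kappa by move: kappa1; lra.
have L1 : 0 < (1 + lam) * L by rewrite mulr_gt0 // addr_gt0.
pose c := - (lam * g (zstar g x)).
have pE : penalty f g lam x = (fun y => G (col_mx x y) + c) by exact: penaltyE.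
have gE y : grad (penalty f g lam x) y = grad (fun y => G (col_mx x y)) y.
  exact: grad_penalty.
have dh y u : is_derive y u (penalty f g lam x) (dot (grad (penalty f g lam x) y) u).
  rewrite gE pE.
  have -> : (fun y => G (col_mx x y) + c) = (fun y => G (col_mx x y)) + cst c by [].
  have D1 := (C2_partial x CG).1 y u.
  have := is_deriveD D1 (is_derive_cst c y u); rewrite addr0.
  by [].
have Lh : lipschitz_grad ((1 + lam) * L) (penalty f g lam x).
  by move=> y y'; rewrite !gE; exact: (lipschitz_grad_partial x CG LG).
have sc : grad_strongly_convex ((1 + lam) * L / (3 * kappa)) (penalty f g lam x).
  apply: (@grad_strongly_convex_le _ _ _ (lam * mu / 2)).
    rewrite ler_pdivrMr; last by apply: lt_le_trans k3.
    have := kappaL; rewrite ler_pdivrMr // => A1.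
    have A2 := ler_wpM2l (ltW lam0) A1.
    have A3 : 0 <= (lam - 2) * L by rewrite mulr_ge0 ?subr_ge0 // ltW.
    by move: A2 A3; lra.
  move=> y y'; rewrite gE pE; have := scG x y y'.
  by rewrite [_ + c + _]addrAC [_ + c + _]addrAC lerD2r.
exact: (agd_converges dh k3 L1 sc Lh (lexx _) e0 zD).
Qed.

Lemma ylam_lipschitz x x' :
  enorm (ylam f g lam x' - ylam f g lam x) <= 4 * kappa * enorm (x' - x).
Proof.
rewrite !(ylamE f g lam); apply: (le_trans (ystar_lipschitz muG0 CG scG LG x x')).
rewrite ler_wpM2r // ler_pdivrMr //.
have := kappaL; rewrite ler_pdivrMr // => A1.
have A2 := ler_wpM2l (ltW lam0) A1.
have A3 : 0 <= (lam - 2) * L by rewrite mulr_ge0 ?subr_ge0 // ltW.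
by have := mulr_gt0 lam0 L0; move: A2 A3; lra.
Qed.

Lemma ystar_lipschitz_kappa x x' :
  enorm (ystar g x' - ystar g x) <= 4 * kappa * enorm (x' - x).
Proof.
apply: (le_trans (ystar_lipschitz mu0 Cg (reg_sc reg) (reg_Lg reg) x x')).
by rewrite ler_wpM2r // (le_trans kappaL) //; move: kappa1; lra.
Qed.

Variables (M rb eps e Rad : R) (m T N : nat) (x0 : 'cV[R]_dx).
Variables (xs ss : nat -> 'cV[R]_dx) (ys ws : nat -> 'cV[R]_dy).
Hypothesis e0 : 0 < e.
Hypothesis Rg : enorm (ystar g x0) <= Rad.
Hypothesis Rl : enorm (ylam f g lam x0) <= Rad.
Let K := inner_steps kappa (3 * kappa) e Rad ss.
Hypothesis run : lfsba_run f g lam M rb eps m T kappa L (3 * kappa) ((1 + lam) * L) K K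
  x0 xs ys ws ss N.

(** Warm start: the previous error is at most [e] and the new solution lies within [4 kappa |s_t|]
    of the old one, which is the distance fed to the next count. *)
Lemma inner_accuracy t : (t < N)%N ->
  enorm (ws t - ystar g (xs t)) <= e /\ enorm (ys t - ylam f g lam (xs t)) <= e.
Proof.
have kk : kappa <= 3 * kappa by move: kappa1; lra.
elim: t => [|t IH] tN.
  rewrite (run_w run tN) (run_y run tN) (run_init run) /K /inner_steps /=.
  by split; [apply: agd_lower|apply: agd_penalty]; rewrite // sub0r enormN.
have [Hw Hy] := IH (ltnW tN).
have xE : xs t.+1 - xs t = ss t by rewrite (run_x run (ltnW tN)) addrC addKr.
rewrite (run_w run tN) (run_y run tN) /K /inner_steps /=.
split; [apply: agd_lower => //|apply: agd_penalty => //].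
  rewrite (le_trans (enorm_triangle _ (ystar g (xs t)) _)) // lerD // enormBC.
  by rewrite -xE; exact: ystar_lipschitz_kappa.
rewrite (le_trans (enorm_triangle _ (ylam f g lam (xs t)) _)) // lerD // enormBC.
by rewrite -xE; exact: ylam_lipschitz.
Qed.

End InnerLoop.

(** * Constants and complexity *)

Section Constants.
Variables (R : realType) (mu C ell rho nu lb kappa lam M eps : R).
Hypothesis mu0 : 0 < mu.
Hypothesis muell : mu <= ell.
Hypothesis elllb : ell <= lb.
Hypothesis C0 : 0 <= C.
Hypothesis Clb : C <= lb.
Hypothesis rho0 : 0 < rho.
Hypothesis rholb : rho <= lb.
Hypothesis nu0 : 0 <= nu.
Hypothesis nulb : nu <= lb.
Hypothesis kappaE : kappa = lb / mu.
Hypothesis lam2 : 2 <= lam.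
Hypothesis M0 : 0 < M.
Hypothesis eps0 : 0 < eps.

Let ell0 : 0 < ell. Proof. exact: lt_le_trans muell. Qed.
Let lb0 : 0 < lb. Proof. exact: lt_le_trans elllb. Qed.
Let lam0 : 0 < lam. Proof. by apply: lt_le_trans lam2. Qed.
Let kappaM : kappa * mu = lb. Proof. by rewrite kappaE divfK // gt_eqF. Qed.
Let kappa1 : 1 <= kappa.
Proof. by rewrite kappaE ler_pdivlMr // mul1r (le_trans muell). Qed.
Let kappa0 : 0 < kappa. Proof. exact: lt_le_trans kappa1. Qed.
Let ratio_le : ell / mu <= kappa.
Proof. by rewrite kappaE ler_pM2r // invr_gt0. Qed.
Let ratio0 : 0 < ell / mu. Proof. exact: divr_gt0. Qed.

(** Identifies [C2] with the constant of [schur_lipschitz] for the penalized function: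
    [1 + 4 y + 4 y^2] is a square. *)
Lemma C2_factor :
  C2 mu ell rho lam = (1 + lam) * rho * (1 + (1 + lam) * ell / (lam * mu / 2)) ^+ 2.
Proof. by rewrite /C2; field; rewrite !gt_eqF. Qed.

Lemma C2_gt0 : 0 < C2 mu ell rho lam.
Proof.
have l1 : 0 < 1 + lam by exact: addr_gt0.
rewrite C2_factor; apply: mulr_gt0; first exact: mulr_gt0.
apply/exprn_gt0/addr_gt0 => //; apply: divr_gt0; first exact: mulr_gt0.
by apply: divr_gt0 => //; exact: mulr_gt0.
Qed.

(** The lower-level error enters with a coefficient no larger than [C2]; hence the factor 2 in the
    tolerance. *)
Lemma C1_le_C2 : lam * (rho * (1 + ell / mu) ^+ 2) <= C2 mu ell rho lam.
Proof.
have p0 : 0 <= 1 + ell / mu by rewrite addr_ge0 // ltW.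
rewrite C2_factor mulrA; apply: ler_pM.
- by rewrite mulr_ge0 // ltW.
- exact: exprn_ge0.
- by rewrite ler_pM2r // lerDr.
have h : ell / mu <= (1 + lam) * ell / (lam * mu / 2).
  rewrite ler_pdivrMr // mulrAC ler_pdivlMr ?divr_gt0 ?mulr_gt0 //.
  have := mulr_gt0 ell0 mu0 => em.
  have := mulr_gt0 lam0 em; lra.
by rewrite ler_pXn2r ?nnegrE ?lerD2l // (le_trans p0) // lerD2l.
Qed.

Let e := Num.sqrt (eps / M).

Lemma step_scale_gt0 : 0 < e. Proof. by rewrite sqrtr_gt0 divr_gt0. Qed.

Lemma step_scale_sqr : M * e ^+ 2 = eps.
Proof. by rewrite sqr_sqrtr ?divr_ge0 ?ltW // mulrC divfK // gt_eqF. Qed.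

Lemma step_scale_mul : M * e = Num.sqrt (M * eps).
Proof.
have -> : M * eps = (M * e) ^+ 2 by rewrite -step_scale_sqr; ring.
by rewrite sqrtr_sqr ger0_norm // mulr_ge0 ?ltW // step_scale_gt0.
Qed.

Let epst := eps_inner mu ell rho lam M eps.

Lemma eps_inner_gt0 : 0 < epst.
Proof.
have inv n : (0 < n)%N -> 0 < (n%:R : R)^-1 by move=> n0; rewrite invr_gt0 ltr0n.
rewrite lt_min; apply/andP; split; apply: divr_gt0.
- by apply: mulr_gt0 eps0; exact: inv.
- by rewrite !mulr_gt0.
- by apply: mulr_gt0; [exact: inv|rewrite sqrtr_gt0 mulr_gt0].
by apply: mulr_gt0; [exact: ltr0n|exact: C2_gt0].
Qed.

Lemma eps_inner_grad a b : 0 <= a <= epst -> 0 <= b <= epst ->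
  (1 + lam) * ell * a + lam * ell * b <= M * e ^+ 2 / 576.
Proof.
move=> /andP[a0 ae] /andP[b0 be]; rewrite step_scale_sqr.
have le : epst <= 576^-1 * eps / (4 * lam * ell) by rewrite ge_min lexx.
move: le; rewrite ler_pdivlMr ?mulr_gt0 // => le.
have A1 := ler_wpM2l (mulr_ge0 (addr_ge0 ler01 (ltW lam0)) (ltW ell0)) ae.
have A2 := ler_wpM2l (mulr_ge0 (ltW lam0) (ltW ell0)) be.
have A3 : 0 <= (lam - 2) * (ell * epst).
  by rewrite mulr_ge0 ?subr_ge0 // mulr_ge0 ?ltW // eps_inner_gt0.
have A4 : 0 <= lam * (ell * epst).
  by rewrite mulr_ge0 ?(ltW lam0) // mulr_ge0 ?ltW // eps_inner_gt0.
by move: A1 A2 A3 A4 le; lra.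
Qed.

Lemma eps_inner_hess a b : 0 <= a <= epst -> 0 <= b <= epst ->
  (1 + lam) * rho * (1 + (1 + lam) * ell / (lam * mu / 2)) ^+ 2 * a
  + lam * (rho * (1 + ell / mu) ^+ 2 * b) <= M * e / 288.
Proof.
move=> /andP[a0 ae] /andP[b0 be]; rewrite step_scale_mul -C2_factor.
have le : epst <= 288^-1 * Num.sqrt (M * eps) / (2 * C2 mu ell rho lam).
  by rewrite ge_min lexx orbT.
move: le; rewrite ler_pdivlMr ?mulr_gt0 ?C2_gt0 // => le.
have A1 := ler_wpM2l (ltW C2_gt0) ae.
have A2 := ler_wpM2r b0 C1_le_C2.
have A3 := ler_wpM2l (ltW C2_gt0) be.
by move: A1 A2 A3 le; lra.
Qed.

Section Delta.
Variable delta : R.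
Hypothesis delta0 : 0 <= delta.
Hypothesis deltaC : lam * mu * delta <= C.

Let t := lam^-1.
Let lt1 : lam * t = 1. Proof. by rewrite mulfV // gt_eqF. Qed.
Let t0 : 0 < t. Proof. by rewrite invr_gt0. Qed.

Lemma delta_le : delta <= kappa * t.
Proof.
rewrite ler_pdivlMr // -(ler_pM2l mu0) [mu * kappa]mulrC kappaM.
by apply: le_trans Clb; move: deltaC; rewrite mulrAC mulrC mulrA [delta * _]mulrC; lra.
Qed.

Lemma value_gap Delta : 0 < Delta -> lb * kappa ^+ 2 / Delta <= lam -> C * delta <= Delta.
Proof.
move=> D0; rewrite ler_pdivrMr // => le.
have A1 : C * delta <= lb * (kappa * t) by rewrite ler_pM // delta_le.
apply: (le_trans A1); rewrite mulrA ler_pdivrMr // [leRHS]mulrC.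
apply: le_trans le; rewrite ler_wpM2l ?(ltW lb0) // expr2 ler_peMr // ltW //.
Qed.

Let quad_le c : 0 <= c -> c <= lb -> lam * (c / 2 * delta ^+ 2) <= lb / 2 * kappa ^+ 2 * t.
Proof.
move=> c0 clb.
have d2 : delta ^+ 2 <= (kappa * t) ^+ 2.
  by rewrite ler_pXn2r ?nnegrE ?delta_le // mulr_ge0 // ltW.
have A1 : c / 2 * delta ^+ 2 <= lb / 2 * (kappa * t) ^+ 2.
  by rewrite ler_pM ?exprn_ge0 ?divr_ge0 // ler_wpM2r.
apply: (le_trans (ler_wpM2l (ltW lam0) A1)).
have -> : lam * (lb / 2 * (kappa * t) ^+ 2) = lb / 2 * kappa ^+ 2 * t * (lam * t) by ring.
by rewrite lt1 mulr1.
Qed.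

Let lin_le c : 0 <= c -> c <= lb -> c * delta <= lb * kappa ^+ 2 * t.
Proof.
move=> c0 clb; have A1 : c * delta <= lb * (kappa * t) by rewrite ler_pM // delta_le.
apply: (le_trans A1); rewrite mulrA ler_wpM2r ?(ltW t0) // ler_wpM2l ?(ltW lb0) //.
by rewrite expr2 ler_peMr // ltW.
Qed.

Let p0 : 0 <= 1 + ell / mu. Proof. by rewrite addr_ge0 // ltW. Qed.

Let quad_ge0 c : 0 <= c -> 0 <= lam * (c / 2 * delta ^+ 2).
Proof.
move=> c0; apply: mulr_ge0; first exact: ltW.
by apply: mulr_ge0; [exact: divr_ge0|exact: exprn_ge0].
Qed.

(** The second entry of [lambda_choice] is used. One power of [kappa] comes from the lift and two
    from [lam * delta ^+ 2], as [delta <= kappa / lam]. *)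
Lemma grad_gap : lb * kappa ^+ 3 / eps <= lam ->
  (1 + ell / mu) * (ell * delta + lam * (rho / 2 * delta ^+ 2)) <= 3 * eps.
Proof.
rewrite ler_pdivrMr // => le.
have A1 := lin_le (ltW ell0) elllb; have A2 := quad_le (ltW rho0) rholb.
have A3 : (1 + ell / mu) * (ell * delta + lam * (rho / 2 * delta ^+ 2)) <=
    2 * kappa * (lb * kappa ^+ 2 * t + lb / 2 * kappa ^+ 2 * t).
  apply: ler_pM => //; last exact: lerD.
    by apply: addr_ge0; [rewrite mulr_ge0 // ltW|apply: quad_ge0; exact: ltW].
  by have := ratio_le; have := kappa1; lra.
apply: (le_trans A3).
have A4 : lb * kappa ^+ 3 * t <= eps by rewrite ler_pdivrMr // [leRHS]mulrC.
by move: A4; lra.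
Qed.

(** The third entry of [lambda_choice] is used. Two powers of [kappa] come from the lifts, one from
    the multiplier error through [rho / mu], two from [lam * delta ^+ 2]. *)
Lemma hess_gap : lb * kappa ^+ 5 / Num.sqrt (M * eps) <= lam ->
  (1 + ell / mu) ^+ 2 * (rho * delta + lam * (nu / 2 * delta ^+ 2)
     + rho * ((ell * delta + lam * (rho / 2 * delta ^+ 2)) / mu)) <= 12 * (M * e).
Proof.
rewrite step_scale_mul; set q := Num.sqrt (M * eps).
have q0 : 0 < q by rewrite sqrtr_gt0 mulr_gt0.
rewrite ler_pdivrMr // => le.
have A1 := lin_le (ltW ell0) elllb; have A2 := quad_le (ltW rho0) rholb.
have A3 := lin_le (ltW rho0) rholb; have A4 := quad_le nu0 nulb.
pose X := lb * kappa ^+ 2 * t; have X0 : 0 <= X by rewrite !mulr_ge0 ?exprn_ge0 // ltW.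
have A5 : rho * ((ell * delta + lam * (rho / 2 * delta ^+ 2)) / mu) <= kappa * (3 / 2 * X).
  have -> : rho * ((ell * delta + lam * (rho / 2 * delta ^+ 2)) / mu) =
    rho / mu * (ell * delta + lam * (rho / 2 * delta ^+ 2)) by ring.
  apply: ler_pM.
  - by rewrite divr_ge0 // ltW.
  - by apply: addr_ge0; [rewrite mulr_ge0 // ltW|apply: quad_ge0; exact: ltW].
  - by rewrite kappaE ler_pM2r // invr_gt0.
  by rewrite /X; move: A1 A2; lra.
have A6 : (1 + ell / mu) ^+ 2 <= (2 * kappa) ^+ 2.
  have k20 : 0 <= 2 * kappa by rewrite mulr_ge0 // ltW.
  rewrite ler_pXn2r ?nnegrE //.
  by have := ratio_le; have := kappa1; lra.
have A7 : X <= kappa * X by rewrite ler_peMl.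
have A8 : lb * kappa ^+ 5 * t <= q by rewrite ler_pdivrMr // [leRHS]mulrC.
have A9 : (1 + ell / mu) ^+ 2 * (rho * delta + lam * (nu / 2 * delta ^+ 2)
     + rho * ((ell * delta + lam * (rho / 2 * delta ^+ 2)) / mu)) <=
   (2 * kappa) ^+ 2 * (3 * (kappa * X)).
  apply: ler_pM => //; first exact: exprn_ge0.
    apply: addr_ge0; first by apply: addr_ge0; [rewrite mulr_ge0 // ltW|exact: quad_ge0].
    apply: mulr_ge0; first exact: ltW.
    apply: divr_ge0; last exact: ltW.
    by apply: addr_ge0; [rewrite mulr_ge0 // ltW|apply: quad_ge0; exact: ltW].
  by move: A3 A4 A5 A7; rewrite /X; lra.
by apply: (le_trans A9); move: A8; rewrite /X; lra.
Qed.

End Delta.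
End Constants.

(** * Polynomial size bounds for the logarithms *)

Section PolynomialGrowth.
Variables (R : realType) (Z : R).
Hypothesis Z2 : 2 <= Z.

(** Only a degree in [Z] is tracked. With [Z >= 2] a sum costs one extra degree and coefficients are
    absorbed. *)
Definition poly_le (k : nat) (q : R) : Prop := 0 <= q <= Z ^+ k.

Let Z1 : 1 <= Z. Proof. by apply: le_trans Z2; rewrite ler1n. Qed.
Let Z0 : 0 <= Z. Proof. exact: le_trans Z1. Qed.

Lemma poly_le_mono i j q : (i <= j)%N -> poly_le i q -> poly_le j q.
Proof. by move=> ij /andP[q0 qi]; rewrite /poly_le q0 (le_trans qi) // ler_weXn2l. Qed.

Lemma poly_le_trans k q q' : 0 <= q -> q <= q' -> poly_le k q' -> poly_le k q.
Proof. by move=> q0 qq /andP[_ qk]; rewrite /poly_le q0 (le_trans qq). Qed.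

Lemma poly_leM i j a b : poly_le i a -> poly_le j b -> poly_le (i + j) (a * b).
Proof.
by move=> /andP[a0 ai] /andP[b0 bj]; rewrite /poly_le mulr_ge0 //= exprD ler_pM.
Qed.

Lemma poly_leD i j a b : poly_le i a -> poly_le j b -> poly_le (maxn i j).+1 (a + b).
Proof.
move=> /(poly_le_mono (leq_maxl i j)) /andP[a0 ai].
move=> /(poly_le_mono (leq_maxr i j)) /andP[b0 bj].
rewrite /poly_le addr_ge0 //= exprS; apply: le_trans (ler_wpM2r (exprn_ge0 _ Z0) Z2).
by rewrite mulr_natl mulr2n lerD.
Qed.

Lemma poly_leX i a n : poly_le i a -> poly_le (i * n) (a ^+ n).
Proof.
move=> /andP[a0 ai]; rewrite /poly_le exprn_ge0 //= exprM.
by apply: lerXn2r; rewrite ?nnegrE // exprn_ge0.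
Qed.

Lemma poly_le_max i a b : poly_le i a -> poly_le i b -> poly_le i (Num.max a b).
Proof. by rewrite /poly_le; case: (leP a b). Qed.

End PolynomialGrowth.

Lemma natceil_le_max (R : realType) (r b : R) : r <= b -> 0 <= b ->
  (natceil r)%:R <= b + 1.
Proof.
move=> rb b0; have [r0|r0] := leP r 0; last first.
  by rewrite (le_trans (natceil_le (ltW r0))) // lerD2r.
have c0 : (Num.ceil r <= 0)%R by rewrite Num.Theory.ceil_le0.
by rewrite /natceil (max_idPl c0) /= addr_ge0.
Qed.

Section InnerCost.
Variables (R : realType) (mu ell rho lb kappa lam M eps Delta Rad mR CT : R).
Hypothesis mu0 : 0 < mu.
Hypothesis muell : mu <= ell.
Hypothesis elllb : ell <= lb.
Hypothesis rho0 : 0 < rho.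
Hypothesis rholb : rho <= lb.
Hypothesis kappaE : kappa = lb / mu.
Hypothesis lam2 : 2 <= lam.
Hypothesis M0 : 0 < M.
Hypothesis eps0 : 0 < eps.
Hypothesis Delta0 : 0 < Delta.
Hypothesis Rad0 : 0 <= Rad.
Hypothesis mR1 : 1 <= mR.
Hypothesis CT0 : 0 < CT.
Hypothesis lamE : lam = lambda_choice lb kappa Delta M eps.
(* A consequence of [1 <= T <= CT * Delta * sqrt M * eps ^ (-3/2)]: [M] cannot be
   polynomially small. *)
Hypothesis M_lower : eps ^+ 3 <= CT ^+ 2 * Delta ^+ 2 * M.

(** The argument of the polylogarithm in the theorem. All summands are positive or nonnegative, so
    each is below the sum. *)
Definition problem_size : R :=
  2 + kappa + lb + lb^-1 + mR + eps + eps^-1 + Delta + Delta^-1 + Rad.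
Let X := problem_size.
(** The factor gives degree 1 to [CT] and to numerals up to 25, the largest being the square of 5 in
    the bound on [C2]. *)
Let Z := (25 + CT) * X.

Let ell0 : 0 < ell. Proof. exact: lt_le_trans muell. Qed.
Let lb0 : 0 < lb. Proof. exact: lt_le_trans elllb. Qed.
Let lam0 : 0 < lam. Proof. by apply: lt_le_trans lam2. Qed.
Let kappa1 : 1 <= kappa.
Proof. by rewrite kappaE ler_pdivlMr // mul1r (le_trans muell). Qed.
Let kappa0 : 0 < kappa. Proof. exact: lt_le_trans kappa1. Qed.

Let lbV0 : 0 < lb^-1. Proof. by rewrite invr_gt0. Qed.
Let epsV0 : 0 < eps^-1. Proof. by rewrite invr_gt0. Qed.
Let DeltaV0 : 0 < Delta^-1. Proof. by rewrite invr_gt0. Qed.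

Lemma problem_size_ge2 : 2 <= X.
Proof.
rewrite /X /problem_size; move: kappa0 lb0 lbV0 eps0 epsV0 Delta0 DeltaV0 mR1 Rad0.
by move: (lb^-1) (eps^-1) (Delta^-1) => *; lra.
Qed.

Let XZ q : 0 <= q -> q <= X -> poly_le Z 1 q.
Proof.
move=> q0 qX; rewrite /poly_le q0 /= expr1 (le_trans qX) // /Z ler_peMl //.
  by apply: le_trans problem_size_ge2.
by rewrite ler_wpDr ?(ltW CT0) // ler1n.
Qed.

Let Zc : 25 + CT <= Z.
Proof.
rewrite /Z ler_peMr ?addr_ge0 ?ler0n ?(ltW CT0) //.
by apply: le_trans problem_size_ge2; rewrite ler1n.
Qed.

Let Z2 : 2 <= Z.
Proof. by apply: le_trans Zc; rewrite ler_wpDr ?(ltW CT0) // ler_nat. Qed.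

Let pbc (n : nat) : (n <= 25)%N -> poly_le Z 1 n%:R.
Proof.
move=> nc; rewrite /poly_le ler0n /= expr1 (le_trans _ Zc) //.
by rewrite ler_wpDr ?(ltW CT0) // ler_nat.
Qed.

Let comp q : 0 <= q -> 0 <= X - q -> poly_le Z 1 q.
Proof. by move=> q0; rewrite subr_ge0; exact: XZ. Qed.

Ltac component := apply: comp; [by (exact: Rad0 || exact: ltW)|rewrite /X /problem_size;
  have := kappa0; have := lb0; have := lbV0; have := eps0; have := epsV0;
  have := Delta0; have := DeltaV0; have := mR1; have := Rad0;
  move: (lb^-1) (eps^-1) (Delta^-1) => *; lra].

Let pb_kappa : poly_le Z 1 kappa. Proof. component. Qed.
Let pb_lb : poly_le Z 1 lb. Proof. component. Qed.
Let pb_epsV : poly_le Z 1 eps^-1. Proof. component. Qed.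
Let pb_Delta : poly_le Z 1 Delta. Proof. component. Qed.
Let pb_DeltaV : poly_le Z 1 Delta^-1. Proof. component. Qed.
Let pb_Rad : poly_le Z 1 Rad. Proof. component. Qed.
Let pb_CT : poly_le Z 1 CT.
Proof. by rewrite /poly_le (ltW CT0) expr1 (le_trans _ Zc) // lerDr ler0n. Qed.
Let pb_ell : poly_le Z 1 ell.
Proof. exact: poly_le_trans (ltW ell0) elllb pb_lb. Qed.
Let pb_rho : poly_le Z 1 rho.
Proof. exact: poly_le_trans (ltW rho0) rholb pb_lb. Qed.

(** Degree 7 is 2 for [CT], 2 for [Delta] and 3 for the inverse accuracy in [M_lower]. *)
Let pb_MV : poly_le Z 7 M^-1.
Proof.
apply: (@poly_le_trans _ _ _ _ (CT ^+ 2 * Delta ^+ 2 * eps^-1 ^+ 3)).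
- by rewrite invr_ge0 ltW.
- have -> : CT ^+ 2 * Delta ^+ 2 * eps^-1 ^+ 3 =
      CT ^+ 2 * Delta ^+ 2 * M * (M^-1 * eps^-1 ^+ 3) by field; rewrite !gt_eqF.
  have {1}-> : M^-1 = eps ^+ 3 * (M^-1 * eps^-1 ^+ 3) by field; rewrite !gt_eqF.
  by rewrite ler_wpM2r // mulr_ge0 ?exprn_ge0 ?ltW // invr_gt0.
exact: (poly_leM (poly_leM (poly_leX Z2 2 pb_CT) (poly_leX Z2 2 pb_Delta)) (poly_leX Z2 3 pb_epsV)).
Qed.

Let q := Num.sqrt (M * eps).
Let q0 : 0 < q. Proof. by rewrite sqrtr_gt0 mulr_gt0. Qed.

Let pb_qV : poly_le Z 9 q^-1.
Proof.
apply: (@poly_le_trans _ _ _ _ (1 + M^-1 * eps^-1)).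
- by rewrite invr_ge0 ltW.
- have -> : M^-1 * eps^-1 = q^-1 ^+ 2.
    by rewrite exprVn sqr_sqrtr ?mulr_ge0 ?ltW // invfM.
  have := sqr_ge0 (q^-1 - 1); have : 0 <= q^-1 by rewrite invr_ge0 ltW.
  by move: (q^-1) => *; lra.
exact: (poly_leD Z2 (pbc (n := 1) isT) (poly_leM pb_MV pb_epsV)).
Qed.

Let pb_lam : poly_le Z 15 lam.
Proof.
rewrite lamE /lambda_choice; apply: poly_le_max; last apply: poly_le_max.
- apply: (poly_le_mono Z2 (i := 4)) => //.
  exact: (poly_leM (poly_leM pb_lb (poly_leX Z2 2 pb_kappa)) pb_DeltaV).
- apply: (poly_le_mono Z2 (i := 5)) => //.
  exact: (poly_leM (poly_leM pb_lb (poly_leX Z2 3 pb_kappa)) pb_epsV).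
exact: (poly_leM (poly_leM pb_lb (poly_leX Z2 5 pb_kappa)) pb_qV).
Qed.

Let pb_C2 : poly_le Z 20 (C2 mu ell rho lam).
Proof.
have r : ell / mu <= kappa by rewrite kappaE ler_pM2r // invr_gt0.
apply: (@poly_le_trans _ _ _ _ (2 * lam * rho * (25 * kappa ^+ 2))).
- exact: ltW (C2_gt0 mu0 muell rho0 lam2).
- rewrite (C2_factor ell rho mu0 lam2).
  have le : 1 + (1 + lam) * ell / (lam * mu / 2) <= 5 * kappa.
    have -> : (1 + lam) * ell / (lam * mu / 2) = 2 * (ell / mu) * ((1 + lam) / lam).
      by field; rewrite !gt_eqF.
    have l2 : (1 + lam) / lam <= 3 / 2 by rewrite ler_pdivrMr //; move: lam2; lra.
    have A1 := ler_wpM2l (mulr_ge0 (ler0n _ 2) (divr_ge0 (ltW ell0) (ltW mu0))) l2.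
    by move: A1 r kappa1; lra.
  have -> : 25 * kappa ^+ 2 = (5 * kappa) ^+ 2 by ring.
  have p0 : 0 <= 1 + (1 + lam) * ell / (lam * mu / 2).
    apply: addr_ge0 => //; apply: divr_ge0; first by rewrite mulr_ge0 ?addr_ge0 ?ltW.
    by rewrite divr_ge0 // mulr_ge0 ?ltW.
  apply: ler_pM.
  + by rewrite mulr_ge0 ?addr_ge0 ?ltW.
  + exact: exprn_ge0.
  + by rewrite ler_wpM2r ?(ltW rho0) //; move: lam2; lra.
  by rewrite ler_pXn2r ?nnegrE // (le_trans p0).
exact: (poly_leM (poly_leM (poly_leM (pbc (n := 2) isT) pb_lam) pb_rho)
  (poly_leM (pbc (n := 25) isT) (poly_leX Z2 2 pb_kappa))).
Qed.

Let epst := eps_inner mu ell rho lam M eps.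
Let epst0 : 0 < epst.
Proof. exact: eps_inner_gt0 mu0 muell rho0 lam2 M0 eps0. Qed.

Let pb576 : poly_le Z 2 (576%:R : R).
Proof.
have -> : (576%:R : R) = 24%:R * 24%:R by rewrite -natrM.
exact: (poly_leM (pbc (n := 24) isT) (pbc (n := 24) isT)).
Qed.

Let pb288 : poly_le Z 2 (288%:R : R).
Proof.
have -> : (288%:R : R) = 12%:R * 24%:R by rewrite -natrM.
exact: (poly_leM (pbc (n := 12) isT) (pbc (n := 24) isT)).
Qed.

Let pb_epstV : poly_le Z 32 epst^-1.
Proof.
rewrite /epst /eps_inner; case: (leP (576^-1 * eps / (4 * lam * ell)) _) => _.
  apply: (poly_le_mono Z2 (i := 20)) => //.
  rewrite !invfM !invrK.
  have := poly_leM (poly_leM pb576 pb_epsV)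
    (poly_leM (poly_leM (pbc (n := 4) isT) pb_lam) pb_ell).
  exact.
rewrite !invfM !invrK.
have := poly_leM (poly_leM pb288 pb_qV)
  (poly_leM (pbc (n := 2) isT) pb_C2).
exact.
Qed.

Let pb_sqrt : poly_le Z 3 (Num.sqrt (3 * kappa + 1)).
Proof.
apply: (@poly_le_trans _ _ _ _ (3 * kappa + 1)); first exact: sqrtr_ge0.
  rewrite -[leRHS]sqr_sqrtr; last by move: kappa0; lra.
  rewrite expr2 ler_peMl ?sqrtr_ge0 // -[leLHS]sqrtr1 ler_wsqrtr //; have := kappa0; lra.
exact: (poly_leD Z2 (poly_leM (pbc (n := 3) isT) pb_kappa) (pbc (n := 1) isT)).
Qed.

Lemma inner_arg0_le : poly_le Z 49 (Num.sqrt (3 * kappa + 1) / epst * Rad).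
Proof.
apply: (poly_le_mono Z2 (i := 36)) => //.
exact: (poly_leM (poly_leM pb_sqrt pb_epstV) pb_Rad).
Qed.

(** The step is bounded through [s <= 1 + s^3], so no cube root is taken. The degree 49 is common to
    the first and the later iterations. *)
Lemma inner_argS_le s : 0 <= s -> s ^+ 3 <= 15 * Delta / M ->
  poly_le Z 49 (Num.sqrt (3 * kappa + 1) / epst * (epst + 4 * kappa * s)).
Proof.
move=> s0 s3.
have pb_s : poly_le Z 10 s.
  apply: (@poly_le_trans _ _ _ _ (1 + 15 * Delta / M)) => //.
    apply: (@le_trans _ _ (1 + s ^+ 3)); last by rewrite lerD2l.
    have := sqr_ge0 (s - 1); have := exprn_ge0 3 s0; have [s1|s1] := leP s 1; first by lra.
    have : 0 <= (s - 1) * (s * (s + 1)).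
      apply: mulr_ge0; first by rewrite subr_ge0 ltW.
      by apply: mulr_ge0 => //; apply: addr_ge0.
    lra.
  exact: (poly_leD Z2 (pbc (n := 1) isT)
    (poly_leM (poly_leM (pbc (n := 15) isT) pb_Delta) pb_MV)).
have -> : Num.sqrt (3 * kappa + 1) / epst * (epst + 4 * kappa * s) =
    Num.sqrt (3 * kappa + 1) * (1 + 4 * kappa * s / epst).
  by field; rewrite gt_eqF.
apply: (poly_le_mono Z2 (i := 48)) => //.
exact: (poly_leM pb_sqrt (poly_leD Z2 (pbc (n := 1) isT)
  (poly_leM (poly_leM (poly_leM (pbc (n := 4) isT) pb_kappa) pb_s) pb_epstV))).
Qed.

(** A degree becomes a factor under the logarithm, and [ln (25 + CT)] is absorbed by [ln X >= ln 2].
    Hence a single power of the logarithm. *)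
Lemma ln_poly_le a : poly_le Z 49 a ->
  ln a <= 49 * (ln (25 + CT) / ln 2 + 1) * ln X.
Proof.
move=> /andP[a0 aZ].
have X2 := problem_size_ge2.
have X0 : 0 < X by apply: lt_le_trans X2; rewrite ltr0n.
have c0 : 0 < 25 + CT by apply: addr_gt0; rewrite ?ltr0n.
have Z0 : 0 < Z by rewrite mulr_gt0.
have l2 : 0 < ln (2 : R) by rewrite ln_gt0 // ltr1n.
have lX : ln 2 <= ln X by rewrite ler_ln // posrE ltr0n.
have lc : 0 <= ln (25 + CT).
  by apply: ln_ge0; rewrite ler_wpDr ?(ltW CT0) // ler1n.
have lZ : ln Z <= (ln (25 + CT) / ln 2 + 1) * ln X.
  rewrite /Z lnM ?posrE // mulrDl mul1r lerD2r.
  rewrite -mulrA ler_peMr // ler_pdivlMl // mulr1 //.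
have lZ0 : 0 <= ln Z by apply: ln_ge0; apply: le_trans Z2; rewrite ler1n.
rewrite -mulrA; apply: (le_trans _ (ler_wpM2l (ler0n _ 49) lZ)).
have [->|an0] := eqVneq a 0; first by rewrite ln0 // mulr_ge0.
rewrite mulr_natl -lnXn // ler_ln ?posrE ?exprn_gt0 // lt_def an0 //.
Qed.

End InnerCost.

(** * Convergence *)

Section HalfPowers.
Variables (R : realType) (x : R).
Hypothesis x0 : 0 < x.

Lemma powR_half : x `^ (1 / 2) = Num.sqrt x.
Proof. by rewrite mul1r powR12_sqrt // ltW. Qed.

Lemma powR_neg_half : x `^ (- (1 / 2)) = (Num.sqrt x)^-1.
Proof. by rewrite powRN powR_half. Qed.

Lemma powR_five_halves : x `^ (5 / 2) = x ^+ 2 * Num.sqrt x.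
Proof.
have -> : 5 / 2 = 2%:R + 1 / 2 :> R by field.
by rewrite powRD ?(gt_eqF x0) ?implybT // powR_mulrn ?ltW // powR_half.
Qed.

Lemma powR_neg_three_halves : x `^ (- (3 / 2)) = x^-1 * (Num.sqrt x)^-1.
Proof.
have -> : 3 / 2 = 1%:R + 1 / 2 :> R by field.
rewrite powRN powRD ?(gt_eqF x0) ?implybT // powR_mulrn ?ltW // powR_half expr1.
by rewrite invfM.
Qed.

End HalfPowers.

(* [0 <= c] covers the junk value [inf set0 = 0] taken when [n = 0]. *)
Lemma lambda_min_ge (R : realType) n (A : 'M[R]_n) c : 0 <= c ->
  (forall v, - c * enorm v ^+ 2 <= dot v (A *m v)) -> - c <= lambda_min A.
Proof.
move=> c0 cA; rewrite /lambda_min.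
have [->|/set0P[a aE]] := eqVneq [set a | eigenvalue A a] set0.
  by rewrite inf0 oppr_le0.
apply: lb_le_inf; first by exists a.
move=> b /= /eigenvalueP[v vA v0].
have w0 : 0 < enorm v^T.
  rewrite lt_def enorm_ge0 andbT; apply: contra v0 => /eqP/enorm0_eq0 vT0.
  by rewrite -[v]trmxK vT0 trmx0.
have := cA v^T; rewrite -dotE trmxK mulmxA vA -scalemxAl mxE -[v in v *m _]trmxK dotE.
by rewrite -enorm_sqr ler_pM2r // exprn_gt0.
Qed.

Section Convergence.
Variables (R : realType) (dx dy : nat) (f g : 'cV[R]_(dx + dy) -> R).
Variables (mu C ell rho nu : R) (x0 : 'cV[R]_dx) (eps M rhobar : R) (m T N : nat).
Variables (xs : nat -> 'cV[R]_dx) (ys ws : nat -> 'cV[R]_dy) (ss : nat -> 'cV[R]_dx).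
Local Notation lb := (ellbar C ell rho nu).
Local Notation kappa := (lb / mu).
Local Notation phi := (hyperobj f g).
Local Notation Delta := (phi x0 - hyperobj_inf f g).
Local Notation lam := (lambda_choice lb kappa Delta M eps).
Local Notation Rad := (Num.max (enorm (ystar g x0)) (enorm (ylam f g lam x0))).
Local Notation epst := (eps_inner mu ell rho lam M eps).
Local Notation K := (inner_steps kappa (3 * kappa) epst Rad ss).
Hypothesis dx0 : (0 < dx)%N.
Hypothesis dy0 : (0 < dy)%N.
Hypothesis sa : standing_assumption f g mu C ell rho nu.
Hypothesis eps0 : 0 < eps.
Hypothesis m0 : (0 < m)%N.
Hypothesis Delta0 : 0 < Delta.
Hypothesis M0 : 0 < M.
Hypothesis lamL : 2 * ell / mu <= lam.
Hypothesis rbF : lipschitz_hess rhobar (penalty_opt f g lam).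
Hypothesis Mrb : 100 * m%:R * rhobar <= M.
Hypothesis run : lfsba_run f g lam M rhobar eps m T kappa ell (3 * kappa)
  ((1 + lam) * ell) K K x0 xs ys ws ss N.

Lemma ellbar_ge : [/\ C <= lb, ell <= lb, rho <= lb & nu <= lb].
Proof. by split; rewrite /ellbar !le_max lexx /= ?orbT. Qed.

Let reg : regular f g mu C ell rho nu. Proof. exact: standing_regular. Qed.
Let muell : mu <= ell. Proof. exact: (standing_mu_le dy0 sa). Qed.
Let mu0 : 0 < mu. Proof. exact: sa_mu sa. Qed.
Let ell0 : 0 < ell. Proof. exact: lt_le_trans muell. Qed.
Let rho0 : 0 < rho. Proof. exact: sa_rho sa. Qed.
Let ell_le : ell <= lb. Proof. by have [] := ellbar_ge. Qed.
Let rho_le : rho <= lb. Proof. by have [] := ellbar_ge. Qed.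
Let nu_le : nu <= lb. Proof. by have [] := ellbar_ge. Qed.
Let C_le : C <= lb. Proof. by have [] := ellbar_ge. Qed.
Let lb0 : 0 < lb. Proof. exact: lt_le_trans ell_le. Qed.

Lemma lambda_ge2 : 2 <= lam.
Proof.
apply: le_trans lamL; rewrite ler_pdivlMr //.
by move: muell; lra.
Qed.

Let lam2 := lambda_ge2.
Let lam0 : 0 < lam. Proof. by apply: lt_le_trans lam2. Qed.
Let lamL' : 2 * ell <= lam * mu. Proof. by rewrite -ler_pdivrMr. Qed.

Let rb0 : 0 <= rhobar.
Proof.
pose u : 'cV[R]_dx := delta_mx (Ordinal dx0) 0.
have u1 : enorm u = 1.
  by apply/eqP; rewrite -(@eqrXn2 _ 2) // enorm_sqr dot_delta mxE !eqxx expr1n.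
by have := lipschitz_hess_ge0 0 u rbF; rewrite u1 mulr1.
Qed.

Local Notation F := (penalty_opt f g lam).
Let e := Num.sqrt (eps / M).
Let e0 : 0 < e. Proof. exact: step_scale_gt0. Qed.
Let Me2 : M * e ^+ 2 = eps. Proof. exact: step_scale_sqr. Qed.
Let epst0 : 0 < epst.
Proof. exact: (eps_inner_gt0 mu0 muell rho0 lam2 M0 eps0). Qed.

Lemma run_inner t : (t < N)%N ->
  enorm (ws t - ystar g (xs t)) <= epst /\
  enorm (ys t - ylam f g lam (xs t)) <= epst.
Proof.
have kL : ell / mu <= kappa by rewrite ler_pM2r // invr_gt0.
have R1 : enorm (ystar g x0) <= Rad by rewrite le_max lexx.
have R2 : enorm (ylam f g lam x0) <= Rad by rewrite le_max lexx orbT.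
exact: (inner_accuracy reg muell kL lam2 lamL' epst0 R1 R2 run).
Qed.

Lemma run_grad t : (t < N)%N ->
  enorm (gest f g lam (xs t) (ys t) (ws t) - grad F (xs t)) <= M * e ^+ 2 / 576.
Proof.
move=> /run_inner[Hw Hy]; apply: (le_trans (gest_error reg lam0 lamL' _ _ _)).
by apply: (eps_inner_grad mu0 muell rho0 lam2 M0 eps0); rewrite enorm_ge0.
Qed.

Lemma run_hess t u : (t < N)%N ->
  enorm ((Hest f g lam (xs t) (ys t) (ws t) - hess F (xs t)) *m u) <=
  M * e / 288 * enorm u.
Proof.
move=> /run_inner[Hw Hy]; apply: (le_trans (Hest_error reg lam0 lamL' _ _ _ _)).
rewrite ler_wpM2r //.
by apply: (eps_inner_hess mu0 muell rho0 lam2 M0 eps0); rewrite enorm_ge0.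
Qed.

Let ydelta x := enorm (ylam f g lam x - ystar g x).
Let ydelta0 x : 0 <= ydelta x. Proof. exact: enorm_ge0. Qed.
Let ydeltaC x : lam * mu * ydelta x <= C. Proof. exact: (ylam_dist reg lam0 lamL' x). Qed.

Let lam_lower : [/\ lb * kappa ^+ 2 / Delta <= lam, lb * kappa ^+ 3 / eps <= lam
  & lb * kappa ^+ 5 / Num.sqrt (M * eps) <= lam].
Proof. by split; rewrite /lambda_choice !le_max lexx /= ?orbT. Qed.

(** [F] starts below [phi x0] and stays above [phi - Delta], the gap being at most [Delta] by the
    first entry of [lambda_choice]. *)
Lemma penalty_opt_gap x : F x0 - F x <= 2 * Delta.
Proof.
have /andP[A1 _] := value_compare reg lam0 lamL' x0.
have /andP[_ A2] := value_compare reg lam0 lamL' x.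
have [l1 _ _] := lam_lower.
have := value_gap mu0 muell ell_le (reg_C reg) C_le erefl lam2 (ydelta0 x)
  (ydeltaC x) Delta0 l1.
have : hyperobj_inf f g <= phi x.
  by apply: inf_lbound; [exact: sa_bounded sa|exists x].
rewrite -/(ydelta x) in A2.
by move: (F x0) (F x) (phi x0) (phi x) (hyperobj_inf _ _) (_ * _) A1 A2 => *; lra.
Qed.

Let gs t := gest f g lam (xs t) (ys t) (ws t).
Let Hs t := Hest f g lam (xs t) (ys t) (ws t).
Let CF : C2_smooth F. Proof. exact: (penalty_opt_C2 reg lam0 lamL'). Qed.
Let sH t : (Hs t)^T = Hs t. Proof. exact: (Hest_sym reg lam0 lamL'). Qed.

Lemma run_budget N' : (N' <= N)%N ->
  (forall t, (t < N')%N -> ~ stop_test M rhobar eps m xs ss t) ->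
  14 / 100 * M * \sum_(t < N') enorm (ss t) ^+ 3 <= 2 * Delta.
Proof.
move=> N'N fl.
have fl' t : (t < N')%N -> ~ stop_test M rhobar (M * e ^+ 2) m xs ss t by rewrite Me2; exact: fl.
apply: le_trans (penalty_opt_gap (xs N')).
have := (descent_budget m0 M0 e0 rb0 Mrb CF rbF run_grad (fun t tN u => run_hess u tN)
  (run_s run) (run_x run) N'N fl').
by rewrite (run_init run).
Qed.

Lemma run_fail N' : (N' <= N)%N ->
  (forall t, (t < N')%N -> ~ stop_test M rhobar eps m xs ss t) ->
  N'%:R * e ^+ 3 <= 8 * \sum_(t < N') enorm (ss t) ^+ 3.
Proof.
move=> N'N fl.
have fl' t : (t < N')%N -> ~ stop_test M rhobar (M * e ^+ 2) m xs ss t by rewrite Me2; exact: fl.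
exact: (fail_cube_sum m0 M0 e0 rb0 Mrb (run_x run) N'N fl').
Qed.

(** All iterations before the last fail the test, so the budget bounds each of their steps; [15]
    exceeds [2 / 0.14]. The last step is excluded and determines no further iteration count. *)
Lemma run_step_bound t : (t.+1 < N)%N -> enorm (ss t) ^+ 3 <= 15 * Delta / M.
Proof.
move=> tN.
have B : 14 / 100 * M * \sum_(t < N.-1) enorm (ss t) ^+ 3 <= 2 * Delta.
  by apply: run_budget => [|s sN]; [exact: leq_pred|apply: (run_continue run); rewrite -ltn_predRL].
have t1 : (t < N.-1)%N by rewrite ltn_predRL.
have : enorm (ss t) ^+ 3 <= \sum_(t < N.-1) enorm (ss t) ^+ 3.
  rewrite (bigD1 (Ordinal t1)) //= lerDl sumr_ge0 // => i _.
  exact: exprn_ge0.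
move=> /(ler_wpM2l (ltW M0)) le; rewrite ler_pdivlMr //.
by move: le B Delta0; move: (\sum_(_ < _) _) (_ ^+ 3) Delta => *; lra.
Qed.

Hypothesis Tlower : 200 * (Delta * Num.sqrt M * (eps^-1 * (Num.sqrt eps)^-1)) <= T%:R.

(** If all [N = T] tests failed, then [N M e^3 <= 8 * 2 Delta / 0.14 < 115 Delta], against
    [200 Delta <= T M e^3]. *)
Lemma run_stopped : stop_test M rhobar eps m xs ss N.-1.
Proof.
have [NT|//] := run_halt run.
apply: contrapT => ns.
have fl t : (t < N)%N -> ~ stop_test M rhobar eps m xs ss t.
  have [tN _|tN tN'] := ltnP t.+1 N; first exact: (run_continue run).
  have -> // : t = N.-1.
  by apply/eqP; rewrite -eqSS prednK ?(leq_trans _ tN') // eqn_leq tN tN'.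
have B := run_budget (leqnn N) fl; have A := run_fail (leqnn N) fl.
have se : M * e ^+ 3 = eps * Num.sqrt eps / Num.sqrt M.
  rewrite /e sqrtrM ?(ltW eps0) // sqrtrV ?(ltW M0) //.
  have := sqr_sqrtr (ltW M0); have := sqr_sqrtr (ltW eps0).
  have : 0 < Num.sqrt M by rewrite sqrtr_gt0.
  move: (Num.sqrt M) (Num.sqrt eps) => a b a0 <- <-.
  by field; rewrite gt_eqF.
have := Tlower; rewrite -NT => A2.
have Me3 : 0 < M * e ^+ 3 by rewrite mulr_gt0 ?exprn_gt0.
have := ler_wpM2r (ltW Me3) A2; rewrite {1}se.
have -> : 200 * (Delta * Num.sqrt M * (eps^-1 * (Num.sqrt eps)^-1)) *
    (eps * Num.sqrt eps / Num.sqrt M) = 200 * Delta.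
  by field; rewrite !gt_eqF ?sqrtr_gt0.
have := ler_wpM2l (ltW M0) A.
move: B Delta0; move: (\sum_(_ < _) _) Delta => S D B D0.
by lra.
Qed.

Let Npos : (0 < N)%N. Proof. by have /andP[] := run_N run. Qed.

Lemma output_grad : enorm (grad phi (xs N)) <= 8 * eps.
Proof.
have N1 : (N.-1 < N)%N by rewrite prednK.
have st : stop_test M rhobar (M * e ^+ 2) m xs ss N.-1 by rewrite Me2; exact: run_stopped.
have := newton_final_grad m0 M0 e0 rb0 Mrb CF rbF run_grad
  (fun t tN u => run_hess u tN) sH (run_s run) (run_x run) N1 st.
rewrite (prednK Npos) Me2 => A1.
have A2 := grad_compare reg lam0 lamL' (xs N).
have [_ l2 _] := lam_lower.
have A3 := grad_gap mu0 muell ell_le C_le rho0 rho_le erefl lam2 eps0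
  (ydelta0 (xs N)) (ydeltaC (xs N)) l2.
have := le_trans A2 A3; rewrite enormBC => A4.
have := enormD (grad phi (xs N) - grad F (xs N)) (grad F (xs N)); rewrite subrK => A5.
apply: (le_trans A5); apply: (le_trans (lerD A4 A1)).
by rewrite -mulrDl -natrD.
Qed.

Lemma output_hess v : - (19 * (M * e)) * enorm v ^+ 2 <= dot v (hess phi (xs N) *m v).
Proof.
have N1 : (N.-1 < N)%N by rewrite prednK.
have st : stop_test M rhobar (M * e ^+ 2) m xs ss N.-1 by rewrite Me2; exact: run_stopped.
have := newton_final_hess m0 M0 e0 rb0 Mrb rbF
  (fun t tN u => run_hess u tN) sH (run_s run) (run_x run) v N1 st.
rewrite (prednK Npos) => A1.
have A2 := hess_compare reg lam0 lamL' (xs N) v.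
have [_ _ l3] := lam_lower.
have A3 := hess_gap mu0 muell ell_le C_le rho0 rho_le (reg_nu reg) nu_le erefl lam2 M0 eps0
  (ydelta0 (xs N)) (ydeltaC (xs N)) l3.
have A4 := ler_wpM2r (exprn_ge0 2 (enorm_ge0 v)) A3.
have A5 := le_trans A1 A2.
rewrite -lerBlDr in A5; apply: (le_trans _ (le_trans (lerB (lexx _) A4) A5)).
rewrite -mulrBl ler_wpM2r ?exprn_ge0 // le_eqVlt; apply/orP; left; apply/eqP.
by move: (M * e) => a; clear; ring.
Qed.

Variables (CM CT : R).
Hypothesis CM0 : 0 < CM.
Hypothesis CT0 : 0 < CT.
Hypothesis M_upper : M <= CM * m%:R * (lb * kappa ^+ 5).
Hypothesis T_upper : T%:R <= CT * (Delta * Num.sqrt M * (eps^-1 * (Num.sqrt eps)^-1)).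

Let kappa0 : 0 < kappa. Proof. exact: divr_gt0. Qed.
Let kappa1 : 1 <= kappa.
Proof. by rewrite ler_pdivlMr // mul1r (le_trans muell). Qed.
Let mR0 : 0 < (m%:R : R). Proof. by rewrite ltr0n. Qed.
Let sM0 : 0 < Num.sqrt M. Proof. by rewrite sqrtr_gt0. Qed.
Let se0 : 0 < Num.sqrt eps. Proof. by rewrite sqrtr_gt0. Qed.
Let rate0 : 0 < eps^-1 * (Num.sqrt eps)^-1. Proof. by rewrite mulr_gt0 ?invr_gt0. Qed.

Let N_le_T : (N%:R : R) <= T%:R.
Proof. by have /andP[_ NT] := run_N run; rewrite ler_nat. Qed.

(** At least one iteration is performed, so the upper bound on [T] is at least 1; squaring it bounds
    [M] from below. *)
Lemma accuracy_le_M : eps ^+ 3 <= CT ^+ 2 * Delta ^+ 2 * M.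
Proof.
have N1 : 1 <= (N%:R : R) by rewrite ler1n.
have := le_trans (le_trans N1 N_le_T) T_upper.
have p0 : 0 < eps * Num.sqrt eps by rewrite mulr_gt0.
move=> /(ler_wpM2l (ltW p0)); rewrite mulr1.
have -> : eps * Num.sqrt eps * (CT * (Delta * Num.sqrt M * (eps^-1 / Num.sqrt eps))) =
    CT * Delta * Num.sqrt M.
  by move: Delta => D; field; rewrite !gt_eqF.
move=> le.
have -> : eps ^+ 3 = (eps * Num.sqrt eps) ^+ 2.
  by rewrite exprMn sqr_sqrtr ?(ltW eps0) // -exprSr.
have -> : CT ^+ 2 * Delta ^+ 2 * M = (CT * Delta * Num.sqrt M) ^+ 2.
  by rewrite [RHS]exprMn sqr_sqrtr ?(ltW M0) // exprMn.
rewrite ler_pXn2r ?nnegrE ?(ltW p0) //.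
by apply: mulr_ge0; [apply: mulr_ge0; exact: ltW|exact: ltW].
Qed.

Lemma sqrt_M_le :
  Num.sqrt M <= Num.sqrt CM * (kappa ^+ 2 * Num.sqrt kappa * Num.sqrt lb * Num.sqrt m%:R).
Proof.
have le := ler_wsqrtr M_upper; apply: (le_trans le).
rewrite -mulrA sqrtrM ?(ltW CM0) // sqrtrM ?(ltW mR0) // sqrtrM ?(ltW lb0) //.
have -> : Num.sqrt (kappa ^+ 5) = kappa ^+ 2 * Num.sqrt kappa.
  have -> : kappa ^+ 5 = (kappa ^+ 2) ^+ 2 * kappa by ring.
  by rewrite sqrtrM ?sqr_ge0 // sqrtr_sqr ger0_norm // sqr_ge0.
rewrite le_eqVlt; apply/orP; left; apply/eqP.
move: (Num.sqrt CM) (Num.sqrt m%:R) (Num.sqrt kappa) (Num.sqrt lb) kappa => *.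
by clear; ring.
Qed.

(** The iteration order, once [sqrt M] is replaced by its bound in [kappa], [lb] and [m]. *)
Let W := Delta * (kappa ^+ 2 * Num.sqrt kappa) * Num.sqrt lb * Num.sqrt m%:R
         * (eps^-1 * (Num.sqrt eps)^-1).

Lemma iterations_le : N%:R <= CT * Num.sqrt CM * W.
Proof.
apply: (le_trans N_le_T); apply: (le_trans T_upper).
have := ler_wpM2l (ltW CT0) (ler_wpM2r (ltW rate0) (ler_wpM2l (ltW Delta0) sqrt_M_le)).
move=> le; apply: (le_trans le); rewrite /W le_eqVlt; apply/orP; left; apply/eqP.
move: Delta kappa lb (Num.sqrt kappa) (Num.sqrt lb) (Num.sqrt CM) (eps^-1 * _) => *.
by clear; ring.
Qed.

Let X := problem_size lb kappa eps Delta Rad m%:R.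
Let c := 49 * (ln (25 + CT) / ln 2 + 1).

Let Rad0 : 0 <= Rad. Proof. by rewrite le_max enorm_ge0. Qed.
Let mR1 : 1 <= (m%:R : R). Proof. by rewrite ler1n. Qed.

Lemma lnX_ge : ln 2 <= ln X.
Proof.
have X2 : 2 <= X := problem_size_ge2 mu0 muell ell_le erefl eps0 Delta0 Rad0 mR1.
by rewrite ler_ln // posrE ?(lt_le_trans _ X2) // ltr0n.
Qed.

Let ln20 : 0 < ln (2 : R). Proof. by rewrite ln_gt0 // ltr1n. Qed.
Let c0 : 0 <= c.
Proof.
rewrite mulr_ge0 // addr_ge0 // divr_ge0 ?(ltW ln20) //.
by apply: ln_ge0; rewrite ler_wpDr ?(ltW CT0) // ler1n.
Qed.

Let lnX0 : 0 <= ln X. Proof. exact: le_trans (ltW ln20) lnX_ge. Qed.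

Lemma inner_steps_le t : (t < N)%N ->
  (K t)%:R <= 2 * Num.sqrt (3 * kappa) * (c * ln X) + 1.
Proof.
move=> tN; have s0 : 0 <= 2 * Num.sqrt (3 * kappa) by rewrite mulr_ge0 ?sqrtr_ge0.
apply: natceil_le_max; last by apply: mulr_ge0 => //; exact: mulr_ge0.
apply: (ler_wpM2l s0).
apply: (ln_poly_le mu0 muell ell_le erefl eps0 Delta0 Rad0 mR1 CT0).
case: t tN => [|t] tN.
  exact: (inner_arg0_le mu0 muell ell_le rho0 rho_le erefl lam2 M0 eps0 Delta0 Rad0 mR1 CT0
    erefl accuracy_le_M).
exact: (inner_argS_le mu0 muell ell_le rho0 rho_le erefl lam2 M0 eps0 Delta0 Rad0 mR1 CT0
    erefl accuracy_le_M (enorm_ge0 _) (run_step_bound tN)).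
Qed.

(** An iteration costs [3 K + 3]. The [+ 1] in the bound on [K] and the final 3 give the constant 6,
    absorbed through [ln X >= ln 2]. *)
Lemma first_order_le :
  (first_order_calls K K N)%:R <=
  CT * Num.sqrt CM * (12 * c + 6 / ln 2) * (W * Num.sqrt kappa) * ln X.
Proof.
have sk1 : 1 <= Num.sqrt kappa by rewrite -[leLHS]sqrtr1 ler_wsqrtr.
have sk0 : 0 <= Num.sqrt kappa by rewrite sqrtr_ge0.
have s3 : Num.sqrt (3 * kappa) <= 2 * Num.sqrt kappa.
  rewrite sqrtrM ?ler0n // ler_wpM2r //.
  rewrite -(@ler_pXn2r _ 2) ?nnegrE ?sqrtr_ge0 // sqr_sqrtr //; lra.
have lX := lnX_ge; have lX0 := lnX0.
have one : 1 <= Num.sqrt kappa * (ln X / ln 2).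
  by rewrite -[leLHS](mulr1 1) ler_pM // ler_pdivlMr // mul1r.
have step t : (t < N)%N -> (K t + 2 * K t + 3)%N%:R <=
    (12 * c + 6 / ln 2) * Num.sqrt kappa * ln X.
  move=> tN; have Kt := inner_steps_le tN.
  have A1 : 2 * Num.sqrt (3 * kappa) * (c * ln X) <=
      2 * (2 * Num.sqrt kappa) * (c * ln X).
    exact: (ler_wpM2r (mulr_ge0 c0 lnX0) (ler_wpM2l (ler0n R 2) s3)).
  rewrite (natrD _ (K t + 2 * K t)%N 3) (natrD _ (K t) (2 * K t)%N) natrM; move: Kt A1 one.
  have -> : (12 * c + 6 / ln 2) * Num.sqrt kappa * ln X =
    12 * (Num.sqrt kappa * (c * ln X)) + 6 * (Num.sqrt kappa * (ln X / ln 2)) by ring.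
  have -> : 2 * (2 * Num.sqrt kappa) * (c * ln X) = 4 * (Num.sqrt kappa * (c * ln X)) by ring.
  move: (Num.sqrt kappa * (c * ln X)) (Num.sqrt kappa * (ln X / ln 2)) ((K t)%:R : R).
  move: (2 * _ * (c * ln X)) => a b d k; lra.
rewrite /first_order_calls natr_sum.
apply: (@le_trans _ _ (N%:R * ((12 * c + 6 / ln 2) * Num.sqrt kappa * ln X))).
  have -> : N%:R * ((12 * c + 6 / ln 2) * Num.sqrt kappa * ln X) =
      \sum_(t < N) ((12 * c + 6 / ln 2) * Num.sqrt kappa * ln X).
    by rewrite sumr_const card_ord mulr_natl.
  by apply: ler_sum => t _; exact: (step t (ltn_ord t)).
have q0 : 0 <= (12 * c + 6 / ln 2) * Num.sqrt kappa * ln X.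
  exact: (mulr_ge0 (mulr_ge0 (addr_ge0 (mulr_ge0 (ler0n R 12) c0)
    (divr_ge0 (ler0n R 6) (ltW ln20))) sk0) lnX0).
apply: (le_trans (ler_wpM2r q0 iterations_le)).
rewrite le_eqVlt; apply/orP; left; apply/eqP.
by move: W (ln X) (Num.sqrt kappa) (Num.sqrt CM) c (6 / ln 2) => *; clear; ring.
Qed.

Lemma second_order_le :
  (second_order_calls m N)%:R <=
  (9 + 9 * (CT * Num.sqrt CM)) * (1 + W / m%:R).
Proof.
(* The multiples of [m] below [N], with 0 included, number the ceiling of [N / m]; this is the
   source of the additive 1. *)
have count : second_order_calls m N = (9 * (N %/ m + ~~ (m %| N)))%N.
  rewrite /second_order_calls; elim: N => [|n IH].
    by rewrite big_ord0 div0n dvdn0 muln0.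
  rewrite big_mkcond big_ord_recr /= -big_mkcond /= IH divnS //.
  by case: (m %| n)%N; case: (m %| n.+1)%N; rewrite ?addn0 ?add0n ?addn1 ?add1n ?mulnSr.
have le1 : ((N %/ m + ~~ (m %| N))%N%:R : R) <= N%:R / m%:R + 1.
  rewrite natrD lerD //; last by rewrite -[1]/(1%:R) ler_nat leq_b1.
  by rewrite ler_pdivlMr // -natrM ler_nat leq_trunc_div.
have W0 : 0 <= W.
  by rewrite /W !mulr_ge0 ?sqrtr_ge0 ?exprn_ge0 ?invr_ge0 ?sqrtr_ge0 ?ltW.
have Wm0 : 0 <= W / m%:R by rewrite divr_ge0.
have le2 : N%:R / m%:R <= CT * Num.sqrt CM * (W / m%:R).
  by rewrite mulrA ler_wpM2r ?iterations_le // invr_ge0.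
have c1 : 0 <= CT * Num.sqrt CM by rewrite mulr_ge0 ?sqrtr_ge0 // ltW.
rewrite count natrM; apply: (le_trans (ler_wpM2l (ler0n _ 9) le1)).
move: Wm0 le2 c1; move: (CT * Num.sqrt CM) (W / m%:R) (N%:R / m%:R) => a b d; lra.
Qed.

Lemma sqrt_Meps_le : M * e <= Num.sqrt CM
  * (kappa ^+ 2 * Num.sqrt kappa * Num.sqrt lb * Num.sqrt m%:R * Num.sqrt eps).
Proof.
rewrite (step_scale_mul M0 eps0) sqrtrM ?(ltW M0) //.
have := ler_wpM2r (ltW se0) sqrt_M_le; rewrite -!mulrA.
exact.
Qed.

End Convergence.

(* cM, CM, cT, CT, A1, ..., A4, p are the absolute constants hidden in the
   asymptotic notations.  M ranges over all values at least cM * m * rhobar,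
   the other constants depending only on upper bounds CM for
   M / (m * ellbar * kappa^5) and CT for the ratio of T to its order. *)
Theorem theorem4p3 (R : realType) :
  exists cM cT : R, 0 < cM /\ 0 < cT /\
  forall CM CT : R, 0 < CM -> 0 < CT ->
  exists (A1 A2 A3 A4 : R) (p : nat),
  forall (dx dy : nat) (f g : 'cV[R]_(dx + dy) -> R) (mu C ell rho nu : R)
    (x0 : 'cV[R]_dx) (eps : R) (m T : nat) (M rhobar : R)
    (xs : nat -> 'cV[R]_dx) (ys ws : nat -> 'cV[R]_dy)
    (ss : nat -> 'cV[R]_dx) (N : nat),
  let lb := ellbar C ell rho nu in
  let kappa := lb / mu in
  let phi := hyperobj f g in
  let Delta := phi x0 - hyperobj_inf f g in
  let lam := lambda_choice lb kappa Delta M eps in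
  let Rad := Num.max (enorm (ystar g x0)) (enorm (ylam f g lam x0)) in
  let kappa2 := 3 * kappa in
  let epst := eps_inner mu ell rho lam M eps in
  let K := inner_steps kappa kappa2 epst Rad ss in
  let Torder := Delta * Num.sqrt M * eps `^ (- (3 / 2)) in
  let polylog := ln (2 + kappa + lb + lb^-1 + m%:R + eps + eps^-1
                     + Delta + Delta^-1 + Rad) ^+ p in
  (0 < dx)%N -> (0 < dy)%N ->
  standing_assumption f g mu C ell rho nu ->
  0 < eps -> (0 < m)%N -> 0 < Delta -> 0 < M ->
  2 * ell / mu <= lam ->
  lipschitz_hess rhobar (penalty_opt f g lam) ->
  cM * m%:R * rhobar <= M -> M <= CM * m%:R * (lb * kappa ^+ 5) ->
  cT * Torder <= T%:R -> T%:R <= CT * Torder ->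
  lfsba_run f g lam M rhobar eps m T kappa ell kappa2 ((1 + lam) * ell) K K
    x0 xs ys ws ss N ->
  [/\ second_order_stationary phi (A1 * eps)
        (A2 * (kappa `^ (5 / 2) * lb `^ (1 / 2) * m%:R `^ (1 / 2)
               * eps `^ (1 / 2)))
        (xs N),
      (first_order_calls K K N)%:R
        <= A3 * (Delta * kappa ^+ 3 * lb `^ (1 / 2) * m%:R `^ (1 / 2)
                 * eps `^ (- (3 / 2))) * polylog &
      (second_order_calls m N)%:R
        <= A4 * (1 + Delta * kappa `^ (5 / 2) * lb `^ (1 / 2)
                     * m%:R `^ (- (1 / 2)) * eps `^ (- (3 / 2)))].
Proof.
exists 100, 200; split; [by rewrite ltr0n|split; first by rewrite ltr0n].
move=> CM CT CM0 CT0.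
(* 8 is 5 for the Newton output plus 3 for the gradient gap, and 19 is 7 plus 12 for the Hessians;
   one power of the logarithm suffices. *)
exists 8, (19 * Num.sqrt CM),
  (CT * Num.sqrt CM * (12 * (49 * (ln (25 + CT) / ln 2 + 1)) + 6 / ln 2)),
  (9 + 9 * (CT * Num.sqrt CM)), 1%N.
move=> dx dy f g mu C ell rho nu x0 eps m T M rhobar xs ys ws ss N.
move=> lb kappa phi Delta lam Rad kappa2 epst K Torder polylog.
move=> dx0 dy0 sa eps0 m0 Delta0 M0 lamL rbF Mrb M_upper T_lower T_upper run.
have mR0 : 0 < (m%:R : R) by rewrite ltr0n.
have mu0 : 0 < mu := sa_mu sa.
have lb0 : 0 < lb.
  by rewrite (lt_le_trans (sa_rho sa)) // /lb /ellbar !le_max lexx !orbT.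
have k0 : 0 < kappa by exact: divr_gt0.
rewrite /Torder (powR_neg_three_halves eps0) in T_lower T_upper.
rewrite (powR_neg_three_halves eps0) (powR_half lb0) (powR_half mR0) (powR_half eps0).
rewrite (powR_five_halves k0) (powR_neg_half mR0).
split.
- split.
    exact: (output_grad dx0 dy0 sa eps0 m0 Delta0 M0 lamL rbF Mrb run T_lower).
  have Me0 : 0 <= 19 * (M * Num.sqrt (eps / M)).
    exact: (mulr_ge0 (ler0n R 19) (mulr_ge0 (ltW M0) (sqrtr_ge0 _))).
  apply: (le_trans _ (lambda_min_ge Me0 _)); last first.
    exact: (output_hess dx0 dy0 sa eps0 m0 Delta0 M0 lamL rbF Mrb run T_lower).
  rewrite lerN2 -(mulrA 19 (Num.sqrt CM)).
  exact: (ler_wpM2l (ler0n R 19) (sqrt_Meps_le dy0 sa eps0 m0 M0 CM0 M_upper)).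
- have := first_order_le dx0 dy0 sa eps0 m0 Delta0 M0 lamL rbF Mrb run CM0 CT0 M_upper T_upper.
  (* The inner loops cost another [sqrt kappa] per iteration, raising [kappa^(5/2)] to [kappa^3]. *)
  have regroup (D s k sl sm r : R) : s ^+ 2 = k ->
      D * (k ^+ 2 * s) * sl * sm * r * s = D * k ^+ 3 * sl * sm * r.
    by move=> <-; ring.
  by rewrite (regroup _ _ _ _ _ _ (sqr_sqrtr (ltW k0))).
have := second_order_le dy0 sa eps0 m0 Delta0 run CM0 CT0 M_upper T_upper.
have regroup (D k sl s mr r : R) : 0 < s -> s ^+ 2 = mr ->
    D * k * sl * s * r / mr = D * k * sl * s^-1 * r.
  by move=> s0 <-; field; rewrite gt_eqF.
by rewrite (regroup _ _ _ _ _ _ _ (sqr_sqrtr (ltW mR0))) // sqrtr_gt0.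
Qed.
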